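(* Let $A$ be a finite dimensional algebra. (1) If $A$ is a monomial quiver algebra, then $A$ is weakly Gorenstein. (2) If $A$ is isomorphic to the endomorphism ring of a module over a representation-finite algebra, then $A$ is weakly Gorenstein.
   Context: Algebras are finite dimensional, connected and non-semisimple over a field $K$; modules are finite dimensional right modules. $D=\operatorname{Hom}_K(-,K)$. A monomial quiver algebra is an algebra $KQ/I$ with $Q$ a finite quiver and $I$ an admissible ideal generated by paths. An algebra is representation-finite if it has only finitely many indecomposable modules up to isomorphism. A module $M$ is Gorenstein-projective if $\operatorname{Ext}_A^i(M,A)=0=\operatorname{Ext}_A^i(\operatorname{Tr}(M),A)$ for all $i\ge1$, where $\operatorname{Tr}$ is the Auslander-Bridger transpose; $M$ is Gorenstein-injective if $D(M)$ is Gorenstein-projective. An algebra $A$ is left weakly Gorenstein if every module $M$ with $\operatorname{Ext}_A^i(M,A)=0$ for all $i\ge1$ is Gorenstein-projective; it is right weakly Gorenstein if every module $M$ with $\operatorname{Ext}_A^i(D(A),M)=0$ for all $i\ge 1$ is Gorenstein-injective; it is weakly Gorenstein if it is both left and right weakly Gorenstein. *)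

(* Defs.v *)
From HB Require Import structures.
From mathcomp Require Import all_boot all_order all_algebra all_field.
From mathcomp Require Import finmap monalg.

Set Implicit Arguments.
Unset Strict Implicit.
Unset Printing Implicit Defensive.

Import GRing.Theory.
Local Open Scope ring_scope.

(* Finite quivers. The nonempty vertex set makes KQ a nonzero ring. *)
Record quiver := Quiver {
  vertex : finType;
  arrow : finType;
  source : arrow -> vertex;
  target : arrow -> vertex;
  vertex_gt0 : (0 < #|vertex|)%N }.

Section Paths.
Variable Q : quiver.
Implicit Types (v : vertex Q) (s t : seq (arrow Q)).

(* [s] is a walk starting at [v], traversed from left to right. A path carries
   its starting vertex, so that there is a trivial path at every vertex. *)
Fixpoint walk v s : bool :=
  if s is a :: s' then (source a == v) && walk (target a) s' else true.

Definition walk_end v s : vertex Q := last v [seq target a | a <- s].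

Record qpath := QPath {
  pval : vertex Q * seq (arrow Q);
  _ : walk pval.1 pval.2 }.
HB.instance Definition _ := [isSub for pval].
HB.instance Definition _ := [Choice of qpath by <:].

Definition pstart (p : qpath) : vertex Q := (val p).1.
Definition parrows (p : qpath) : seq (arrow Q) := (val p).2.
Definition pend (p : qpath) : vertex Q := walk_end (pstart p) (parrows p).

Definition triv_path v : qpath := @QPath (v, [::]) isT.

Lemma arrow_path_subproof (a : arrow Q) : walk (source a) [:: a].
Proof. by rewrite /= eqxx. Qed.
Definition arrow_path (a : arrow Q) : qpath :=
  @QPath (source a, [:: a]) (arrow_path_subproof a).

Definition pcat (p q : qpath) : option qpath :=
  if pend p == pstart q then insub (pstart p, parrows p ++ parrows q) else None.

Lemma walk_cat v s t : walk v (s ++ t) = walk v s && walk (walk_end v s) t.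
Proof. by elim: s v => //= a s IH v; rewrite IH andbA. Qed.

Lemma walk_end_cat v s t : walk_end v (s ++ t) = walk_end (walk_end v s) t.
Proof. by rewrite /walk_end map_cat last_cat. Qed.

Lemma pcat_val p q : omap val (pcat p q) =
  if pend p == pstart q then Some (pstart p, parrows p ++ parrows q) else None.
Proof.
rewrite /pcat; case: eqP => // epq.
have w : walk (pstart p) (parrows p ++ parrows q).
  by rewrite walk_cat (valP p) -/(pend p) epq (valP q).
by case: insubP => [r _ /= ->|] //=; rewrite w.
Qed.

Lemma pcat_SomeP p q r : pcat p q = Some r ->
  [/\ pend p = pstart q, pstart r = pstart p, pend r = pend q
     & parrows r = parrows p ++ parrows q].
Proof.
move=> E; have := pcat_val p q; rewrite E /=; case: eqP => // epq [vr].
have sr : pstart r = pstart p by rewrite /pstart /= vr.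
have ar : parrows r = parrows p ++ parrows q by rewrite /parrows /= vr.
by split=> //; rewrite /pend sr ar walk_end_cat -/(pend p) epq.
Qed.

Lemma pcatA p q r : obind (pcat p) (pcat q r) = obind (pcat^~ r) (pcat p q).
Proof.
have oinj : injective (omap (val : qpath -> vertex Q * seq (arrow Q))).
  by apply: inj_omap; apply: val_inj.
apply: oinj.
case E1: (pcat q r) => [s|] /=; case E2: (pcat p q) => [t|] //=.
- case/pcat_SomeP: E1 => e1 e2 e3 e4; case/pcat_SomeP: E2 => f1 f2 f3 f4.
  by rewrite !pcat_val e2 e4 f2 f3 f4 f1 e1 !eqxx catA.
- case/pcat_SomeP: E1 => e1 e2 e3 e4; have := pcat_val p q.
  by rewrite E2 pcat_val e2 /=; case: eqP.
- case/pcat_SomeP: E2 => f1 f2 f3 f4; have := pcat_val q r.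
  by rewrite E1 pcat_val f3 /=; case: eqP.
Qed.

Lemma pcat1p v p : pcat (triv_path v) p = if v == pstart p then Some p else None.
Proof.
apply: (@inj_omap _ _ val val_inj); rewrite pcat_val.
have -> : pend (triv_path v) = v by [].
by case: eqP => //= ->; case: p => [[]].
Qed.

Lemma pcatp1 p v : pcat p (triv_path v) = if pend p == v then Some p else None.
Proof.
apply: (@inj_omap _ _ val val_inj); rewrite pcat_val.
have -> : pstart (triv_path v) = v by [].
by case: eqP => //= _; rewrite cats0; case: p => [[]].
Qed.

End Paths.

Section PathAlgebra.
Variables (K : fieldType) (Q : quiver).

(* KQ: finite linear combinations of paths. The product p * q is "first p, then
   q" if p ends where q starts, and 0 otherwise. *)
Definition path_algebra := {malg K[qpath Q]}.
HB.instance Definition _ := GRing.Lmodule.on path_algebra.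
Implicit Types (x y z : path_algebra) (p q : qpath Q).

Definition path_vec p : path_algebra := << p >>.

Definition lin_ext (V : lmodType K) (f : qpath Q -> V) x : V :=
  \sum_(p <- msupp x) x@_p *: f p.

Definition path_mul x y : path_algebra :=
  lin_ext (fun p => lin_ext (fun q => oapp path_vec 0 (pcat p q)) y) x.

Definition path_one : path_algebra := \sum_(v : vertex Q) path_vec (triv_path v).

Lemma lin_extw (V : lmodType K) (f : qpath Q -> V) x (d : {fset qpath Q}) :
  (msupp x `<=` d)%fset -> lin_ext f x = \sum_(p <- d) x@_p *: f p.
Proof.
move=> le_d; rewrite /lin_ext (big_fset_incl _ le_d) //= => p _ /mcoeff_outdom ->.
by rewrite scale0r.
Qed.

Lemma lin_ext_is_linear (V : lmodType K) (f : qpath Q -> V) : linear (lin_ext f).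
Proof.
move=> k x y; pose d := (msupp x `|` msupp y `|` msupp (k *: x + y))%fset.
have hx : (msupp x `<=` d)%fset by rewrite /d -fsetUA fsubsetUl.
have hy : (msupp y `<=` d)%fset by rewrite /d fsetUAC fsubsetUr.
have hz : (msupp (k *: x + y) `<=` d)%fset by rewrite /d fsubsetUr.
rewrite (lin_extw f hx) (lin_extw f hy) (lin_extw f hz).
rewrite scaler_sumr -big_split /=; apply: eq_bigr => p _.
by rewrite mcoeffD mcoeffZ scalerDl scalerA.
Qed.
HB.instance Definition _ (V : lmodType K) (f : qpath Q -> V) :=
  GRing.isLinear.Build K path_algebra V _ (lin_ext f) (lin_ext_is_linear f).

Lemma lin_ext_vec (V : lmodType K) (f : qpath Q -> V) p : lin_ext f (path_vec p) = f p.
Proof.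
by rewrite (lin_extw f (d := [fset p]%fset)) ?msuppU_le // big_seq_fset1 mcoeffUU scale1r.
Qed.

Lemma path_vecE x : x = \sum_(p <- msupp x) x@_p *: path_vec p.
Proof.
rewrite {1}[x]monalgE; apply: eq_bigr => p _; apply/malgP => q.
by rewrite mcoeffZ !mcoeffU mulr_natr.
Qed.

Lemma lin_ext_id (V : lmodType K) (f : {linear path_algebra -> V}) x :
  f x = lin_ext (fun p => f (path_vec p)) x.
Proof. by rewrite {1}[x]path_vecE linear_sum; apply: eq_bigr => p _; rewrite linearZ. Qed.

Lemma eq_lin (V : lmodType K) (f g : {linear path_algebra -> V}) :
  (forall p, f (path_vec p) = g (path_vec p)) -> f =1 g.
Proof.
by move=> e x; rewrite lin_ext_id [RHS]lin_ext_id; apply: eq_bigr => p _; rewrite e.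
Qed.

Lemma path_mul_linr x : linear (path_mul x).
Proof.
move=> k y z; rewrite /path_mul /lin_ext scaler_sumr -big_split /=.
apply: eq_bigr => p _; rewrite -!/(lin_ext _ _) linearP.
by rewrite scalerDr !scalerA [x@_p * k]mulrC.
Qed.
Lemma path_mul_linl y : linear (path_mul^~ y).
Proof. exact: lin_ext_is_linear. Qed.
HB.instance Definition _ x :=
  GRing.isLinear.Build K path_algebra path_algebra _ (path_mul x) (path_mul_linr x).
Definition path_mulr y x := path_mul x y.
HB.instance Definition _ y :=
  GRing.isLinear.Build K path_algebra path_algebra _ (path_mulr y) (path_mul_linl y).

Lemma path_mul_vec p q :
  path_mul (path_vec p) (path_vec q) = oapp path_vec 0 (pcat p q).
Proof. by rewrite /path_mul !lin_ext_vec. Qed.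

Lemma path_mulA : associative path_mul.
Proof.
move=> x y z.
apply: (eq_lin (f := path_mulr (path_mul y z)) (g := path_mulr z \o path_mulr y)).
move=> p /=; rewrite /path_mulr.
apply: (eq_lin (f := path_mul (path_vec p) \o path_mulr z)
               (g := path_mulr z \o path_mul (path_vec p))).
move=> q /=; rewrite /path_mulr.
apply: (eq_lin (f := path_mul (path_vec p) \o path_mul (path_vec q))
               (g := path_mul (path_mul (path_vec p) (path_vec q)))).
move=> r /=; rewrite !path_mul_vec; have := pcatA p q r.
case: (pcat q r) => [s|] /=; case: (pcat p q) => [t|] /= e.
- by rewrite !path_mul_vec e.
- by rewrite path_mul_vec e -/(path_mulr _ _) linear0.
- by rewrite path_mul_vec -e linear0.
- by rewrite linear0 -/(path_mulr _ _) linear0.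
Qed.

Lemma path_mul1x : left_id path_one path_mul.
Proof.
move=> x; apply: (eq_lin (f := path_mul path_one) (g := idfun)) => p /=.
rewrite -/(path_mulr _ _) linear_sum (bigD1 (pstart p)) //= big1 => [|v nv].
  by rewrite /path_mulr path_mul_vec pcat1p eqxx addr0.
by rewrite /path_mulr path_mul_vec pcat1p (negPf nv).
Qed.

Lemma path_mulx1 : right_id path_one path_mul.
Proof.
move=> x; apply: (eq_lin (f := path_mulr path_one) (g := idfun)) => p /=.
rewrite /path_mulr linear_sum (bigD1 (pend p)) //= big1 => [|v nv].
  by rewrite path_mul_vec pcatp1 eqxx addr0.
by rewrite path_mul_vec pcatp1 eq_sym (negPf nv).
Qed.

Lemma path_mulDl : left_distributive path_mul +%R.
Proof. by move=> x y z; rewrite -!/(path_mulr _ _) linearD. Qed.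
Lemma path_mulDr : right_distributive path_mul +%R.
Proof. by move=> x y z; rewrite linearD. Qed.

Lemma path_one_neq0 : path_one != 0.
Proof.
have /card_gt0P [v _] := vertex_gt0 Q.
apply/eqP => /(congr1 (mcoeff (triv_path v))) /eqP; apply/negP.
rewrite raddf_sum (bigD1 v) //= big1 => [|w nw].
  by rewrite addr0 mcoeffUU mcoeff0 oner_neq0.
rewrite mcoeffU; case: eqP => // /(congr1 val) [] e; by rewrite e eqxx in nw.
Qed.

HB.instance Definition _ := GRing.Zmodule_isNzRing.Build path_algebra
  path_mulA path_mul1x path_mulx1 path_mulDl path_mulDr path_one_neq0.

Lemma path_scalerAl (k : K) x y : k *: (x * y) = (k *: x) * y.
Proof. exact: esym (linearZ_LR (path_mulr y) k x). Qed.
Lemma path_scalerAr (k : K) x y : k *: (x * y) = x * (k *: y).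
Proof. exact: esym (linearZ_LR (path_mul x) k y). Qed.
HB.instance Definition _ :=
  GRing.Lmodule_isLalgebra.Build K path_algebra path_scalerAl.
HB.instance Definition _ :=
  GRing.Lalgebra_isAlgebra.Build K path_algebra path_scalerAr.
End PathAlgebra.

Section Ideals.
Variables (K : fieldType) (Q : quiver).
Local Notation KQ := (path_algebra K Q).

Definition two_sided_ideal (I : KQ -> Prop) : Prop :=
  [/\ I 0, forall x y, I x -> I y -> I (x + y)
    & forall x y z, I y -> I (x * y * z)].

Definition ideal_gen (S : KQ -> Prop) (x : KQ) : Prop :=
  forall I, two_sided_ideal I -> (forall y, S y -> I y) -> I x.

Fixpoint ideal_pow (I : KQ -> Prop) (n : nat) : KQ -> Prop :=
  if n is m.+1 then
    ideal_gen (fun z => exists x y, [/\ I x, ideal_pow I m y & z = x * y])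
  else fun _ => True.

Definition arrow_ideal : KQ -> Prop :=
  ideal_gen (fun x => exists a : arrow Q, x = path_vec K (arrow_path a)).

Definition path_ideal (S : qpath Q -> Prop) : KQ -> Prop :=
  ideal_gen (fun x => exists p, S p /\ x = path_vec K p).

Definition admissible (I : KQ -> Prop) : Prop :=
  two_sided_ideal I /\
  exists m, [/\ (1 < m)%N, forall x, ideal_pow arrow_ideal m x -> I x
              & forall x, I x -> ideal_pow arrow_ideal 2 x].

End Ideals.

HB.instance Definition _ (K : fieldType) (A : falgType K) :=
  GRing.Lmodule.copy A^c A.

(* The cast on [k *: x] matters: [A^c] unfolds to [A], so without it the outer
   product may be read as the one of [A]. *)
Lemma converse_scalerAl (K : fieldType) (A : falgType K) (k : K) (x y : A^c) :
  k *: (x * y) = (k *: x : A^c) * y.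
Proof. exact: (@scalerAr K A k y x). Qed.

Lemma converse_scalerAr (K : fieldType) (A : falgType K) (k : K) (x y : A^c) :
  k *: (x * y) = x * (k *: y : A^c).
Proof. exact: (@scalerAl K A k y x). Qed.

HB.instance Definition _ (K : fieldType) (A : falgType K) :=
  GRing.Lmodule_isLalgebra.Build K A^c (@converse_scalerAl K A).
HB.instance Definition _ (K : fieldType) (A : falgType K) :=
  GRing.Lalgebra_isAlgebra.Build K A^c (@converse_scalerAr K A).
HB.instance Definition _ (K : fieldType) (A : falgType K) :=
  Vector.copy A^c A.

Definition opalg (K : fieldType) (A : falgType K) : falgType K := A^c.

Lemma opalgM (K : fieldType) (A : falgType K) (a b : opalg A) :
  a * b = (b : A) * (a : A).
Proof. by []. Qed.

(* Finite dimensional right A-modules. Left A-modules are right modules over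
   [opalg A]. *)
Record rmod (K : fieldType) (A : falgType K) := RMod {
  rmod_vect :> vectType K;
  ract : rmod_vect -> A -> rmod_vect;
  ract_linearl : forall a, linear (ract^~ a);
  ract_linearr : forall x, linear (ract x);
  ractA : forall x a b, ract (ract x a) b = ract x (a * b);
  ract1 : forall x, ract x 1 = x }.

HB.instance Definition _ (K : fieldType) (A : falgType K) (M : rmod A) (x : M) :=
  GRing.isLinear.Build K A M _ (ract x) (ract_linearr x).

Definition ractr (K : fieldType) (A : falgType K) (M : rmod A) (a : A) (x : M) :=
  ract x a.
HB.instance Definition _ (K : fieldType) (A : falgType K) (M : rmod A) (a : A) :=
  GRing.isLinear.Build K M M _ (@ractr K A M a) (@ract_linearl K A M a).

Section Modules.
Variables (K : fieldType) (A : falgType K).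
Implicit Types M N X Y P : rmod A.

Definition rlinear M N (f : 'Hom(M, N)) : Prop :=
  forall x a, f (ract x a) = ract (f x) a.

Definition rmod_iso M N : Prop := exists f : 'Hom(M, N), rlinear f /\ bijective f.

Definition surj M N (f : 'Hom(M, N)) : Prop := limg f = fullv.

Definition submodule M (U : {vspace M}) : Prop :=
  forall x a, x \in U -> ract x a \in U.

Definition simple_sub M (U : {vspace M}) : Prop :=
  [/\ submodule U, U != 0%VS
    & forall V : {vspace M}, submodule V -> (V <= U)%VS -> V = 0%VS \/ V = U].

Definition semisimple_rmod M : Prop :=
  exists (n : nat) (U : 'I_n -> {vspace M}),
    [/\ forall i, simple_sub (U i), directv (\sum_i U i)
      & (\sum_i U i)%VS = fullv].

Definition indecomposable M : Prop :=
  (fullv : {vspace M}) != 0%VS /\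
  forall U V : {vspace M}, submodule U -> submodule V ->
    (U + V)%VS = fullv -> (U :&: V)%VS = 0%VS -> U = 0%VS \/ V = 0%VS.

Definition projective P : Prop :=
  forall X Y (g : 'Hom(X, Y)) (f : 'Hom(P, Y)),
    rlinear g -> surj g -> rlinear f ->
    exists h : 'Hom(P, X), rlinear h /\ (g \o h)%VF = f.

Record proj_resolution M := ProjResolution {
  res_obj :> nat -> rmod A;
  res_diff : forall i, 'Hom(res_obj i.+1, res_obj i);
  res_aug : 'Hom(res_obj 0, M);
  res_projective : forall i, projective (res_obj i);
  res_diff_rlinear : forall i, rlinear (res_diff i);
  res_aug_rlinear : rlinear res_aug;
  res_aug_surj : surj res_aug;
  res_exact0 : limg (res_diff 0) = lker res_aug;
  res_exact : forall i, limg (res_diff i.+1) = lker (res_diff i) }.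

Section Cohomology.
Variables (M N : rmod A) (P : proj_resolution M).

Definition cocycle i (g : 'Hom(P i, N)) : Prop :=
  rlinear g /\ (g \o res_diff P i)%VF = 0.

Definition coboundary i : 'Hom(P i, N) -> Prop :=
  if i is j.+1 then
    fun g => exists h : 'Hom(P j, N), rlinear h /\ g = (h \o res_diff P j)%VF
  else fun g => g = 0.

End Cohomology.

(* Ext^i_A(M, N) = 0, with Ext^i computed as the i-th cohomology of
   Hom_A(P, N), for P a projective resolution of M. Since the cohomology does
   not depend on P, quantifying over all P is harmless; resolutions exist by
   [exists_proj_resolution]. *)
Definition Ext_vanishes i M N : Prop :=
  forall (P : proj_resolution M) (g : 'Hom(P i, N)), cocycle g -> coboundary g.

(* Hom_A(M, N): [f] is A-linear as soon as it is so on bases of M and A. *)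
Definition rhom M N : {vspace 'Hom(M, N)} :=
  (\bigcap_(i < \dim {:M}) \bigcap_(j < \dim {:A})
    lker (linfun (fun f : 'Hom(M, N) =>
      f (ract (vbasis {:M})`_i (vbasis {:A})`_j)
        - ract (f (vbasis {:M})`_i) (vbasis {:A})`_j)))%VS.

Lemma rhom_linear M N x a :
  linear (fun f : 'Hom(M, N) => f (ract x a) - ract (f x) a).
Proof.
move=> k f g; rewrite !lfun_simp ract_linearl scalerBr opprD.
by rewrite !addrA; congr (_ - _); rewrite -!addrA; congr (_ + _); rewrite addrC.
Qed.

Lemma rhomP M N (f : 'Hom(M, N)) : reflect (rlinear f) (f \in rhom M N).
Proof.
have eqker x a : (f \in lker (linfun (fun f : 'Hom(M, N) =>
    f (ract x a) - ract (f x) a))) = (f (ract x a) == ract (f x) a).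
  pose g := GRing.isLinear.Build _ _ _ _ _ (@rhom_linear M N x a).
  pose h : {linear 'Hom(M, N) -> N} := HB.pack (fun f : 'Hom(M, N) =>
    f (ract x a) - ract (f x) a) g.
  by rewrite memv_ker -[X in linfun X]/(h : _ -> _) lfunE /= subr_eq0.
rewrite memvE; apply: (iffP subv_bigcapP) => [Hf x a | Hf i _]; last first.
  by apply/subv_bigcapP => j _; rewrite -memvE eqker Hf.
rewrite (coord_vbasis (memvf x)) (coord_vbasis (memvf a)).
rewrite linear_sum /= [LHS]linear_sum linear_sum /=; apply: eq_bigr => j _.
rewrite linearZ /= !linearZ /=; congr (_ *: _).
rewrite -!/(ractr _ _) !linear_sum /=; apply: eq_bigr => i _.
rewrite !linearZ /=; congr (_ *: _); apply/eqP; rewrite -eqker.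
by have /subv_bigcapP/(_ j isT) := Hf i isT; rewrite -memvE.
Qed.

Lemma reg_ract_linearl (a : A) : linear (fun x : A => x * a).
Proof. by move=> k x y; rewrite mulrDl scalerAl. Qed.
Lemma reg_ract_linearr (x : A) : linear (fun a : A => x * a).
Proof. by move=> k a b; rewrite mulrDr scalerAr. Qed.

(* A as a right module over itself. *)
Definition reg_rmod : rmod A :=
  @RMod K A A *%R reg_ract_linearl reg_ract_linearr
    (fun x a b => esym (mulrA x a b)) (@mulr1 A).

Lemma dual_reg_linearl (a : A) :
  linear (fun f : 'Hom(A, K^o) => (f \o amull a)%VF).
Proof. by move=> k f g; apply/lfunP => x; rewrite !lfun_simp. Qed.
Lemma dual_reg_linearr (f : 'Hom(A, K^o)) :
  linear (fun a : A => (f \o amull a)%VF).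
Proof. by move=> k a b; apply/lfunP => x; rewrite linearP !lfun_simp linearP. Qed.
Lemma dual_regA (f : 'Hom(A, K^o)) (a b : A) :
  ((f \o amull a) \o amull b)%VF = (f \o amull (a * b))%VF.
Proof. by apply/lfunP => x; rewrite !comp_lfunE !lfunE /= mulrA. Qed.
Lemma dual_reg1 (f : 'Hom(A, K^o)) : (f \o amull 1)%VF = f.
Proof. by apply/lfunP => x; rewrite !comp_lfunE !lfunE /= mul1r. Qed.

(* D(A), the dual of the left module A: (f.a)(x) = f(a x). *)
Definition dual_reg : rmod A :=
  @RMod K A 'Hom(A, K^o) (fun f a => (f \o amull a)%VF)
    dual_reg_linearl dual_reg_linearr dual_regA dual_reg1.

Section Dual.
Variable M : rmod A.
Let act (f : 'Hom(M, K^o)) (a : opalg A) : 'Hom(M, K^o) :=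
  (f \o linfun (@ractr K A M a))%VF.
Lemma dual_linearl a : linear (act^~ a).
Proof. by move=> k f g; apply/lfunP => x; rewrite !lfun_simp. Qed.
Lemma dual_linearr f : linear (act f).
Proof.
move=> k a b; apply/lfunP => x; rewrite !lfun_simp /=.
by rewrite /ractr (linearP (ract x)) linearP.
Qed.
Lemma dualA f a b : act (act f a) b = act f (a * b).
Proof. by apply/lfunP => x; rewrite !comp_lfunE !lfunE /= /ractr ractA. Qed.
Lemma dual1 f : act f 1 = f.
Proof. by apply/lfunP => x; rewrite !comp_lfunE !lfunE /= /ractr ract1. Qed.

(* D(M) = Hom_K(M, K), a left A-module by (a.f)(x) = f(x a). *)
Definition dual_rmod : rmod (opalg A) :=
  RMod dual_linearl dual_linearr dualA dual1.
End Dual.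

Section RegDual.
Variable P : rmod A.
Let car := subvs_of (rhom P reg_rmod).
Let act (f : car) (a : opalg A) : car :=
  vsproj _ (amull (a : A) \o (vsval f : 'Hom(P, A)))%VF.

Lemma hom_regE (f : car) (a : opalg A) x :
  (vsval (act f a) : 'Hom(P, A)) x = (a : A) * (vsval f : 'Hom(P, A)) x.
Proof.
rewrite vsprojK ?comp_lfunE ?lfunE //.
apply/rhomP => y b; rewrite !comp_lfunE !lfunE /= -mulrA; congr (_ * _).
by have /rhomP := subvsP f; apply.
Qed.

Let eqcar (f g : car) :
  (forall x, (vsval f : 'Hom(P, A)) x = (vsval g : 'Hom(P, A)) x) -> f = g.
Proof. by move=> e; apply: subvs_inj; apply/lfunP. Qed.

Let car_linE (k : K) (f g : car) x : (vsval (k *: f + g) : 'Hom(P, A)) x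
  = k *: (vsval f : 'Hom(P, A)) x + (vsval g : 'Hom(P, A)) x.
Proof. by rewrite linearP /= add_lfunE scale_lfunE. Qed.

Lemma hom_reg_linearl a : linear (act^~ a).
Proof.
move=> k f g; apply: eqcar => x.
by rewrite hom_regE !car_linE !hom_regE mulrDr scalerAr.
Qed.
Lemma hom_reg_linearr f : linear (act f).
Proof.
move=> k a b; apply: eqcar => x.
by rewrite hom_regE !car_linE !hom_regE mulrDl scalerAl.
Qed.
Lemma hom_regA f a b : act (act f a) b = act f (a * b).
Proof. by apply: eqcar => x; rewrite !hom_regE mulrA. Qed.
Lemma hom_reg1 f : act f 1 = f.
Proof. by apply: eqcar => x; rewrite !hom_regE mul1r. Qed.

(* Hom_A(P, A), a left A-module by (a.f)(x) = a f(x). *)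
Definition hom_reg : rmod (opalg A) :=
  RMod hom_reg_linearl hom_reg_linearr hom_regA hom_reg1.
End RegDual.

(* Hom_A(f, A) : Hom_A(Y, A) -> Hom_A(X, A) for [f : X -> Y]. *)
Definition hom_reg_map X Y (f : 'Hom(X, Y)) : 'Hom(hom_reg Y, hom_reg X) :=
  linfun (fun h : hom_reg Y =>
    vsproj (rhom X reg_rmod) ((vsval h : 'Hom(Y, reg_rmod)) \o f)%VF : hom_reg X).

Lemma hom_reg_mapE X Y (f : 'Hom(X, Y)) (h : hom_reg Y) : rlinear f ->
  vsval (hom_reg_map f h) = ((vsval h : 'Hom(Y, reg_rmod)) \o f)%VF.
Proof.
move=> lf.
have L : linear (fun h : hom_reg Y =>
    vsproj (rhom X reg_rmod) ((vsval h : 'Hom(Y, reg_rmod)) \o f)%VF : hom_reg X).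
  by move=> k g g'; rewrite linearP /= comp_lfunDl -comp_lfunZl linearP.
pose g : {linear hom_reg Y -> hom_reg X} :=
  HB.pack (fun h : hom_reg Y =>
    vsproj (rhom X reg_rmod) ((vsval h : 'Hom(Y, reg_rmod)) \o f)%VF : hom_reg X)
  (GRing.isLinear.Build _ _ _ _ _ L).
rewrite /hom_reg_map -[X in linfun X]/(g : _ -> _) lfunE /= vsprojK //.
by apply/(@rhomP X reg_rmod) => x a; rewrite !comp_lfunE lf; have /rhomP := subvsP h; apply.
Qed.

End Modules.

(* [T] is a transpose of [M]: there is a projective presentation
   P1 -f-> P0 -> M -> 0 with T the cokernel of Hom_A(f, A). This determines T
   up to projective direct summands. *)
Definition transpose_of (K : fieldType) (A : falgType K)
    (M : rmod A) (T : rmod (opalg A)) : Prop :=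
  exists (P1 P0 : rmod A) (f : 'Hom(P1, P0)) (p : 'Hom(P0, M))
         (q : 'Hom(hom_reg P1, T)),
    [/\ projective P1 /\ projective P0,
        [/\ rlinear f, rlinear p, surj p & limg f = lker p]
      & [/\ rlinear q, surj q & limg (hom_reg_map f) = lker q]].

(* Submodules as modules, free modules and cokernels, used to check that every
   module has a projective resolution and a transpose. *)
Section SubModule.
Variables (K : fieldType) (A : falgType K) (M : rmod A) (U : {vspace M}).
Hypothesis sU : submodule U.
Let act (x : subvs_of U) (a : A) : subvs_of U := vsproj U (ract (vsval x) a).
Let actE x a : vsval (act x a) = ract (vsval x) a.
Proof. by rewrite vsprojK // sU ?subvsP. Qed.
Lemma sub_linearl a : linear (act^~ a).
Proof.
move=> k x y; apply: subvs_inj.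
by rewrite actE !linearP /= !actE -!/(ractr _ _) linearP.
Qed.
Lemma sub_linearr x : linear (act x).
Proof. by move=> k a b; apply: subvs_inj; rewrite actE !linearP /= !actE. Qed.
Lemma sub_actA x a b : act (act x a) b = act x (a * b).
Proof. by apply: subvs_inj; rewrite !actE ractA. Qed.
Lemma sub_act1 x : act x 1 = x.
Proof. by apply: subvs_inj; rewrite actE ract1. Qed.
Definition sub_rmod : rmod A := RMod sub_linearl sub_linearr sub_actA sub_act1.

Definition sub_incl : 'Hom(sub_rmod, M) := linfun (vsval : subvs_of U -> M).
Lemma sub_inclE (x : sub_rmod) : sub_incl x = vsval x. Proof. exact: lfunE. Qed.
Lemma sub_incl_rlinear : rlinear sub_incl.
Proof. by move=> x a; rewrite !sub_inclE actE. Qed.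
End SubModule.

Section FreeModule.
Variables (K : fieldType) (A : falgType K) (n : nat).
Let car := {ffun 'I_n -> A}.
Let act (x : car) (a : A) : car := [ffun i => x i * a].
Lemma free_linearl a : linear (act^~ a).
Proof.
by move=> k x y; apply/ffunP => i; rewrite !ffunE mulrDl scalerAl.
Qed.
Lemma free_linearr x : linear (act x).
Proof. by move=> k a b; apply/ffunP => i; rewrite !ffunE mulrDr scalerAr. Qed.
Lemma free_actA x a b : act (act x a) b = act x (a * b).
Proof. by apply/ffunP => i; rewrite !ffunE mulrA. Qed.
Lemma free_act1 x : act x 1 = x.
Proof. by apply/ffunP => i; rewrite !ffunE mulr1. Qed.
Definition free_rmod : rmod A := RMod free_linearl free_linearr free_actA free_act1.

Definition free_gen (i : 'I_n) : free_rmod := [ffun j => (i == j)%:R].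

Lemma free_genE (x : free_rmod) : x = \sum_i ract (free_gen i) ((x : car) i).
Proof.
apply/ffunP => j; rewrite sum_ffunE (bigD1 j) //= big1 => [|i ni].
  by rewrite !ffunE eqxx mul1r addr0.
by rewrite !ffunE (negPf ni) mul0r.
Qed.

Section Map.
Variables (X : rmod A) (m : 'I_n -> X).
Let fm (x : car) : X := \sum_i ract (m i) (x i).
Let fm_linear : linear fm.
Proof.
move=> k x y; rewrite /fm scaler_sumr -big_split; apply: eq_bigr => i _ /=.
by rewrite !ffunE linearP.
Qed.
#[local] HB.instance Definition _ := GRing.isLinear.Build K car X _ fm fm_linear.
Definition free_map : 'Hom(free_rmod, X) := linfun fm.
Lemma free_mapE x : free_map x = \sum_i ract (m i) ((x : car) i).
Proof. exact: lfunE. Qed.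
Lemma free_map_rlinear : rlinear free_map.
Proof.
move=> x a; rewrite !free_mapE -[RHS]/(ractr a _) linear_sum; apply: eq_bigr => i _.
by rewrite ffunE /= /ractr ractA.
Qed.
Lemma free_map_gen i : free_map (free_gen i) = m i.
Proof.
rewrite free_mapE (bigD1 i) //= big1 => [|j nj].
  by rewrite ffunE eqxx ract1 addr0.
by rewrite ffunE eq_sym (negPf nj) linear0.
Qed.
End Map.

Lemma free_hom_ext (X : rmod A) (f g : 'Hom(free_rmod, X)) :
  rlinear f -> rlinear g -> (forall i, f (free_gen i) = g (free_gen i)) -> f = g.
Proof.
move=> lf lg e; apply/lfunP => x; rewrite (free_genE x) !linear_sum.
by apply: eq_bigr => i _ /=; rewrite lf lg e.
Qed.

Lemma free_projective : projective free_rmod.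
Proof.
move=> X Y g f lg sg lf.
exists (free_map (fun i => (g^-1)%VF (f (free_gen i)))); split.
  exact: free_map_rlinear.
apply: free_hom_ext => // [x a|i].
  by rewrite !comp_lfunE free_map_rlinear lg.
by rewrite comp_lfunE free_map_gen limg_lfunVK // sg memvf.
Qed.
End FreeModule.

Section Resolution.
Variables (K : fieldType) (A : falgType K).
Implicit Type M : rmod A.

Definition cover_rmod M : rmod A := free_rmod A (\dim {:M}).
Definition cover M : 'Hom(cover_rmod M, M) :=
  free_map (fun i : 'I_(\dim {:M}) => (vbasis {:M})`_i : M).

Lemma cover_rlinear M : rlinear (cover M). Proof. exact: free_map_rlinear. Qed.

Lemma cover_surj M : surj (cover M).
Proof.
apply/eqP; rewrite eqEsubv subvf -(span_basis (vbasisP {:M})).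
apply/span_subvP => x /(nthP 0) [i]; rewrite size_tuple => li <-.
rewrite -(free_map_gen (fun i : 'I_(\dim {:M}) => (vbasis {:M})`_i : M) (Ordinal li)).
exact: memv_img (memvf _).
Qed.

Lemma lker_submodule (M N : rmod A) (f : 'Hom(M, N)) : rlinear f -> submodule (lker f).
Proof.
move=> lf x a; rewrite !memv_ker lf => /eqP ->.
by rewrite -/(ractr _ _) linear0.
Qed.

Definition syzygy M : rmod A := sub_rmod (lker_submodule (@cover_rlinear M)).

Lemma limg_sub_incl (M : rmod A) (U : {vspace M}) (sU : submodule U) :
  limg (sub_incl sU) = U.
Proof.
apply/vspaceP => x; apply/memv_imgP/idP => [[y _ ->]|Ux].
  by rewrite sub_inclE subvsP.
by exists (vsproj U x : sub_rmod sU); rewrite ?memvf // sub_inclE vsprojK.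
Qed.

Lemma exists_proj_resolution M : exists P : proj_resolution M, True.
Proof.
pose Z i := iter i syzygy M; pose P i := cover_rmod (Z i).
pose incl i : 'Hom(Z i.+1, P i) := sub_incl (lker_submodule (@cover_rlinear (Z i))).
pose d i : 'Hom(P i.+1, P i) := (incl i \o cover (Z i.+1))%VF.
have dim i : limg (d i) = lker (cover (Z i)).
  by rewrite limg_comp [(cover _ @: _)%VS]cover_surj limg_sub_incl.
have dker i : lker (d i) = lker (cover (Z i.+1)).
  apply/vspaceP => x; rewrite !memv_ker comp_lfunE sub_inclE.
  by rewrite -(inj_eq subvs_inj) linear0.
suff P0 : proj_resolution M by exists P0.
apply: (@ProjResolution K A M P d (cover M)) => [i|i x a||||i].
- exact: free_projective.
- by rewrite !comp_lfunE cover_rlinear sub_incl_rlinear.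
- exact: cover_rlinear.
- exact: cover_surj.
- exact: dim.
- by rewrite dim dker.
Qed.
End Resolution.

Section Cokernel.
Variables (K : fieldType) (A : falgType K) (M : rmod A) (U : {vspace M}).
Hypothesis sU : submodule U.
Let car := subvs_of (U^C)%VS.
Let q (x : M) : car := vsproj (U^C)%VS (x - projv U x).
Let q_linear : linear q.
Proof.
move=> k x y; rewrite /q -linearP; congr (vsproj _ _).
by rewrite linearP scalerBr opprD addrACA.
Qed.
#[local] HB.instance Definition _ := GRing.isLinear.Build K M car _ q q_linear.
Let qU x : (q x == 0) = (x \in U).
Proof.
rewrite -(inj_eq subvs_inj) linear0 vsprojK ?memv_projC // subr_eq0.
by apply/eqP/idP => [->|/projv_id ->]; rewrite ?memv_proj.
Qed.
Let qval (x : car) : q (vsval x) = x.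
Proof.
rewrite /q; have -> : projv U (vsval x) = 0.
  apply/eqP; rewrite -memv_ker lker_proj; exact: subvsP.
by rewrite subr0 vsvalK.
Qed.
Let eqq x y : x - y \in U -> q x = q y.
Proof. by rewrite -qU linearB subr_eq0 => /eqP. Qed.
Let subq x : vsval (q x) - x \in U.
Proof. by rewrite -qU linearB subr_eq0 /= qval. Qed.
Let act (x : car) (a : A) : car := q (ract (vsval x) a).
Let q_act x a : q (ract x a) = act (q x) a.
Proof.
apply/esym/eqq; rewrite -!/(ractr _ _) -linearB; exact: sU.
Qed.
Lemma coker_linearl a : linear (act^~ a).
Proof. by move=> k x y; rewrite /act -!/(ractr _ _) !linearP. Qed.
Lemma coker_linearr x : linear (act x).
Proof. by move=> k a b; rewrite /act !linearP. Qed.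
Lemma coker_actA x a b : act (act x a) b = act x (a * b).
Proof. by rewrite {2}/act -q_act ractA. Qed.
Lemma coker_act1 x : act x 1 = x.
Proof. by rewrite /act ract1 qval. Qed.
Definition coker_rmod : rmod A :=
  RMod coker_linearl coker_linearr coker_actA coker_act1.
Lemma exists_coker : exists (N : rmod A) (p : 'Hom(M, N)),
  [/\ rlinear p, surj p & lker p = U].
Proof.
exists coker_rmod, (linfun q : 'Hom(M, coker_rmod)); split=> [x a||].
- by rewrite !lfunE /= q_act.
- apply/vspaceP => x; rewrite memvf; apply/memv_imgP.
  by exists (vsval x); rewrite ?memvf // lfunE /= qval.
- by apply/vspaceP => x; rewrite memv_ker lfunE /= qU.
Qed.
End Cokernel.

Lemma exists_transpose (K : fieldType) (A : falgType K) (M : rmod A) :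
  exists T, transpose_of M T.
Proof.
have [P _] := exists_proj_resolution M.
have s : submodule (limg (hom_reg_map (res_diff P 0))).
  move=> _ a /memv_imgP [h _ ->]; apply/memv_imgP; exists (ract h a).
    exact: memvf.
  apply: subvs_inj; apply/lfunP => x.
  have l := @res_diff_rlinear _ _ _ P 0.
  by rewrite hom_regE !hom_reg_mapE // !comp_lfunE hom_regE.
have [T [q [lq sq kq]]] := exists_coker s.
exists T, (P 1%N), (P 0%N), (res_diff P 0), (res_aug P), q.
split; split=> //; try exact: res_projective.
- exact: res_diff_rlinear.
- exact: res_aug_rlinear.
- exact: res_aug_surj.
- exact: res_exact0.
Qed.

Section Gorenstein.
Variables (K : fieldType) (A : falgType K).

(* The Ext-groups of a transpose do not depend on which transpose is taken, and
   one exists by [exists_transpose]. *)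
Definition Gorenstein_projective (M : rmod A) : Prop :=
  (forall i, (0 < i)%N -> Ext_vanishes i M (reg_rmod A)) /\
  (forall T : rmod (opalg A), transpose_of M T ->
     forall i, (0 < i)%N -> Ext_vanishes i T (reg_rmod (opalg A))).

End Gorenstein.

Definition Gorenstein_injective (K : fieldType) (A : falgType K) (M : rmod A) :
  Prop := Gorenstein_projective (dual_rmod M).

Section Algebras.
Variables (K : fieldType) (A : falgType K).

Definition left_weakly_Gorenstein : Prop :=
  forall M : rmod A,
    (forall i, (0 < i)%N -> Ext_vanishes i M (reg_rmod A)) ->
    Gorenstein_projective M.

Definition right_weakly_Gorenstein : Prop :=
  forall M : rmod A,
    (forall i, (0 < i)%N -> Ext_vanishes i (dual_reg A) M) ->
    Gorenstein_injective M.

Definition weakly_Gorenstein : Prop :=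
  left_weakly_Gorenstein /\ right_weakly_Gorenstein.

(* A is not isomorphic to a product of two (nonzero) algebras. *)
Definition connected_alg : Prop :=
  forall (B C : falgType K) (f : {lrmorphism A -> B}) (g : {lrmorphism A -> C}),
    ~ bijective (fun a => (f a, g a)).

Definition semisimple_alg : Prop := semisimple_rmod (reg_rmod A).

Definition representation_finite : Prop :=
  exists (n : nat) (X : 'I_n -> rmod A),
    forall M : rmod A, indecomposable M -> exists i, rmod_iso M (X i).

(* A is isomorphic to End_B(M) for M a module over B, the product of End_B(M)
   being composition of maps written on the left. *)
Definition iso_endo_alg (B : falgType K) (M : rmod B) : Prop :=
  exists phi : {linear A -> 'End(M)},
    [/\ injective phi, forall f : 'End(M), rlinear f <-> exists a, f = phi a,
        phi 1 = \1%VF & forall a b, phi (a * b) = (phi a \o phi b)%VF].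

(* The map onto A with kernel I is an isomorphism KQ/I -> A. *)
Definition monomial_quiver_algebra : Prop :=
  exists (Q : quiver) (S : qpath Q -> Prop),
    let I := @path_ideal K Q S in
    admissible I /\
    exists pi : {lrmorphism path_algebra K Q -> A},
      (forall a, exists x, pi x = a) /\ (forall x, pi x = 0 <-> I x).

End Algebras.

(* Main.v *)
Require Import Defs.
From HB Require Import structures.
From mathcomp Require Import all_boot all_order all_algebra all_field.
From mathcomp Require Import finmap monalg zify.
From Stdlib Require Import Classical IndefiniteDescription FunctionalExtensionality.

(** Call [M] semi-Gorenstein-projective if [Ext^i(M, A) = 0] for all [i >= 1]. An
    algebra is left weakly Gorenstein as soon as all its semi-Gorenstein-projective
    modules are torsionless ([left_weakly_Gorenstein_torsionless]): the cokernel
    of a left approximation of such a module by free modules is again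
    semi-Gorenstein-projective, so [M] sits in an exact complex of projectives
    that stays exact under duality, and this complex computes the extension
    groups of the transpose.

    Torsionlessness follows from a finiteness property
    ([semi_Gproj_torsionless]): for some [n0 >= 1] every module has an [n0]-th
    syzygy that is a direct sum of modules from a fixed finite list. Taking
    syzygies is fully faithful on the stable category of
    semi-Gorenstein-projective modules. Hence the stable endomorphism rings of
    the syzygies of [M] all have the same dimension, which bounds their numbers
    of non-projective summands, and two different syzygies of [M] are stably
    isomorphic by the pigeonhole principle. Undoing the common syzygies, [M] is
    a stable retract of one of its own proper syzygies, which lies in a
    projective module.

    The right-hand condition for [A] follows from the left-hand one for the
    opposite algebra ([right_weakly_Gorenstein_op]), since vector space duality
    identifies [Ext(D A, N)] with [Ext(D N, A)] over the opposite algebra; here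
    [Ext^1] is shifted from projective presentations of one variable to injective
    copresentations of the other. So the finiteness property has to be proved for
    [A] and for its opposite algebra.

    If [A = End_B(M)], a map between free [A]-modules is a matrix of
    endomorphisms of [M]; its kernel is [Hom_B(M, Y)] for a kernel [Y] of a map
    between powers of [M], and over the opposite algebra it is [Hom_B(Y, M)] for
    a cokernel [Y] ([homl_kernel], [homr_kernel]). If [B] is representation-finite,
    decomposing [Y] decomposes these second syzygies.

    If [A] is monomial, the nonzero paths form a basis closed under
    multiplication up to zero, on both sides. In a projective cover attach to
    each generator the last letters of the terms of the element it maps to. A
    relation between homogeneous generators splits according to last letters, so
    each further syzygy is graded by one more letter ([graded_syzygy]). Once the
    labels are as long as the longest nonzero path, the words occurring in a
    homogeneous element are all ends of one word, and a homogeneous element with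
    a shortest word [w] generates a direct summand isomorphic to [w A]
    ([path_ideal_summand]). So syzygies of a fixed order are direct sums of path
    ideals, of which there are finitely many ([graded_biproduct]). *)

Set Implicit Arguments.
Unset Strict Implicit.
Unset Printing Implicit Defensive.

Import GRing.Theory.
Local Open Scope ring_scope.

(** * Short exact sequences and first extension groups *)

Section ModuleMaps.
Variables (K : fieldType) (A : falgType K).
Implicit Types M N X Y Z P Q I S L : rmod A.

Lemma rlinear_id M : rlinear (\1%VF : 'Hom(M, M)).
Proof. by move=> x a; rewrite !id_lfunE. Qed.

Lemma rlinear_comp M N X (f : 'Hom(M, N)) (g : 'Hom(N, X)) :
  rlinear f -> rlinear g -> rlinear (g \o f)%VF.
Proof. by move=> lf lg x a; rewrite !comp_lfunE lf lg. Qed.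

Lemma rlinearD M N (f g : 'Hom(M, N)) : rlinear f -> rlinear g -> rlinear (f + g).
Proof. by move=> /rhomP lf /rhomP lg; apply/rhomP; exact: memvD. Qed.

Lemma rlinearB M N (f g : 'Hom(M, N)) : rlinear f -> rlinear g -> rlinear (f - g).
Proof. by move=> /rhomP lf /rhomP lg; apply/rhomP; exact: memvB. Qed.

Lemma rlinear0 M N : rlinear (0 : 'Hom(M, N)).
Proof. by apply/rhomP; exact: mem0v. Qed.

Lemma rlinearZ M N k (f : 'Hom(M, N)) : rlinear f -> rlinear (k *: f).
Proof. by move=> /rhomP lf; apply/rhomP; exact: memvZ. Qed.

Lemma rlinear_sum M N (J : finType) (f : J -> 'Hom(M, N)) (b : pred J) :
  (forall i, rlinear (f i)) -> rlinear (\sum_(i | b i) f i).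
Proof. by move=> lf; apply/rhomP/memv_suml => i _; apply/rhomP. Qed.

Lemma ractDl M (x y : M) (a : A) : ract (x + y) a = ract x a + ract y a.
Proof. by rewrite -!/(ractr a _) linearD. Qed.

Lemma ract_suml M (J : Type) (r : seq J) (b : pred J) (F : J -> M) (a : A) :
  ract (\sum_(i <- r | b i) F i) a = \sum_(i <- r | b i) ract (F i) a.
Proof. by rewrite -/(ractr a _) linear_sum. Qed.

Lemma ractZl M k (x : M) (a : A) : ract (k *: x) a = k *: ract x a.
Proof. by rewrite -!/(ractr a _) linearZ. Qed.

Lemma surjP M N (f : 'Hom(M, N)) : surj f -> forall y, exists x, f x = y.
Proof.
move=> sf y; have : y \in limg f by rewrite sf memvf.
by case/memv_imgP => x _ ->; exists x.
Qed.

Lemma surjW M N (f : 'Hom(M, N)) : (forall y, exists x, f x = y) -> surj f.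
Proof.
move=> sf; apply/vspaceP => y; rewrite memvf; have [x <-] := sf y.
exact: memv_img (memvf x).
Qed.

Lemma factor_surj P M N (p : 'Hom(P, M)) (g : 'Hom(P, N)) :
  rlinear p -> surj p -> rlinear g -> (lker p <= lker g)%VS ->
  exists h : 'Hom(M, N), rlinear h /\ (h \o p)%VF = g.
Proof.
move=> lp sp lg /subvP ker.
have E x : (g \o p^-1)%VF (p x) = g x.
  rewrite comp_lfunE; apply/eqP; rewrite -subr_eq0 -linearB -memv_ker.
  by apply: ker; rewrite memv_ker linearB /= limg_lfunVK ?subrr // sp memvf.
exists (g \o p^-1)%VF; split; last first.
  by apply/lfunP => x; rewrite comp_lfunE E.
by move=> y a; have [x <-] := surjP sp y; rewrite -lp !E.
Qed.

Lemma factor_inj X Y Z (i : 'Hom(X, Y)) (f : 'Hom(Z, Y)) :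
  rlinear i -> lker i == 0%VS -> rlinear f -> (limg f <= limg i)%VS ->
  exists h : 'Hom(Z, X), rlinear h /\ (i \o h)%VF = f.
Proof.
move=> li ki lf im.
have E x : i ((i^-1 \o f)%VF x) = f x.
  rewrite comp_lfunE limg_lfunVK //; exact: (subvP im _ (memv_img _ (memvf x))).
exists (i^-1 \o f)%VF; split; last first.
  by apply/lfunP => x; rewrite comp_lfunE E.
by move=> x a; apply: (lker0P ki); rewrite li !E lf.
Qed.

Lemma sub_corestrict M N (U : {vspace N}) (sU : submodule U) (f : 'Hom(M, N)) :
  rlinear f -> (limg f <= U)%VS ->
  exists h : 'Hom(M, sub_rmod sU), rlinear h /\ (sub_incl sU \o h)%VF = f.
Proof.
move=> lf im; apply: factor_inj lf _; rewrite ?limg_sub_incl //.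
  exact: sub_incl_rlinear.
apply/lker0P => x y; rewrite !sub_inclE; exact: subvs_inj.
Qed.

Lemma sub_incl_ker N (U : {vspace N}) (sU : submodule U) :
  lker (sub_incl sU) == 0%VS.
Proof. by apply/lker0P => x y; rewrite !sub_inclE; exact: subvs_inj. Qed.

Definition ses L P M (i : 'Hom(L, P)) (p : 'Hom(P, M)) : Prop :=
  [/\ rlinear i, rlinear p, lker i == 0%VS, limg i = lker p & surj p].

Lemma ses_comp0 L P M (i : 'Hom(L, P)) (p : 'Hom(P, M)) x :
  ses i p -> p (i x) = 0.
Proof.
by case=> _ _ _ e _; apply/eqP; rewrite -memv_ker -e; exact: memv_img (memvf x).
Qed.

Lemma ses_ker L P M (i : 'Hom(L, P)) (p : 'Hom(P, M)) y :
  ses i p -> p y = 0 -> exists x, y = i x.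
Proof.
case=> _ _ _ e _ /eqP; rewrite -memv_ker -e => /memv_imgP [x _ ->].
by exists x.
Qed.

Lemma ses_kernel P M (p : 'Hom(P, M)) (lp : rlinear p) :
  surj p -> ses (sub_incl (lker_submodule lp)) p.
Proof.
move=> sp; split=> //; first exact: sub_incl_rlinear.
  exact: sub_incl_ker.
exact: limg_sub_incl.
Qed.

Lemma ses_factor L P M N (i : 'Hom(L, P)) (p : 'Hom(P, M)) (g : 'Hom(P, N)) :
  ses i p -> rlinear g -> (forall x, g (i x) = 0) ->
  exists h : 'Hom(M, N), rlinear h /\ (h \o p)%VF = g.
Proof.
move=> s lg g0; case: (s) => li lp ki e sp; apply: factor_surj => //.
apply/subvP => y; rewrite -e => /memv_imgP [x _ ->].
by rewrite memv_ker g0.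
Qed.

Lemma ses_lift L P M N (i : 'Hom(L, P)) (p : 'Hom(P, M)) (f : 'Hom(N, P)) :
  ses i p -> rlinear f -> (forall x, p (f x) = 0) ->
  exists h : 'Hom(N, L), rlinear h /\ (i \o h)%VF = f.
Proof.
move=> s lf f0; case: (s) => li lp ki e sp; apply: factor_inj => //.
by rewrite e; apply/subvP => _ /memv_imgP [x _ ->]; rewrite memv_ker f0.
Qed.

(** [Ext^1(M, N) = 0]. All presentations of [M] are quantified over so that the
    condition can be used with any of them; [ext1_presentation] shows that it
    suffices to check one. *)
Definition ext1 M N : Prop :=
  forall L P (i : 'Hom(L, P)) (p : 'Hom(P, M)), projective P -> ses i p ->
  forall g : 'Hom(L, N), rlinear g ->
  exists h : 'Hom(P, N), rlinear h /\ (h \o i)%VF = g.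

(** Let [P2] be another projective mapping onto [M], with comparison maps
    [al : P2 -> P] and [be : P -> P2] over [M]. A map [g] on the kernel of
    [P2 -> M] is the sum of [g be al], which extends because [g be] does, and of
    [g (1 - be al)], which makes sense on the whole of [P2] since [1 - be al]
    maps [P2] to that kernel. *)
Lemma ext1_presentation M N L P (i : 'Hom(L, P)) (p : 'Hom(P, M)) :
  projective P -> ses i p ->
  (forall g : 'Hom(L, N), rlinear g ->
     exists h : 'Hom(P, N), rlinear h /\ (h \o i)%VF = g) ->
  ext1 M N.
Proof.
move=> pP s ext L2 P2 i2 p2 pP2 s2 g lg.
have [li lp ki e sp] := s; have [li2 lp2 ki2 e2 sp2] := s2.
have [be [lbe be_p]] := pP _ _ p2 p lp2 sp2 lp.
have [al [lal al_p]] := pP2 _ _ p p2 lp sp lp2.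
have [b [lb eb]] : exists b : 'Hom(L, L2), rlinear b /\ (i2 \o b)%VF = (be \o i)%VF.
  apply: (ses_lift s2); first exact: rlinear_comp.
  by move=> x; rewrite comp_lfunE -[p2 _]comp_lfunE be_p (ses_comp0 _ s).
have [h [lh eh]] := ext _ (rlinear_comp lb lg).
have [d [ld ed]] : exists d : 'Hom(P2, L2),
    rlinear d /\ (i2 \o d)%VF = (\1 - (be \o al))%VF.
  apply: (ses_lift s2).
    by apply: rlinearB; [exact: rlinear_id | exact: rlinear_comp].
  move=> x; rewrite !lfun_simp linearB /= -[p2 (be _)]comp_lfunE be_p.
  by rewrite -[p (al _)]comp_lfunE al_p subrr.
exists ((h \o al) + (g \o d))%VF; split.
  by apply: rlinearD; exact: rlinear_comp.
have [c [lc ec]] : exists c : 'Hom(L2, L), rlinear c /\ (i \o c)%VF = (al \o i2)%VF.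
  apply: (ses_lift s); first exact: rlinear_comp.
  by move=> x; rewrite comp_lfunE -[p _]comp_lfunE al_p (ses_comp0 _ s2).
apply/lfunP => x; rewrite !lfun_simp -[al _]comp_lfunE -ec comp_lfunE.
rewrite -[h _]comp_lfunE eh comp_lfunE -linearD; congr (g _).
apply: (lker0P ki2); rewrite linearD /= -[i2 (b _)]comp_lfunE eb.
rewrite -[i2 (d _)]comp_lfunE ed !lfun_simp.
by rewrite -[i (c x)]comp_lfunE ec comp_lfunE addrC subrK.
Qed.

Definition injective_rmod I : Prop :=
  forall X Y (i : 'Hom(X, Y)) (f : 'Hom(X, I)),
    rlinear i -> lker i == 0%VS -> rlinear f ->
    exists h : 'Hom(Y, I), rlinear h /\ (h \o i)%VF = f.

(** Both conditions say that [Ext^2(M, N)] vanishes: a map from the syzygy [L] to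
    the cosyzygy [S] lifts to [I] if and only if it extends to [P], up to
    corrections supplied by projectivity of [P] and injectivity of [I]. *)
Lemma ext1_shift L P M N I S (i : 'Hom(L, P)) (p : 'Hom(P, M))
    (j : 'Hom(N, I)) (q : 'Hom(I, S)) :
  projective P -> ses i p -> injective_rmod I -> ses j q ->
  ext1 L N <-> ext1 M S.
Proof.
move=> pP s inI t; have [li lp ki ei sp] := s; have [lj lq kj ej sq] := t.
have [c sc] : exists c : 'Hom(syzygy L, cover_rmod L), ses c (Defs.cover L).
  by eexists; apply: ses_kernel; exact: cover_surj.
have [lc lcov kc ec _] := sc.
have pc : projective (cover_rmod L) by exact: free_projective.
split=> H.
  apply: (ext1_presentation pP s) => f lf.
  (* lift f to a map from the cover of L to I; on the syzygy of L it lands in N,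
     and subtracting an extension makes it descend to L *)
  have [u [lu eu]] := pc _ _ q (f \o Defs.cover L)%VF lq sq (rlinear_comp lcov lf).
  have [v [lv ev]] : exists v : 'Hom(syzygy L, N), rlinear v /\ (j \o v)%VF = (u \o c)%VF.
    apply: (ses_lift t); first exact: rlinear_comp.
    move=> x; rewrite comp_lfunE -[q _]comp_lfunE eu comp_lfunE.
    by rewrite (ses_comp0 _ sc) linear0.
  have [w [lw ew]] := H _ _ c (Defs.cover L) pc sc v lv.
  have [f' [lf' ef']] : exists f' : 'Hom(L, I),
      rlinear f' /\ (f' \o Defs.cover L)%VF = (u - (j \o w))%VF.
    apply: (ses_factor sc).
      by apply: rlinearB => //; exact: rlinear_comp.
    move=> x; rewrite !lfun_simp -[u (c x)]comp_lfunE -ev comp_lfunE.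
    by rewrite -[w (c x)]comp_lfunE ew subrr.
  have [h [lh eh]] := inI _ _ i f' li ki lf'.
  exists (q \o h)%VF; split; first exact: rlinear_comp.
  apply/lfunP => y; have [x <-] := surjP (@cover_surj _ _ L) y.
  rewrite !comp_lfunE -[h _]comp_lfunE eh -[f' _]comp_lfunE ef' !lfun_simp.
  rewrite linearB /= (ses_comp0 _ t) subr0.
  by rewrite -[q _]comp_lfunE eu comp_lfunE.
apply: (ext1_presentation pc sc) => g lg.
have [u [lu eu]] := inI _ _ c (j \o g)%VF lc kc (rlinear_comp lg lj).
have [f [lf ef]] : exists f : 'Hom(L, S), rlinear f /\ (f \o Defs.cover L)%VF = (q \o u)%VF.
  apply: (ses_factor sc); first exact: rlinear_comp.
  by move=> x; rewrite comp_lfunE -[u _]comp_lfunE eu comp_lfunE (ses_comp0 _ t).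
have [h [lh eh]] := H _ _ i p pP s f lf.
have [h' [lh' eh']] := pP _ _ q h lq sq lh.
have [w [lw ew]] : exists w : 'Hom(cover_rmod L, N),
    rlinear w /\ (j \o w)%VF = (u - ((h' \o i) \o Defs.cover L))%VF.
  apply: (ses_lift t).
    by apply: rlinearB => //; do 2?[apply: rlinear_comp => //].
  move=> x; rewrite !lfun_simp linearB /= -[q (h' _)]comp_lfunE eh'.
  by rewrite -[h _]comp_lfunE eh -!comp_lfunE ef subrr.
exists w; split=> //; apply/lfunP => x; apply: (lker0P kj).
rewrite comp_lfunE -[j (w _)]comp_lfunE ew !lfun_simp (ses_comp0 _ sc).
by rewrite !linear0 addr0 -[u _]comp_lfunE eu comp_lfunE.
Qed.

End ModuleMaps.

(** * Injective modules and higher extension groups *)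

Lemma lfun_of_linear (K : fieldType) (U V : vectType K) (f : U -> V) :
  linear f -> exists g : 'Hom(U, V), forall x, g x = f x.
Proof.
move=> lf; pose h : {linear U -> V} := HB.pack f (GRing.isLinear.Build K U V _ f lf).
by exists (linfun h) => x; rewrite lfunE.
Qed.

Section Coinduced.
Variables (K : fieldType) (A : falgType K) (V : vectType K).

Lemma coind_linearl (a : A) : linear (fun f : 'Hom(A, V) => (f \o amull a)%VF).
Proof. by move=> k f g; apply/lfunP => x; rewrite !lfun_simp. Qed.
Lemma coind_linearr (f : 'Hom(A, V)) : linear (fun a : A => (f \o amull a)%VF).
Proof. by move=> k a b; apply/lfunP => x; rewrite linearP !lfun_simp linearP. Qed.
Lemma coindA (f : 'Hom(A, V)) (a b : A) :
  ((f \o amull a) \o amull b)%VF = (f \o amull (a * b))%VF.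
Proof. by apply/lfunP => x; rewrite !comp_lfunE !lfunE /= mulrA. Qed.
Lemma coind1 (f : 'Hom(A, V)) : (f \o amull 1)%VF = f.
Proof. by apply/lfunP => x; rewrite !comp_lfunE !lfunE /= mul1r. Qed.

(** The coinduced module; for [V = K] it is [D(A)]. *)
Definition coind_rmod : rmod A :=
  @RMod K A 'Hom(A, V) (fun f a => (f \o amull a)%VF)
    coind_linearl coind_linearr coindA coind1.

(** [A]-linear maps into a coinduced module are the same as [K]-linear maps
    into [V], and these extend along injections. *)
Lemma coind_injective : injective_rmod coind_rmod.
Proof.
move=> X Y i f li ki lf.
have [f0 ef0] : exists f0 : 'Hom(X, V), forall x, f0 x = (f x : 'Hom(A, V)) 1.
  by apply: lfun_of_linear => k x y; rewrite linearP !lfun_simp.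
pose h0 (y : Y) : 'Hom(A, V) := (f0 \o i^-1 \o linfun (ract y))%VF.
have h0E y a : h0 y a = f0 ((i^-1)%VF (ract y a)) by rewrite !comp_lfunE lfunE.
clearbody h0.
have [h eh] : exists h : 'Hom(Y, coind_rmod), forall y, h y = h0 y.
  apply: lfun_of_linear => k y z; apply/lfunP => a.
  by rewrite !lfun_simp !h0E -!/(ractr a _) !linearP.
have hE y a : (h y : 'Hom(A, V)) a = f0 ((i^-1)%VF (ract y a)) by rewrite eh h0E.
have amullE (a b : A) : amull a b = a * b by rewrite lfunE.
exists h; split=> [y a|].
  by apply/lfunP => b; rewrite hE [RHS]comp_lfunE amullE hE ractA.
apply/lfunP => x; apply/lfunP => a.
by rewrite [X in fun_of_lfun X]comp_lfunE hE -li lker0_lfunK // ef0 lf comp_lfunE amullE mulr1.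
Qed.
End Coinduced.

Section Ext.
Variables (K : fieldType) (A : falgType K).
Implicit Types M N X Y Z P Q I S L : rmod A.

Lemma enough_injectives N :
  exists (I S : rmod A) (j : 'Hom(N, I)) (q : 'Hom(I, S)), injective_rmod I /\ ses j q.
Proof.
pose j0 (x : N) : 'Hom(A, N) := linfun (ract x).
have j0E x a : j0 x a = ract x a by rewrite lfunE.
clearbody j0.
have [j ej] : exists j : 'Hom(N, coind_rmod A N), forall x, j x = j0 x.
  apply: lfun_of_linear => k x y; apply/lfunP => a.
  by rewrite !lfun_simp !j0E ractDl ractZl.
have amullE (a b : A) : amull a b = a * b by rewrite lfunE.
have lj : rlinear j.
  by move=> x a; apply/lfunP => b; rewrite !ej comp_lfunE !j0E amullE ractA.
have sj : submodule (limg j).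
  move=> _ a /memv_imgP [x _ ->]; rewrite -lj; exact: memv_img (memvf _).
have [S [q [lq sq kq]]] := exists_coker sj.
exists (coind_rmod A N), S, j, q; split; first exact: coind_injective.
split=> //; apply/lker0P => x y; rewrite !ej => /lfunP /(_ 1).
by rewrite !j0E !ract1.
Qed.

(** [Ext^{n+1}(M, N) = 0], by dimension shifting in the second variable: this
    makes it independent of a choice of syzygies of [M]. *)
Fixpoint ext_zero n M N : Prop :=
  if n is m.+1 then
    forall I S (j : 'Hom(N, I)) (q : 'Hom(I, S)),
      injective_rmod I -> ses j q -> ext_zero m M S
  else ext1 M N.

(** By induction on [n] with [N] varying, since shifting [N] turns the claim for
    [n + 1] into the claim for [n]. *)
Lemma ext_zero_syzygy n M N L P (i : 'Hom(L, P)) (p : 'Hom(P, M)) :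
  projective P -> ses i p -> ext_zero n.+1 M N <-> ext_zero n L N.
Proof.
move=> pP s; elim: n N => [|n IH] N; last first.
  split=> H I S j q inI t; first by apply/IH; exact: H inI t.
  by apply/IH; exact: H inI t.
split=> [H|H I S j q inI t]; last exact/(ext1_shift pP s inI t).
have [I [S [j [q [inI t]]]]] := enough_injectives N.
by apply/(ext1_shift pP s inI t); exact: H inI t.
Qed.

Section Resolution.
Variables (M N : rmod A) (P : proj_resolution M).

(** The augmentation is the map out of degree 0; its target is not a term of the
    resolution, hence the dependent pair. *)
Definition res_map i : {Y : rmod A & 'Hom(P i, Y)} :=
  if i is j.+1 then existT _ (P j) (res_diff P j) else existT _ M (res_aug P).

Lemma res_map_rlinear i : rlinear (tagged (res_map i)).
Proof. by case: i => [|i]; [exact: res_aug_rlinear | exact: res_diff_rlinear]. Qed.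

Definition res_syzygy i : rmod A :=
  if i is j.+1 then sub_rmod (lker_submodule (@res_map_rlinear j)) else M.

Lemma res_exactS i : limg (res_diff P i) = lker (tagged (res_map i)).
Proof. by case: i => [|i]; [exact: res_exact0 | exact: res_exact]. Qed.

Definition res_incl i : 'Hom(res_syzygy i.+1, P i) :=
  sub_incl (lker_submodule (@res_map_rlinear i)).

Lemma res_cover i : exists p : 'Hom(P i.+1, res_syzygy i.+1),
  [/\ rlinear p, surj p, lker p = lker (res_diff P i)
    & (res_incl i \o p)%VF = res_diff P i].
Proof.
have := @sub_corestrict _ _ _ _ _ (lker_submodule (@res_map_rlinear i)) (res_diff P i).
case=> [||p [lp ep]]; first exact: res_diff_rlinear.
  by rewrite res_exactS.
have kp : lker p = lker (res_diff P i).
  apply/vspaceP => x; rewrite !memv_ker -ep comp_lfunE.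
  apply/eqP/eqP => [->|]; first by rewrite linear0.
  move=> e; apply: (lker0P (sub_incl_ker (lker_submodule (@res_map_rlinear i)))).
  by rewrite linear0.
exists p; split=> //; apply: surjW => y.
have : vsval y \in limg (res_diff P i) by rewrite res_exactS; exact: subvsP.
case/memv_imgP => x _ e; exists x; apply: subvs_inj.
by rewrite e -ep comp_lfunE sub_inclE.
Qed.

Lemma res_ses i : exists p : 'Hom(P i, res_syzygy i), ses (res_incl i) p.
Proof.
rewrite /res_incl; case: i => [|i].
  exists (res_aug P); apply: ses_kernel; exact: res_aug_surj.
have [p [lp sp kp _]] := res_cover i.
exists p; split=> //; first exact: sub_incl_rlinear.
  exact: sub_incl_ker.
by rewrite limg_sub_incl kp.
Qed.

Lemma ext_zero_res_syzygy i j : ext_zero (i + j) M N <-> ext_zero j (res_syzygy i) N.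
Proof.
elim: i j => [|i IH] j //; rewrite addSnnS IH.
have [p s] := res_ses i.
exact: (ext_zero_syzygy _ _ (@res_projective _ _ _ P i) s).
Qed.

Lemma res_cocycleP i :
  (forall g : 'Hom(P i.+1, N), cocycle g -> coboundary g) <-> ext_zero i M N.
Proof.
have [p s] := res_ses i.
have [p' [lp' sp' ep' diffE]] := res_cover i.
rewrite -[i in ext_zero i]addn0 ext_zero_res_syzygy.
have pP := @res_projective _ _ _ P.
split=> H.
  apply: (ext1_presentation (pP i) s) => g lg.
  have [|h [lh eh]] := H (g \o p')%VF.
    split; first exact: rlinear_comp.
    apply/lfunP => x; rewrite !lfun_simp.
    have : res_diff P i.+1 x \in lker p'.
      by rewrite ep' -(res_exactS i.+1); exact: memv_img (memvf x).
    by rewrite memv_ker => /eqP ->; rewrite linear0.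
  exists h; split=> //; apply/lfunP => y; have [x <-] := surjP sp' y.
  by rewrite -[RHS]comp_lfunE eh -diffE !comp_lfunE.
move=> g [lg g0].
have [g' [lg' eg']] : exists g' : 'Hom(res_syzygy i.+1, N), rlinear g' /\ (g' \o p')%VF = g.
  apply: factor_surj => //; rewrite ep' -(res_exactS i.+1); apply/subvP => _ /memv_imgP [x _ ->].
  by rewrite memv_ker -comp_lfunE g0 lfunE.
have [h [lh eh]] := H _ _ _ _ (pP i) s _ lg'.
by exists h; split=> //; rewrite -eg' -diffE comp_lfunA eh.
Qed.
End Resolution.

Lemma Ext_vanishesP i M N : Ext_vanishes i.+1 M N <-> ext_zero i M N.
Proof.
split=> [H|H P]; last exact/res_cocycleP.
have [P _] := exists_proj_resolution M.
by apply/(res_cocycleP N P) => g; exact: H.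
Qed.

Lemma Ext_vanishes_all M N :
  (forall i, (0 < i)%N -> Ext_vanishes i M N) <-> (forall i, ext_zero i M N).
Proof.
split=> H i; first by apply/Ext_vanishesP; exact: H.
by case: i => // i _; exact/Ext_vanishesP.
Qed.
End Ext.

(** * The stable category *)

Section Stable.
Variables (K : fieldType) (A : falgType K).
Implicit Types M N X Y Z P Q I S L : rmod A.

Definition semi_Gproj M : Prop := forall n, ext_zero n M (reg_rmod A).

Definition torsionless M : Prop :=
  forall x : M, x != 0 -> exists h : 'Hom(M, reg_rmod A), rlinear h /\ h x != 0.

Lemma projective_retract X Q (s : 'Hom(X, Q)) (r : 'Hom(Q, X)) :
  projective Q -> rlinear s -> rlinear r -> (r \o s)%VF = \1%VF -> projective X.
Proof.
move=> pQ ls lr rs Y Z g f lg sg lf.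
have [h [lh eh]] := pQ _ _ g (f \o r)%VF lg sg (rlinear_comp lr lf).
exists (h \o s)%VF; split; first exact: rlinear_comp.
by rewrite comp_lfunA eh -comp_lfunA rs comp_lfun1r.
Qed.

Lemma projective_split Q : projective Q ->
  exists s : 'Hom(Q, cover_rmod Q), rlinear s /\ (Defs.cover Q \o s)%VF = \1%VF.
Proof.
move=> pQ; apply: pQ; [exact: cover_rlinear | exact: cover_surj | exact: rlinear_id].
Qed.

Section FreeCoordinates.
Variable n : nat.

Lemma free_coord_ex (i : 'I_n) : exists f : 'Hom(free_rmod A n, reg_rmod A),
  rlinear f /\ forall x, f x = (x : {ffun 'I_n -> A}) i.
Proof.
have [f ef] : exists f : 'Hom(free_rmod A n, reg_rmod A),
    forall x, f x = (x : {ffun 'I_n -> A}) i.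
  by apply: lfun_of_linear => k x y; rewrite !ffunE.
by exists f; split=> // x a; rewrite !ef ffunE.
Qed.

Lemma free_tuple_ex M (h : 'I_n -> 'Hom(M, reg_rmod A)) :
  (forall i, rlinear (h i)) ->
  exists f : 'Hom(M, free_rmod A n),
    rlinear f /\ forall x i, (f x : {ffun 'I_n -> A}) i = h i x.
Proof.
move=> lh; pose f0 (x : M) : {ffun 'I_n -> A} := [ffun i => h i x : A].
have [f ef] : exists f : 'Hom(M, free_rmod A n), forall x, f x = f0 x.
  by apply: lfun_of_linear => k x y; apply/ffunP => i; rewrite !ffunE linearP.
exists f; split=> [x a|x i]; last by rewrite ef ffunE.
by apply/ffunP => i; rewrite !ef !ffunE lh.
Qed.

End FreeCoordinates.

Lemma ext1_free M n : ext1 M (reg_rmod A) -> ext1 M (free_rmod A n).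
Proof.
move=> e L P i p pP s g lg.
have ex j : exists h : 'Hom(P, reg_rmod A), rlinear h /\
    forall x, h (i x) = (g x : {ffun 'I_n -> A}) j.
  have [c [lc ec]] := free_coord_ex j.
  have [h [lh eh]] := e _ _ i p pP s _ (rlinear_comp lg lc).
  by exists h; split=> // x; rewrite -comp_lfunE eh comp_lfunE ec.
have [h eh] := fin_all_exists ex.
have [f [lf ef]] := free_tuple_ex (fun j => proj1 (eh j)).
exists f; split=> //; apply/lfunP => x; apply/ffunP => j.
by rewrite comp_lfunE ef (proj2 (eh j)).
Qed.

Lemma ext1_projective M Q : projective Q -> ext1 M (reg_rmod A) -> ext1 M Q.
Proof.
move=> pQ e L P i p pP s g lg.
have [r [lr er]] := projective_split pQ.
have [h [lh eh]] := ext1_free e pP s (rlinear_comp lg lr).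
exists (Defs.cover Q \o h)%VF; split; first exact: rlinear_comp (@cover_rlinear _ _ Q).
by rewrite -comp_lfunA eh comp_lfunA er comp_lfun1l.
Qed.

Lemma torsionless_projective Q : projective Q -> torsionless Q.
Proof.
move=> pQ x nx; have [s [ls es]] := projective_split pQ.
have nsx : s x != 0.
  apply: contraNneq nx => sx0; have /lfunP/(_ x) := es.
  by rewrite comp_lfunE sx0 linear0 id_lfunE => <-.
have [i ni] : exists i, (s x : {ffun _ -> A}) i != 0.
  apply/existsP; apply: contraNT nsx => /existsPn H; apply/eqP/ffunP => i.
  by rewrite ffunE; apply/eqP; have := H i; rewrite negbK.
have [c [lc ec]] := free_coord_ex i.
by exists (c \o s)%VF; split; [exact: rlinear_comp | rewrite comp_lfunE ec].
Qed.

Lemma torsionless_sub X Y (i : 'Hom(X, Y)) :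
  rlinear i -> lker i == 0%VS -> torsionless Y -> torsionless X.
Proof.
move=> li ki tY x nx.
have [|h [lh hx]] := tY (i x).
  by apply: contraNneq nx => e; apply/eqP/(lker0P ki); rewrite e linear0.
by exists (h \o i)%VF; split; [exact: rlinear_comp | rewrite comp_lfunE].
Qed.

(** [f] factors through a projective module; as every such factorization passes
    through the cover of the target, this is closed under sums. *)
Definition pfac X Y (f : 'Hom(X, Y)) : Prop :=
  exists u : 'Hom(X, cover_rmod Y), rlinear u /\ f = (Defs.cover Y \o u)%VF.

Lemma pfac_factor X Y Q (u : 'Hom(X, Q)) (v : 'Hom(Q, Y)) :
  projective Q -> rlinear u -> rlinear v -> pfac (v \o u)%VF.
Proof.
move=> pQ lu lv.
have [w [lw ew]] := pQ _ _ (Defs.cover Y) v (@cover_rlinear _ _ Y) (@cover_surj _ _ Y) lv.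
exists (w \o u)%VF; split; first exact: rlinear_comp.
by rewrite comp_lfunA ew.
Qed.

Lemma pfac0 X Y : pfac (0 : 'Hom(X, Y)).
Proof. by exists 0; split; [exact: rlinear0 | rewrite comp_lfun0r]. Qed.

Lemma pfacD X Y (f g : 'Hom(X, Y)) : pfac f -> pfac g -> pfac (f + g).
Proof.
move=> [u [lu ->]] [v [lv ->]]; exists (u + v); split; first exact: rlinearD.
by rewrite comp_lfunDr.
Qed.

Lemma pfacZ X Y k (f : 'Hom(X, Y)) : pfac f -> pfac (k *: f).
Proof.
move=> [u [lu ->]]; exists (k *: u); split; first exact: rlinearZ.
by rewrite comp_lfunZr.
Qed.

Lemma pfac_sum X Y (J : finType) (b : pred J) (f : J -> 'Hom(X, Y)) :
  (forall j, b j -> pfac (f j)) -> pfac (\sum_(j | b j) f j).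
Proof. by move=> pf; elim/big_rec: _ => [|j g bj pg]; [exact: pfac0 | apply: pfacD => //; exact: pf]. Qed.

Lemma pfac_compl X Y Z (f : 'Hom(X, Y)) (g : 'Hom(Y, Z)) :
  pfac f -> rlinear g -> pfac (g \o f)%VF.
Proof.
move=> [u [lu ->]] lg; rewrite comp_lfunA; apply: pfac_factor => //.
  exact: free_projective.
exact: rlinear_comp (@cover_rlinear _ _ Y) lg.
Qed.

Lemma pfac_compr X Y Z (f : 'Hom(X, Y)) (g : 'Hom(Y, Z)) :
  rlinear f -> pfac g -> pfac (g \o f)%VF.
Proof.
move=> lf [u [lu ->]]; exists (u \o f)%VF; split; first exact: rlinear_comp.
by rewrite comp_lfunA.
Qed.

Lemma pfac_id X : pfac (\1%VF : 'Hom(X, X)) -> projective X.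
Proof.
move=> [u [lu eu]]; apply: (@projective_retract X (cover_rmod X) u (Defs.cover X)) => //.
  exact: free_projective.
exact: cover_rlinear.
Qed.

Section Syzygy.
Variables (M N L P L2 P2 : rmod A).
Variables (i : 'Hom(L, P)) (p : 'Hom(P, M)) (i2 : 'Hom(L2, P2)) (p2 : 'Hom(P2, N)).
Hypotheses (pP : projective P) (pP2 : projective P2) (s : ses i p) (s2 : ses i2 p2).
Hypothesis eM : ext1 M (reg_rmod A).

Definition induces (e : 'Hom(L, L2)) (f : 'Hom(M, N)) : Prop :=
  exists e0 : 'Hom(P, P2),
    [/\ rlinear e0, (e0 \o i)%VF = (i2 \o e)%VF & (f \o p)%VF = (p2 \o e0)%VF].

(** [Omega] is full on stable categories: as [Ext^1(M, -)] vanishes on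
    projectives, a map of syzygies extends to a map of presentations. *)
Lemma syzygy_full (e : 'Hom(L, L2)) : rlinear e -> exists f : 'Hom(M, N), rlinear f /\ induces e f.
Proof.
move=> le; have [li2 lp2 _ _ _] := s2.
have [e0 [le0 ee0]] := ext1_projective pP2 eM pP s (rlinear_comp le li2).
have [f [lf ef]] : exists f : 'Hom(M, N), rlinear f /\ (f \o p)%VF = (p2 \o e0)%VF.
  apply: (ses_factor s); first exact: rlinear_comp.
  by move=> x; rewrite comp_lfunE -[e0 _]comp_lfunE ee0 comp_lfunE (ses_comp0 _ s2).
by exists f; split=> //; exists e0.
Qed.

(** [Omega] is faithful on stable categories: a factorization of [e] through a
    projective extends from [L] to [P], because [Ext^1(M, -)] vanishes there. *)
Lemma syzygy_faithful (e : 'Hom(L, L2)) (f : 'Hom(M, N)) :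
  rlinear f -> induces e f -> pfac e -> pfac f.
Proof.
move=> lf [e0 [le0 ee0 ef]] [u [lu eu]]; have [li2 lp2 _ _ _] := s2.
have [_ lp _ _ sp] := s.
have pC := @free_projective _ A (\dim {:L2}).
have [v [lv ev]] := ext1_projective pC eM pP s lu.
(* e0 corrected by a map that p2 kills vanishes on L, so f lifts to P2 *)
pose d := (e0 - (i2 \o (Defs.cover L2 \o v)))%VF.
have ld : rlinear d.
  apply: rlinearB => //; apply: rlinear_comp li2.
  exact: rlinear_comp (@cover_rlinear _ _ L2).
have [t [lt et]] : exists t : 'Hom(M, P2), rlinear t /\ (t \o p)%VF = d.
  apply: (ses_factor s) => // x; rewrite !lfun_simp.
  rewrite -[v _]comp_lfunE ev -[e0 _]comp_lfunE ee0 comp_lfunE eu comp_lfunE.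
  by rewrite subrr.
have -> : f = (p2 \o t)%VF.
  apply/lfunP => y; have [x <-] := surjP sp y.
  rewrite comp_lfunE -[t _]comp_lfunE et -comp_lfunE ef comp_lfunE !lfun_simp.
  by rewrite linearD linearN /= (ses_comp0 _ s2) subr0.
exact: pfac_factor.
Qed.
End Syzygy.

(** [Omega] is well defined on stable categories: if [f = v u] with [v] out of a
    projective, [v] lifts to [P2], and subtracting this lift from [e0] leaves a
    map from [P] to [L2] that restricts to [e]. *)
Lemma induced_pfac M N L P L2 P2 (i : 'Hom(L, P)) (p : 'Hom(P, M)) (i2 : 'Hom(L2, P2))
    (p2 : 'Hom(P2, N)) e f :
  projective P -> ses i p -> ses i2 p2 ->
  rlinear e -> induces i p i2 p2 e f -> pfac f -> pfac e.
Proof.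
move=> pP s s2 le [e0 [le0 ee0 ef]] [u [lu eu]].
have [li2 lp2 ki2 _ sp2] := s2; have [li lp _ _ _] := s.
have [v [lv ev]] := free_projective lp2 sp2 (@cover_rlinear _ _ N).
have lvu : rlinear (v \o u \o p)%VF by do 2!apply: rlinear_comp => //.
have [t [lt et]] : exists t : 'Hom(P, L2), rlinear t /\ (i2 \o t)%VF = (e0 - (v \o u \o p))%VF.
  apply: (ses_lift s2); first exact: rlinearB.
  move=> x; rewrite !lfun_simp linearD linearN /= -[p2 (e0 x)]comp_lfunE -ef.
  by rewrite -[p2 (v _)]comp_lfunE ev eu !comp_lfunE subrr.
have -> : e = (t \o i)%VF.
  apply/lfunP => x; apply: (lker0P ki2).
  rewrite comp_lfunE -[i2 (t _)]comp_lfunE et !lfun_simp (ses_comp0 _ s) !linear0 addr0.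
  by rewrite -[e0 _]comp_lfunE ee0 comp_lfunE.
exact: pfac_factor.
Qed.

Lemma inducesZ M N L P L2 P2 (i : 'Hom(L, P)) (p : 'Hom(P, M)) (i2 : 'Hom(L2, P2))
    (p2 : 'Hom(P2, N)) k e f : induces i p i2 p2 e f -> induces i p i2 p2 (k *: e) (k *: f).
Proof.
move=> [e0 [le0 e1 e2]]; exists (k *: e0); split; first exact: rlinearZ.
  by rewrite -comp_lfunZl e1 comp_lfunZr.
by rewrite -comp_lfunZl e2 comp_lfunZr.
Qed.

Lemma inducesD M N L P L2 P2 (i : 'Hom(L, P)) (p : 'Hom(P, M)) (i2 : 'Hom(L2, P2))
    (p2 : 'Hom(P2, N)) e f e' f' : induces i p i2 p2 e f -> induces i p i2 p2 e' f' ->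
  induces i p i2 p2 (e + e') (f + f').
Proof.
move=> [e0 [le0 e1 e2]] [g0 [lg0 g1 g2]]; exists (e0 + g0); split; first exact: rlinearD.
  by rewrite comp_lfunDl e1 g1 comp_lfunDr.
by rewrite comp_lfunDl e2 g2 comp_lfunDr.
Qed.

Lemma induces_comp M N X L P L2 P2 L3 P3 (i : 'Hom(L, P)) (p : 'Hom(P, M)) (i2 : 'Hom(L2, P2))
    (p2 : 'Hom(P2, N)) (i3 : 'Hom(L3, P3)) (p3 : 'Hom(P3, X)) e f e' f' :
  induces i p i2 p2 e f -> induces i2 p2 i3 p3 e' f' ->
  induces i p i3 p3 (e' \o e)%VF (f' \o f)%VF.
Proof.
move=> [e0 [le0 e1 e2]] [g0 [lg0 g1 g2]]; exists (g0 \o e0)%VF; split.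
- exact: rlinear_comp.
- by rewrite -comp_lfunA e1 comp_lfunA g1 comp_lfunA.
- by rewrite -comp_lfunA e2 comp_lfunA g2 comp_lfunA.
Qed.

Lemma induces_id M L P (i : 'Hom(L, P)) (p : 'Hom(P, M)) : induces i p i p \1%VF \1%VF.
Proof.
exists \1%VF; split; first exact: rlinear_id.
  by rewrite comp_lfun1l comp_lfun1r.
by rewrite comp_lfun1l comp_lfun1r.
Qed.

Lemma induces_sum M N L P L2 P2 (i : 'Hom(L, P)) (p : 'Hom(P, M)) (i2 : 'Hom(L2, P2))
    (p2 : 'Hom(P2, N)) (J : finType) (e : J -> _) (f : J -> _) :
  (forall j, induces i p i2 p2 (e j) (f j)) ->
  induces i p i2 p2 (\sum_j e j) (\sum_j f j).
Proof.
move=> H; elim/big_rec2: _ => [|j g g' _ IH]; last exact: inducesD.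
by exists 0; split; rewrite ?comp_lfun0l ?comp_lfun0r //; exact: rlinear0.
Qed.

(** The presentations are arbitrary, so that free covers and minimal covers both
    give syzygies; the recursion peels off the first syzygy because properties
    are transferred from syzygies back to [M]. *)
Fixpoint nth_syzygy n M Z : Prop :=
  if n is m.+1 then
    exists L P (i : 'Hom(L, P)) (p : 'Hom(P, M)),
      [/\ projective P, ses i p & nth_syzygy m L Z]
  else Z = M.

Lemma nth_syzygyD m n M Y Z :
  nth_syzygy m M Y -> nth_syzygy n Y Z -> nth_syzygy (m + n) M Z.
Proof.
elim: m M => [|m IH] M /=; first by move=> ->.
by move=> [L [P [i [p [pP s H]]]]] HZ; exists L, P, i, p; split=> //; exact: IH HZ.
Qed.

Lemma semi_Gproj_syzygy M L P (i : 'Hom(L, P)) (p : 'Hom(P, M)) :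
  projective P -> ses i p -> semi_Gproj M -> semi_Gproj L.
Proof. by move=> pP s sM n; apply/(ext_zero_syzygy _ _ pP s). Qed.

Lemma semi_Gproj_nth_syzygy n M Z : nth_syzygy n M Z -> semi_Gproj M -> semi_Gproj Z.
Proof.
elim: n M => [|n IH] M /=; first by move=> ->.
by move=> [L [P [i [p [pP s H]]]]] sM; exact: IH H (semi_Gproj_syzygy pP s sM).
Qed.

Lemma torsionless_nth_syzygy n M Z : nth_syzygy n.+1 M Z -> torsionless Z.
Proof.
elim: n M => [|n IH] M /= [L [P [i [p [pP s H]]]]]; last exact: IH H.
by case: s => li _ ki _ _; rewrite H; exact: (torsionless_sub li ki (torsionless_projective pP)).
Qed.

Definition stable_retract M N : Prop :=
  exists (f : 'Hom(M, N)) (g : 'Hom(N, M)),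
    [/\ rlinear f, rlinear g & pfac ((g \o f) - \1)%VF].

Lemma stable_retract_syzygy n M N Y Z : semi_Gproj M -> semi_Gproj N ->
  nth_syzygy n M Y -> nth_syzygy n N Z -> stable_retract Y Z -> stable_retract M N.
Proof.
elim: n M N => [|n IH] M N sM sN /=; first by move=> -> ->.
move=> [L [P [i [p [pP s H]]]]] [L2 [P2 [i2 [p2 [pP2 s2 H2]]]]] rYZ.
have [||f [g [lf lg fg]]] := IH L L2 _ _ H H2 rYZ.
- exact: semi_Gproj_syzygy pP s sM.
- exact: semi_Gproj_syzygy pP2 s2 sN.
have [f' [lf' ff']] := syzygy_full pP pP2 s s2 (sM 0%N) lf.
have [g' [lg' gg']] := syzygy_full pP2 pP s2 s (sN 0%N) lg.
exists f', g'; split=> //.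
apply: (syzygy_faithful pP pP s s (sM 0%N) (e := ((g \o f) - \1)%VF)) => //.
  by apply: rlinearB; [exact: rlinear_comp | exact: rlinear_id].
apply: inducesD; first exact: induces_comp ff' gg'.
rewrite -[X in induces _ _ _ _ X _]scaleN1r -[X in induces _ _ _ _ _ X]scaleN1r.
by apply: inducesZ; exact: induces_id.
Qed.

(** If [g f - 1] factors through [u : M -> F] with [F] free, then [f] and [u]
    have no common kernel. *)
Lemma torsionless_stable_retract M N : stable_retract M N -> torsionless N -> torsionless M.
Proof.
move=> [f [g [lf lg [u [lu eu]]]]] tN x nx.
have [fx0|nfx] := eqVneq (f x) 0; last first.
  have [h [lh hx]] := tN _ nfx; exists (h \o f)%VF.
  by split; [exact: rlinear_comp | rewrite comp_lfunE].
have [|h [lh hx]] := torsionless_projective (@free_projective _ A (\dim {:M})) (x := u x).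
  apply: contraNneq nx => ux0; have /lfunP/(_ x) := eu.
  rewrite !lfun_simp fx0 ux0 !linear0 add0r => /eqP.
  by rewrite oppr_eq0.
by exists (h \o u)%VF; split; [exact: rlinear_comp | rewrite comp_lfunE].
Qed.

(** Linear independence in the stable endomorphism ring of [M]; the number of
    members of such families replaces the dimension of that ring. *)
Definition stably_free_family M k (e : 'I_k -> 'Hom(M, M)) : Prop :=
  (forall j, rlinear (e j)) /\
  (forall c : 'I_k -> K, pfac (\sum_j c j *: e j) -> forall j, c j = 0).

Lemma stably_free_family_syzygy n M Z k (e : 'I_k -> 'Hom(Z, Z)) : semi_Gproj M ->
  nth_syzygy n M Z -> stably_free_family e ->
  exists e' : 'I_k -> 'Hom(M, M), stably_free_family e'.
Proof.
elim: n M => [|n IH] M sM /=; first by move=> E; move: e; rewrite E => e; exists e.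
move=> [L [P [i [p [pP s H]]]]] fe.
have [|e1 [le1 fe1]] := IH L _ H fe; first exact: semi_Gproj_syzygy pP s sM.
have [e2 he2] := fin_all_exists (fun j => syzygy_full pP pP s s (sM 0%N) (le1 j)).
exists e2; split=> [j|c pc]; first by case: (he2 j).
apply: fe1; apply: (induced_pfac pP s s) pc.
  by apply: rlinear_sum => j; exact: rlinearZ.
by apply: induces_sum => j; apply: inducesZ; case: (he2 j).
Qed.

Lemma stably_free_family_le M k (e : 'I_k -> 'Hom(M, M)) :
  stably_free_family e -> (k <= \dim {:'Hom(M, M)})%N.
Proof.
move=> [le fe]; pose X := [tuple e j | j < k].
have fX : free X.
  apply/freeP => c H j; apply: fe; rewrite (_ : \sum_j _ = 0); last first.
    by rewrite -[RHS]H; apply: eq_bigr => i _; rewrite -tnth_nth tnth_mktuple.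
  exact: pfac0.
by rewrite -(size_tuple X) -(eqP fX) dimvS ?subvf.
Qed.

End Stable.

(** * Finitely many syzygies make semi-Gorenstein-projective modules torsionless *)

Section Biproduct.
Variables (K : fieldType) (A : falgType K).
Implicit Types M N Y Z P Q L : rmod A.

(** Direct sums are given by inclusions and projections rather than by submodules,
    so that additive functors of either variance preserve them. *)
Definition is_biproduct (J : Type) (X : J -> rmod A) Z : Prop :=
  exists (T : finType) (c : T -> J)
    (io : forall j, 'Hom(X (c j), Z)) (pr : forall j, 'Hom(Z, X (c j))),
    [/\ forall j, rlinear (io j), forall j, rlinear (pr j),
        forall i j, i != j -> (pr i \o io j)%VF = 0,
        forall j, (pr j \o io j)%VF = \1%VF
      & (\sum_j (io j \o pr j))%VF = \1%VF].

Lemma biproduct_direct (J : Type) (X : J -> rmod A) Y Z (W : rmod A) (i : 'Hom(Y, W)) (p : 'Hom(W, Y))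
    (j : 'Hom(Z, W)) (q : 'Hom(W, Z)) :
  [/\ rlinear i, rlinear p, rlinear j & rlinear q] ->
  [/\ (p \o i)%VF = \1%VF, (q \o j)%VF = \1%VF, (p \o j)%VF = 0 & (q \o i)%VF = 0] ->
  ((i \o p) + (j \o q))%VF = \1%VF ->
  is_biproduct X Y -> is_biproduct X Z -> is_biproduct X W.
Proof.
move=> [li lp lj lq] [pi qj pj qi] e.
move=> [T [c [io [pr [lio lpr o id1 e1]]]]] [T' [c' [io' [pr' [lio' lpr' o' id1' e1']]]]].
pose d (s : T + T') := match s with inl a => c a | inr b => c' b end.
pose ino (s : T + T') : 'Hom(X (d s), W) :=
  match s with inl a => (i \o io a)%VF | inr b => (j \o io' b)%VF end.
pose prj (s : T + T') : 'Hom(W, X (d s)) :=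
  match s with inl a => (pr a \o p)%VF | inr b => (pr' b \o q)%VF end.
have mid (U1 U2 U3 U4 U5 : rmod A) (f : 'Hom(U1, U2)) (g : 'Hom(U2, U3)) (h : 'Hom(U3, U4))
    (k : 'Hom(U4, U5)) : ((k \o h) \o (g \o f))%VF = ((k \o (h \o g)) \o f)%VF.
  by rewrite !comp_lfunA.
exists (T + T')%type, d, ino, prj; split.
- by case=> [a|b] /=; exact: rlinear_comp.
- by case=> [a|b] /=; exact: rlinear_comp.
- move=> [a|b] [a'|b'] nab; rewrite /= mid ?pi ?qj ?pj ?qi ?comp_lfun1r ?comp_lfun0r ?comp_lfun0l //.
    by apply: o.
  by apply: o'.
- by case=> [a|b]; rewrite /= mid ?pi ?qj ?comp_lfun1r.
rewrite big_sumType /= -e; congr (_ + _); apply/lfunP => x.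
  rewrite sum_lfunE -[in RHS](comp_lfun1l p) -e1 comp_lfunE comp_lfunE sum_lfunE linear_sum.
  by apply: eq_bigr => a _; rewrite !comp_lfunE.
rewrite sum_lfunE -[in RHS](comp_lfun1l q) -e1' comp_lfunE comp_lfunE sum_lfunE linear_sum.
by apply: eq_bigr => a _; rewrite !comp_lfunE.
Qed.

Lemma biproduct_iso (J : Type) (X : J -> rmod A) k Z (f : 'Hom(X k, Z)) :
  rlinear f -> lker f == 0%VS -> surj f -> is_biproduct X Z.
Proof.
move=> lf kf sf.
exists unit, (fun=> k), (fun=> f), (fun=> (f^-1)%VF); split.
- by [].
- by move=> _ y a; have [x <-] := surjP sf y; rewrite -lf !lker0_lfunK.
- by case; case.
- by move=> _; apply/lfunP => x; rewrite comp_lfunE lker0_lfunK // id_lfunE.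
apply/lfunP => y; rewrite sum_lfunE (big_pred1 tt); last by case.
by rewrite comp_lfunE limg_lfunVK ?id_lfunE // sf memvf.
Qed.

Lemma biproduct0 (J : Type) (X : J -> rmod A) Z :
  (fullv : {vspace Z}) = 0%VS -> is_biproduct X Z.
Proof.
move=> Z0; exists void, (fun v : void => match v with end), (fun v : void => match v with end),
  (fun v : void => match v with end); split=> //; try by case.
apply/lfunP => z; have : z \in fullv by exact: memvf.
by rewrite Z0 memv0 => /eqP ->; rewrite !linear0.
Qed.

Section Finite.
Variables (t : nat) (X : 'I_t -> rmod A).

(** A decomposition in the stable category. The summands are recorded by an
    element of a finite type, to which the pigeonhole principle applies. *)
Definition stable_biproduct D (x : {k : 'I_D.+1 & {ffun 'I_k -> 'I_t}}) Z : Prop :=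
  exists (io : forall j, 'Hom(X (tagged x j), Z)) (pr : forall j, 'Hom(Z, X (tagged x j))),
    [/\ forall j, rlinear (io j), forall j, rlinear (pr j),
        forall i j, i != j -> (pr i \o io j)%VF = 0,
        forall j, (pr j \o io j)%VF = \1%VF
      & pfac ((\sum_j (io j \o pr j)) - \1)%VF].

Lemma stable_biproduct_retract D (x : {k : 'I_D.+1 & {ffun 'I_k -> 'I_t}}) Y Z :
  stable_biproduct x Y -> stable_biproduct x Z -> stable_retract Y Z.
Proof.
move=> [io [pr [lio lpr _ _ pY]]] [io' [pr' [lio' lpr' o' i' _]]].
exists (\sum_j (io' j \o pr j))%VF, (\sum_j (io j \o pr' j))%VF; split.
- by apply: rlinear_sum => j; exact: rlinear_comp.
- by apply: rlinear_sum => j; exact: rlinear_comp.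
rewrite (_ : (_ \o _)%VF = (\sum_j (io j \o pr j))%VF) //.
apply/lfunP => y; rewrite comp_lfunE !sum_lfunE; apply: eq_bigr => j _.
rewrite !comp_lfunE linear_sum (bigD1 j) //= big1 => [|l nl].
  by rewrite addr0 comp_lfunE -[pr' j _]comp_lfunE i' id_lfunE.
by rewrite comp_lfunE -[pr' j _]comp_lfunE o' ?lfunE // eq_sym.
Qed.

Lemma biproduct_stable_free Z k (c : 'I_k -> 'I_t)
    (io : forall j, 'Hom(X (c j), Z)) (pr : forall j, 'Hom(Z, X (c j))) :
  (forall j, rlinear (io j)) -> (forall j, rlinear (pr j)) ->
  (forall i j, i != j -> (pr i \o io j)%VF = 0) ->
  (forall j, (pr j \o io j)%VF = \1%VF) ->
  (forall j, ~ projective (X (c j))) ->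
  stably_free_family (fun j => io j \o pr j)%VF.
Proof.
move=> lio lpr o id1 np; split=> [j|a pa j]; first exact: rlinear_comp.
have [//|nz] := eqVneq (a j) 0; case: (np j).
apply: pfac_id; have := pfacZ (a j)^-1 (pfac_compr (lio j) (pfac_compl pa (lpr j))).
rewrite (_ : _ *: _ = \1%VF) //; apply/lfunP => x.
rewrite scale_lfunE !comp_lfunE sum_lfunE linear_sum (bigD1 j) //= big1 => [|l nl].
  rewrite addr0 scale_lfunE comp_lfunE -[pr j (io j x)]comp_lfunE id1 id_lfunE.
  rewrite !linearZ /= -[pr j (io j x)]comp_lfunE id1 !id_lfunE.
  by rewrite scalerA mulfV ?scale1r.
rewrite scale_lfunE comp_lfunE -[pr l _]comp_lfunE o // lfunE /=.
by rewrite !linear0.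
Qed.

(** The non-projective summands of [Z] give orthogonal idempotents of [Z] that
    are linearly independent modulo maps factoring through projectives; stable
    endomorphisms of [Z] and [M] correspond, so there are at most
    [dim End_K(M)] of them. *)
Lemma biproduct_stable n M Z : semi_Gproj M -> nth_syzygy n M Z -> is_biproduct X Z ->
  exists x : {k : 'I_(\dim {:'Hom(M, M)}).+1 & {ffun 'I_k -> 'I_t}}, stable_biproduct x Z.
Proof.
move=> sM sZ [U [c [io [pr [lio lpr o id1 e1]]]]].
have ex i : exists b : bool, b <-> projective (X i).
  by have [p|np] := classic (projective (X i)); [exists true | exists false].
have [b eb] := fin_all_exists ex.
pose S := [set j | ~~ b (c j)].
pose c' : {ffun 'I_#|S| -> 'I_t} := [ffun j => c (enum_val j)].
have fr : stably_free_family (fun j : 'I_#|S| => io (enum_val j) \o pr (enum_val j))%VF.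
  apply: biproduct_stable_free => // [i j nij|j].
    by apply: o; apply: contra nij => /eqP /enum_val_inj ->.
  by have := enum_valP j; rewrite inE => /negP nb pX; apply/nb/eb.
have [e' /stably_free_family_le le] := stably_free_family_syzygy sM sZ fr.
have le' : (#|S| < (\dim {:'Hom(M, M)}).+1)%N by [].
pose k' := Ordinal le'.
suff [io' [pr' H]] : exists (io' : forall j, 'Hom(X (c' j), Z)) (pr' : forall j, 'Hom(Z, X (c' j))),
    [/\ forall j, rlinear (io' j), forall j, rlinear (pr' j),
        forall i j, i != j -> (pr' i \o io' j)%VF = 0,
        forall j, (pr' j \o io' j)%VF = \1%VF
      & pfac ((\sum_j (io' j \o pr' j)) - \1)%VF].
  by exists (@Tagged _ k' (fun k : 'I_(\dim {:'Hom(M, M)}).+1 => {ffun 'I_k -> 'I_t}) c'),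
     io', pr'.
have dE : (c' : _ -> _) = (fun j => c (enum_val j)).
  by apply: functional_extensionality => j; rewrite ffunE.
have gen (d : 'I_#|S| -> 'I_t) : d = (fun j => c (enum_val j)) ->
  exists (io' : forall j, 'Hom(X (d j), Z)) (pr' : forall j, 'Hom(Z, X (d j))),
    [/\ forall j, rlinear (io' j), forall j, rlinear (pr' j),
        forall i j, i != j -> (pr' i \o io' j)%VF = 0,
        forall j, (pr' j \o io' j)%VF = \1%VF
      & pfac ((\sum_j (io' j \o pr' j)) - \1)%VF].
  move=> ->; exists (fun j => io (enum_val j)), (fun j => pr (enum_val j)).
  split=> // [i j nij|].
    by apply: o; apply: contra nij => /eqP /enum_val_inj ->.
  rewrite -e1 (bigID (fun j => j \in S)) /= opprD (@big_enum_val _ _ _ _ (mem S)) /=.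
  rewrite addrA subrr add0r -scaleN1r; apply: pfacZ; apply: pfac_sum => j.
  rewrite inE negbK => /eb pX; exact: pfac_factor.
exact: gen dE.
Qed.

(** If syzygies of some fixed order are direct sums of finitely many modules,
    two of the iterated syzygies [Y r] of [M] have the same non-projective
    summands, say those of index [a < b]; as taking syzygies is fully faithful
    on the stable category of semi-Gorenstein-projective modules, [M] is a stable
    retract of [Y (b - a)], a submodule of a projective. *)
Theorem semi_Gproj_torsionless n0 M :
  (0 < n0)%N -> (forall N, exists Z, nth_syzygy n0 N Z /\ is_biproduct X Z) ->
  semi_Gproj M -> torsionless M.
Proof.
move=> n0_gt0 fin sM.
pose next N := proj1_sig (constructive_indefinite_description _ (fin N)).
have nextP N : nth_syzygy n0 N (next N) /\ is_biproduct X (next N).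
  exact: proj2_sig (constructive_indefinite_description _ (fin N)).
pose Y r := iter r next M.
have sY r d : nth_syzygy (r * n0) (Y d) (Y (r + d)%N).
  elim: r => [|r IH] //=; rewrite mulSn addnC; apply: nth_syzygyD IH _.
  exact: (proj1 (nextP _)).
pose T := {k : 'I_(\dim {:'Hom(M, M)}).+1 & {ffun 'I_k -> 'I_t}}.
have ex (r : 'I_#|{: T}|.+1) : exists x : T, stable_biproduct x (Y r.+1).
  apply: (@biproduct_stable (r.+1 * n0) M) => //; last exact: (proj2 (nextP _)).
  by have := sY r.+1 0%N; rewrite addn0.
(* pigeonhole: the summands of more modules than there are values must repeat *)
have [f ef] := fin_all_exists ex.
have /injectivePn [a [b nab fab]] : ~~ injectiveb f.
  by apply/injectiveP => /leq_card; rewrite card_ord ltnn.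
wlog ltab : a b nab fab / (a < b)%N => [H|].
  case: (ltngtP a b) => [lt|gt|e]; first exact: (H a b).
    by apply: (H b a); rewrite // eq_sym.
  by move: nab; rewrite (ord_inj e) eqxx.
have eb : (b.+1 = a.+1 + (b - a))%N by rewrite addSn subnKC // ltnW.
have rY : stable_retract (Y a.+1) (Y b.+1).
  by apply: stable_biproduct_retract (ef a) _; rewrite fab.
have sM' : semi_Gproj (Y (b - a)%N).
  by apply: semi_Gproj_nth_syzygy sM; have := sY (b - a)%N 0%N; rewrite addn0; apply.
have rM : stable_retract M (Y (b - a)%N).
  apply: stable_retract_syzygy sM sM' _ _ rY.
    by have := sY a.+1 0%N; rewrite addn0; apply.
  by rewrite eb; exact: sY.
apply: torsionless_stable_retract rM _.
have := sY (b - a)%N 0%N; rewrite addn0.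
by case E: (_ * _)%N => [|n]; [move/eqP: E; rewrite muln_eq0 subn_eq0 leqNgt ltab gtn_eqF | exact: torsionless_nth_syzygy].
Qed.
End Finite.
End Biproduct.

(** * Duals and transposes *)

Section RegularDual.
Variables (K : fieldType) (A : falgType K).
Implicit Types M N X Y Z P Q L C : rmod A.

Lemma ext_zero_projective n P N : projective P -> ext_zero n P N.
Proof.
move=> pP; elim: n N => [|n IH] N; last by move=> I S j q _ _; exact: IH.
move=> L Q i p pQ s g lg; have [li lp ki e sp] := s.
have [u [lu eu]] := pP _ _ p \1%VF lp sp (@rlinear_id _ _ _).
have lup : rlinear (u \o p)%VF by exact: rlinear_comp.
have [t [lt et]] : exists t : 'Hom(Q, L), rlinear t /\ (i \o t)%VF = (\1 - (u \o p))%VF.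
  apply: (ses_lift s); first exact: rlinearB (@rlinear_id _ _ _) lup.
  move=> x; rewrite !lfun_simp linearD linearN /= -[p (u _)]comp_lfunE eu.
  by rewrite id_lfunE subrr.
exists (g \o t)%VF; split; first exact: rlinear_comp.
apply/lfunP => x; rewrite !comp_lfunE; congr (g _); apply: (lker0P ki).
by rewrite -[i (t _)]comp_lfunE et !lfun_simp (ses_comp0 _ s) !linear0 addr0.
Qed.

Lemma semi_Gproj_projective P : projective P -> semi_Gproj P.
Proof. by move=> pP n; exact: ext_zero_projective. Qed.

Definition dual_val M (h : hom_reg M) : 'Hom(M, reg_rmod A) := vsval h.

Lemma dual_val_rlinear M (h : hom_reg M) : rlinear (dual_val h).
Proof. by apply/rhomP; exact: subvsP. Qed.

Lemma dual_val_ex M (f : 'Hom(M, reg_rmod A)) : rlinear f ->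
  exists h : hom_reg M, dual_val h = f.
Proof.
move=> /rhomP lf; exists (vsproj (rhom M (reg_rmod A)) f : hom_reg M).
by rewrite /dual_val vsprojK.
Qed.

Lemma dual_val_inj M (h h' : hom_reg M) : (forall x, dual_val h x = dual_val h' x) -> h = h'.
Proof. by move=> e; apply: subvs_inj; apply/lfunP. Qed.

Lemma dual_valM M (h : hom_reg M) (a : opalg A) x :
  dual_val (ract h a) x = (a : A) * dual_val h x.
Proof. exact: hom_regE. Qed.

Lemma dual_valP M k (h h' : hom_reg M) x :
  dual_val (k *: h + h') x = k *: dual_val h x + dual_val h' x.
Proof. by rewrite /dual_val linearP /= add_lfunE scale_lfunE. Qed.

Lemma dual_val0 M x : dual_val (0 : hom_reg M) x = 0.
Proof. by rewrite /dual_val linear0 lfunE. Qed.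

Lemma dual_val_sum M n (h : 'I_n -> hom_reg M) x :
  dual_val (\sum_i h i) x = \sum_i dual_val (h i) x.
Proof. by rewrite /dual_val linear_sum sum_lfunE. Qed.

Lemma dual_map_val M N (f : 'Hom(M, N)) (h : hom_reg N) x : rlinear f ->
  dual_val (hom_reg_map f h) x = dual_val h (f x).
Proof. by move=> lf; rewrite /dual_val hom_reg_mapE // comp_lfunE. Qed.

Lemma dual_map_rlinear M N (f : 'Hom(M, N)) : rlinear f -> rlinear (hom_reg_map f).
Proof.
move=> lf h a; apply: dual_val_inj => x.
by rewrite dual_map_val // !dual_valM dual_map_val.
Qed.

Lemma dual_eval_ex M (m : M) : exists e : 'Hom(hom_reg M, reg_rmod (opalg A)),
  rlinear e /\ forall h, e h = dual_val h m.
Proof.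
have [e ee] : exists e : 'Hom(hom_reg M, reg_rmod (opalg A)), forall h, e h = dual_val h m.
  by apply: lfun_of_linear => k h h'; exact: dual_valP.
by exists e; split=> // h a; rewrite !ee dual_valM.
Qed.

Lemma dual_ses L P M (i : 'Hom(L, P)) (p : 'Hom(P, M)) : ses i p ->
  (forall g : 'Hom(L, reg_rmod A), rlinear g ->
     exists h : 'Hom(P, reg_rmod A), rlinear h /\ (h \o i)%VF = g) ->
  ses (hom_reg_map p) (hom_reg_map i).
Proof.
move=> s ext; have [li lp ki e sp] := s; split.
- exact: dual_map_rlinear.
- exact: dual_map_rlinear.
- apply/lker0P => h h' eh; apply: dual_val_inj => y; have [x <-] := surjP sp y.
  by rewrite -!dual_map_val // eh.
- apply/vspaceP => h; apply/memv_imgP/idP => [[h0 _ ->]|].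
    rewrite memv_ker; apply/eqP/dual_val_inj => x.
    by rewrite !dual_map_val // (ses_comp0 _ s) linear0 dual_val0.
  rewrite memv_ker => /eqP e0.
  have [|f [lf ef]] := ses_factor s (dual_val_rlinear h).
    by move=> x; rewrite -dual_map_val // e0 dual_val0.
  have [h0 eh0] := dual_val_ex lf; exists h0; first exact: memvf.
  by apply: dual_val_inj => x; rewrite dual_map_val // eh0 -ef comp_lfunE.
- apply: surjW => g; have [f [lf ef]] := ext _ (dual_val_rlinear g).
  have [h eh] := dual_val_ex lf; exists h; apply: dual_val_inj => x.
  by rewrite dual_map_val // eh -ef comp_lfunE.
Qed.

Lemma dual_val_free n (h : hom_reg (free_rmod A n)) (x : free_rmod A n) :
  dual_val h x = \sum_i dual_val h (free_gen A i) * (x : {ffun 'I_n -> A}) i.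
Proof.
by rewrite {1}(free_genE x) linear_sum; apply: eq_bigr => i _; exact: dual_val_rlinear.
Qed.

Lemma dual_free_projective n : projective (hom_reg (free_rmod A n)).
Proof.
have exc i : exists c : hom_reg (free_rmod A n), forall x, dual_val c x = (x : {ffun _ -> A}) i.
  have [c [lc ec]] := @free_coord_ex K A n i; have [h eh] := dual_val_ex lc.
  by exists h => x; rewrite eh ec.
have [c ec] := fin_all_exists exc.
have exv i : exists e : 'Hom(hom_reg (free_rmod A n), reg_rmod (opalg A)),
    rlinear e /\ forall h, e h = dual_val h (free_gen A i) by exact: dual_eval_ex.
have [ev eev] := fin_all_exists exv.
have [s [ls es]] := free_tuple_ex (fun i => proj1 (eev i)).
refine (projective_retract (@free_projective K (opalg A) n) ls (free_map_rlinear c) _).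
apply/lfunP => h; rewrite comp_lfunE id_lfunE free_mapE; apply: dual_val_inj => x.
rewrite dual_val_sum dual_val_free.
by apply: eq_bigr => i _; rewrite dual_valM ec es (proj2 (eev i)).
Qed.

Lemma dual_projective P : projective P -> projective (hom_reg P).
Proof.
move=> pP; have [s [ls es]] := projective_split pP.
have lc := dual_map_rlinear (@cover_rlinear _ _ P).
refine (projective_retract (@dual_free_projective _) lc (dual_map_rlinear ls) _).
apply/lfunP => h; apply: dual_val_inj => x; rewrite comp_lfunE id_lfunE.
rewrite !dual_map_val //; last exact: cover_rlinear.
by rewrite -[Defs.cover P _]comp_lfunE es id_lfunE.
Qed.

(** The map given by a basis of [Hom(M, A)]: it is injective because [M] is
    torsionless, and all functionals on [M] are combinations of its entries. *)
Lemma left_approximation M : torsionless M ->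
  exists n C (j : 'Hom(M, free_rmod A n)) (q : 'Hom(free_rmod A n, C)),
    ses j q /\ forall h : 'Hom(M, reg_rmod A), rlinear h ->
      exists g : 'Hom(free_rmod A n, reg_rmod A), rlinear g /\ (g \o j)%VF = h.
Proof.
move=> tM; pose n := \dim (rhom M (reg_rmod A)).
pose b (i : 'I_n) : 'Hom(M, reg_rmod A) := (vbasis (rhom M (reg_rmod A)))`_i.
have lb i : rlinear (b i).
  by apply/rhomP; apply: vbasis_mem; rewrite mem_nth // size_tuple.
have [j [lj ej]] := free_tuple_ex lb.
have ext (h : 'Hom(M, reg_rmod A)) : rlinear h ->
    exists g : 'Hom(free_rmod A n, reg_rmod A), rlinear g /\ (g \o j)%VF = h.
  move=> /rhomP lh.
  have [c ec] := fin_all_exists (@free_coord_ex K A n).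
  exists (\sum_i coord (vbasis (rhom M (reg_rmod A))) i h *: c i); split.
    by apply: rlinear_sum => i; apply: rlinearZ; case: (ec i).
  apply/lfunP => x; rewrite [in RHS](coord_vbasis lh) comp_lfunE !sum_lfunE.
  by apply: eq_bigr => i _; rewrite !scale_lfunE (proj2 (ec i)) ej.
have kj : lker j == 0%VS.
  apply/eqP/vspaceP => x; rewrite memv0 memv_ker; apply/eqP/eqP => [jx0|->]; last exact: linear0.
  apply/eqP/negP => /negP nx; have [h [lh]] := tM _ nx.
  have [g [lg <-]] := ext h lh.
  by rewrite comp_lfunE jx0 linear0 eqxx.
have sj : submodule (limg j).
  move=> _ a /memv_imgP [x _ ->]; rewrite -lj; exact: memv_img (memvf _).
have [C [q [lq sq kq]]] := exists_coker sj.
by exists n, C, j, q.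
Qed.

Section AllTorsionless.
Hypothesis torsionless_semi : forall M, semi_Gproj M -> torsionless M.

(** The cokernel of the approximation is again semi-Gorenstein-projective: [Ext^1]
    vanishes by the approximation property and the higher groups by shifting. *)
Lemma semi_Gproj_cosyzygy M : semi_Gproj M ->
  exists n C (j : 'Hom(M, free_rmod A n)) (q : 'Hom(free_rmod A n, C)),
    [/\ ses j q, semi_Gproj C & ses (hom_reg_map q) (hom_reg_map j)].
Proof.
move=> sM; have [n [C [j [q [s ext]]]]] := left_approximation (torsionless_semi sM).
have pF := @free_projective K A n.
exists n, C, j, q; split=> //; last exact: dual_ses.
case=> [|m]; first exact: ext1_presentation pF s ext.
by apply/(ext_zero_syzygy _ _ pF s); exact: sM.
Qed.

(** Let [F] and [C] be as in [semi_Gproj_cosyzygy]. A functional on [M^*] pulls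
    back to [F^*], where it is evaluation at some [x] in [F]; it kills [C^*], so
    [x] vanishes in the torsionless module [C] and comes from [M]. *)
Lemma semi_Gproj_reflexive M (phi : 'Hom(hom_reg M, reg_rmod (opalg A))) :
  semi_Gproj M -> rlinear phi -> exists m, forall h, phi h = dual_val h m.
Proof.
move=> sM lphi; have [n [C [j [q [s sC s']]]]] := semi_Gproj_cosyzygy sM.
have [lj lq kj e sq] := s; have [_ lj' _ _ sj'] := s'.
have exc i : exists c : hom_reg (free_rmod A n), forall x, dual_val c x = (x : {ffun _ -> A}) i.
  have [c [lc ec]] := @free_coord_ex K A n i; have [h eh] := dual_val_ex lc.
  by exists h => x; rewrite eh ec.
have [c ec] := fin_all_exists exc.
pose x : free_rmod A n := [ffun i => phi (hom_reg_map j (c i)) : A].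
have ex h : phi (hom_reg_map j h) = dual_val h x.
  have -> : h = \sum_i ract (c i) (dual_val h (free_gen A i)).
    apply: dual_val_inj => y; rewrite dual_val_sum dual_val_free.
    by apply: eq_bigr => i _; rewrite dual_valM ec.
  rewrite !linear_sum dual_val_sum; apply: eq_bigr => i _.
  rewrite -[LHS]/(phi (hom_reg_map j (ract (c i) (dual_val h (free_gen A i))))).
  by rewrite lj' lphi dual_valM ec ffunE.
have qx : q x = 0.
  apply/eqP/negP => /negP /(torsionless_semi sC) [h [lh /negP]]; apply; apply/eqP.
  have [h' <-] := dual_val_ex lh; rewrite -dual_map_val // -ex.
  by rewrite (ses_comp0 _ s') linear0.
have [m em] := ses_ker s qx; exists m => h.
have [g <-] := surjP sj' h.
by rewrite ex em dual_map_val.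
Qed.

(** By induction along [0 -> C^* -> F^* -> M^* -> 0]: a functional on [C^*] is
    evaluation at the image in [C] of some [x] in [F], so it extends to
    evaluation at [x] on [F^*]. *)
Lemma dual_semi_Gproj M : semi_Gproj M -> semi_Gproj (hom_reg M).
Proof.
move=> sM n; elim: n M sM => [|n IH] M sM;
  have [m [C [j [q [s sC s']]]]] := semi_Gproj_cosyzygy sM;
  have pF := @dual_free_projective m.
  have [lj lq _ _ sq] := s.
  apply: (ext1_presentation pF s') => g lg.
  have [c ec] := semi_Gproj_reflexive sC lg; have [x xc] := surjP sq c.
  have [e [le ee]] := dual_eval_ex x; exists e; split=> //.
  by apply/lfunP => h; rewrite comp_lfunE ee dual_map_val // xc ec.
by apply/(ext_zero_syzygy _ _ pF s'); exact: IH.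
Qed.

(** The presentation of [M] dualizes to [0 -> M^* -> P0^* -> P1^* -> T -> 0], and
    functionals on [P0^*] and [P1^*] are evaluations. Vanishing of [Ext^1(T, A)]
    amounts to torsionlessness of [M], that of [Ext^2(T, A)] to reflexivity, and
    the higher groups are those of [M^*]. *)
Lemma transpose_semi_Gproj M (T : rmod (opalg A)) :
  semi_Gproj M -> transpose_of M T -> semi_Gproj T.
Proof.
move=> sM [P1 [P0 [f [p [q [[pP1 pP0] [lf lp sp e] [lq sq e']]]]]]].
have sP0 := semi_Gproj_projective pP0.
have pD1 := dual_projective pP1; have pD0 := dual_projective pP0.
have s1 := ses_kernel lq sq; set u := sub_incl _ in s1.
have [lu _ ku _ _] := s1.
have [f1 [lf1 ef1]] : exists f1 : 'Hom(hom_reg P0, sub_rmod (lker_submodule lq)),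
    rlinear f1 /\ (u \o f1)%VF = hom_reg_map f.
  apply: sub_corestrict; first exact: dual_map_rlinear.
  by rewrite e'.
have f1E h x : dual_val (u (f1 h)) x = dual_val h (f x).
  by rewrite -[u _]comp_lfunE ef1 dual_map_val.
have s2 : ses (hom_reg_map p) f1.
  split=> //; first exact: dual_map_rlinear.
  - apply/lker0P => h h' eh; apply: dual_val_inj => y; have [x <-] := surjP sp y.
    by rewrite -!dual_map_val // eh.
  - apply/vspaceP => h; apply/memv_imgP/idP => [[h0 _ ->]|].
      rewrite memv_ker; apply/eqP/(lker0P ku); rewrite linear0.
      apply: dual_val_inj => x; rewrite f1E dual_map_val // dual_val0.
      have : f x \in lker p by rewrite -e; exact: memv_img (memvf x).
      by rewrite memv_ker => /eqP ->; rewrite linear0.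
    rewrite memv_ker => /eqP f1h.
    have [|g [lg eg]] := factor_surj lp sp (dual_val_rlinear h).
      rewrite -e; apply/subvP => _ /memv_imgP [x _ ->].
      by rewrite memv_ker -f1E f1h linear0 dual_val0.
    have [h0 eh0] := dual_val_ex lg; exists h0; first exact: memvf.
    by apply: dual_val_inj => x; rewrite dual_map_val // eh0 -eg comp_lfunE.
  apply: surjW => y.
  have : vsval y \in limg (hom_reg_map f) by rewrite e'; exact: subvsP.
  case/memv_imgP => h _ ey; exists h; apply: (lker0P ku).
  by rewrite -comp_lfunE ef1 -ey [RHS]sub_inclE.
case=> [|[|n]].
- apply: (ext1_presentation pD1 s1) => g lg.
  (* g is evaluation at x on P0^*; it kills M^*, so x comes from some y in P1 *)
  have [x ex] := semi_Gproj_reflexive sP0 (rlinear_comp lf1 lg).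
  have px : p x = 0.
    apply/eqP/negP => /negP /(torsionless_semi sM) [h [lh /negP]]; apply; apply/eqP.
    have [h' <-] := dual_val_ex lh; rewrite -dual_map_val // -ex comp_lfunE.
    by rewrite (ses_comp0 _ s2) linear0.
  have : x \in limg f by rewrite e memv_ker px.
  case/memv_imgP => y _ xy.
  have [ev [lev eev]] := dual_eval_ex y; exists ev; split=> //.
  have [_ _ _ _ sf1] := s2.
  apply/lfunP => k; have [h <-] := surjP sf1 k.
  by rewrite comp_lfunE eev f1E -xy -ex comp_lfunE.
- apply/(ext_zero_syzygy _ _ pD1 s1); apply: (ext1_presentation pD0 s2) => g lg.
  have [m em] := semi_Gproj_reflexive sM lg; have [x xm] := surjP sp m.
  have [ev [lev eev]] := dual_eval_ex x; exists ev; split=> //.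
  by apply/lfunP => h; rewrite comp_lfunE eev dual_map_val // xm em.
apply/(ext_zero_syzygy _ _ pD1 s1); apply/(ext_zero_syzygy _ _ pD0 s2).
exact: dual_semi_Gproj.
Qed.

Lemma left_weakly_Gorenstein_torsionless : left_weakly_Gorenstein A.
Proof.
move=> M /Ext_vanishes_all sM; split; first exact/Ext_vanishes_all.
by move=> T /(transpose_semi_Gproj sM) sT; exact/Ext_vanishes_all.
Qed.
End AllTorsionless.
End RegularDual.

(** * Passage to the opposite algebra *)

Section LinearDual.
Variables (K : fieldType).

Lemma dual_sep (V : vectType K) (x y : V) :
  (forall l : 'Hom(V, K^o), l x = l y) -> x = y.
Proof.
move=> e; rewrite (coord_vbasis (memvf x)) (coord_vbasis (memvf y)).
apply: eq_bigr => i _; congr (_ *: _).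
have [l el] : exists l : 'Hom(V, K^o), forall z, l z = coord (vbasis fullv) i z.
  by apply: lfun_of_linear => k u v; rewrite linearP.
by rewrite -!el e.
Qed.

(** Finite dimensional spaces are reflexive, in the form that every linear map
    between duals is a transpose. *)
Lemma transpose_ex (U V : vectType K) (F : 'Hom('Hom(V, K^o), 'Hom(U, K^o))) :
  exists h : 'Hom(U, V), forall l u, F l u = l (h u).
Proof.
have exl (i : 'I_(\dim {:V})) : exists l : 'Hom(V, K^o), forall z, l z = coord (vbasis fullv) i z.
  by apply: lfun_of_linear => k u v; rewrite linearP.
have [l el] := fin_all_exists exl.
pose h0 u := \sum_(i < \dim {:V}) F (l i) u *: (vbasis {:V})`_i.
have [h eh] : exists h : 'Hom(U, V), forall u, h u = h0 u.
  apply: lfun_of_linear => k u v; rewrite /h0 scaler_sumr -big_split /=.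
  by apply: eq_bigr => i _; rewrite linearP scalerDl scalerA.
exists h => m u; have -> : m = \sum_(i < \dim {:V}) m (vbasis {:V})`_i *: l i.
  apply/lfunP => z; rewrite {1}(coord_vbasis (memvf z)) linear_sum sum_lfunE.
  by apply: eq_bigr => i _; rewrite linearZ scale_lfunE /= el [LHS]mulrC.
rewrite linear_sum !sum_lfunE; apply: eq_bigr => i _.
rewrite linearZ !scale_lfunE eh; congr (_ *: _).
rewrite /h0 linear_sum (bigD1 i) //= big1 => [|j nj]; rewrite linearZ /= el.
  rewrite (coord_free i i (basis_free (vbasisP fullv))) eqxx addr0.
  by rewrite -[RHS]/(_ * _) mulr1.
rewrite (coord_free j i (basis_free (vbasisP fullv))).
have -> : (j == i) = false by exact: negbTE nj.
by rewrite scaler0.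
Qed.

End LinearDual.

Section OppositeDual.
Variables (K : fieldType) (A : falgType K).
Implicit Types M N X Y Z S I L C : rmod A.
Implicit Types W F V : rmod (opalg A).

Section Codual.
Variable W : rmod (opalg A).
Let act (f : 'Hom(W, K^o)) (a : A) : 'Hom(W, K^o) := (f \o linfun (@ractr K (opalg A) W a))%VF.
Let actE f a w : act f a w = f (ract w (a : opalg A)).
Proof. by rewrite comp_lfunE lfunE. Qed.
Lemma codual_linearl a : linear (act^~ a).
Proof. by move=> k f g; apply/lfunP => x; rewrite !lfun_simp. Qed.
Lemma codual_linearr f : linear (act f).
Proof.
by move=> k a b; apply/lfunP => x; rewrite add_lfunE scale_lfunE !actE !linearP.
Qed.
Lemma codualA f a b : act (act f a) b = act f (a * b).
Proof. by apply/lfunP => x; rewrite !actE ractA. Qed.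
Lemma codual_1 f : act f 1 = f.
Proof. by apply/lfunP => x; rewrite !actE ract1. Qed.

(** The inverse of [dual_rmod] up to isomorphism. *)
Definition codual_rmod : rmod A := RMod codual_linearl codual_linearr codualA codual_1.

Lemma codual_actE (f : codual_rmod) (a : A) w :
  (ract f a : 'Hom(W, K^o)) w = (f : 'Hom(W, K^o)) (ract w (a : opalg A)).
Proof. exact: actE. Qed.
End Codual.

Lemma dual_actE M (f : dual_rmod M) (a : opalg A) x :
  (ract f a : 'Hom(M, K^o)) x = (f : 'Hom(M, K^o)) (ract x (a : A)).
Proof. by rewrite comp_lfunE lfunE. Qed.

(** [Hom_A(X, D W) = Hom_op(W, D X)]: both sides are the balanced bilinear forms
    on [X] and [W]. *)
Lemma codual_adj X W (f : 'Hom(X, codual_rmod W)) : rlinear f ->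
  exists g : 'Hom(W, dual_rmod X), rlinear g /\
    forall w x, (g w : 'Hom(X, K^o)) x = (f x : 'Hom(W, K^o)) w.
Proof.
move=> lf.
have exg w : exists h : 'Hom(X, K^o), forall x, h x = (f x : 'Hom(W, K^o)) w.
  by apply: lfun_of_linear => k x y; rewrite linearP add_lfunE scale_lfunE.
pose g0 w := proj1_sig (constructive_indefinite_description _ (exg w)).
have g0E w x : g0 w x = (f x : 'Hom(W, K^o)) w.
  exact: proj2_sig (constructive_indefinite_description _ (exg w)) x.
clearbody g0.
have [g eg] : exists g : 'Hom(W, dual_rmod X), forall w, g w = g0 w.
  apply: lfun_of_linear => k v w; apply/lfunP => x.
  by rewrite add_lfunE scale_lfunE !g0E linearP.
exists g; split=> [w a|w x]; last by rewrite eg.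
by apply/lfunP => x; rewrite dual_actE !eg !g0E lf codual_actE.
Qed.

Lemma dual_adj X W (g : 'Hom(W, dual_rmod X)) : rlinear g ->
  exists f : 'Hom(X, codual_rmod W), rlinear f /\
    forall w x, (f x : 'Hom(W, K^o)) w = (g w : 'Hom(X, K^o)) x.
Proof.
move=> lg.
have exf x : exists h : 'Hom(W, K^o), forall w, h w = (g w : 'Hom(X, K^o)) x.
  by apply: lfun_of_linear => k v w; rewrite linearP add_lfunE scale_lfunE.
pose f0 x := proj1_sig (constructive_indefinite_description _ (exf x)).
have f0E x w : f0 x w = (g w : 'Hom(X, K^o)) x.
  exact: proj2_sig (constructive_indefinite_description _ (exf x)) w.
clearbody f0.
have [f ef] : exists f : 'Hom(X, codual_rmod W), forall x, f x = f0 x.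
  apply: lfun_of_linear => k v w; apply/lfunP => x.
  by rewrite add_lfunE scale_lfunE !f0E linearP.
exists f; split=> [x a|w x]; last by rewrite ef.
by apply/lfunP => w; rewrite codual_actE !ef !f0E lg dual_actE.
Qed.

Lemma codual_injective F : projective F -> injective_rmod (codual_rmod F).
Proof.
move=> pF X Y i f li ki lf; have [g [lg eg]] := codual_adj lf.
have [r [lr er]] : exists r : 'Hom(dual_rmod Y, dual_rmod X), rlinear r /\
    forall h x, (r h : 'Hom(X, K^o)) x = (h : 'Hom(Y, K^o)) (i x).
  have [r er] : exists r : 'Hom(dual_rmod Y, dual_rmod X),
      forall h, r h = ((h : 'Hom(Y, K^o)) \o i)%VF.
    by apply: lfun_of_linear => k h h'; rewrite comp_lfunDl comp_lfunZl.
  have rE h x : (r h : 'Hom(X, K^o)) x = (h : 'Hom(Y, K^o)) (i x).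
    by rewrite er comp_lfunE.
  exists r; split=> // h a; apply/lfunP => x.
  by rewrite dual_actE !rE dual_actE li.
have sr : surj r.
  apply: surjW => l; exists ((l : 'Hom(X, K^o)) \o i^-1)%VF; apply/lfunP => x.
  by rewrite er comp_lfunE lker0_lfunK.
have [u [lu eu]] := pF _ _ r g lr sr lg.
have [h [lh eh]] := dual_adj lu; exists h; split=> //.
apply/lfunP => x; apply/lfunP => w.
by rewrite [X in fun_of_lfun X]comp_lfunE eh -er -[r _]comp_lfunE eu eg.
Qed.

Lemma codual_ses W F V (i : 'Hom(V, F)) (p : 'Hom(F, W)) : ses i p ->
  exists (j : 'Hom(codual_rmod W, codual_rmod F)) (q : 'Hom(codual_rmod F, codual_rmod V)),
    ses j q /\ forall l v, (q l : 'Hom(V, K^o)) v = (l : 'Hom(F, K^o)) (i v).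
Proof.
move=> s; have [li lp ki e sp] := s.
have tr (U U' : rmod (opalg A)) (f : 'Hom(U, U')) : rlinear f ->
    exists r : 'Hom(codual_rmod U', codual_rmod U), rlinear r /\
      forall l v, (r l : 'Hom(U, K^o)) v = (l : 'Hom(U', K^o)) (f v).
  move=> lf.
  have [r er] : exists r : 'Hom(codual_rmod U', codual_rmod U),
      forall h, r h = ((h : 'Hom(U', K^o)) \o f)%VF.
    by apply: lfun_of_linear => k h h'; rewrite comp_lfunDl comp_lfunZl.
  have rE h x : (r h : 'Hom(U, K^o)) x = (h : 'Hom(U', K^o)) (f x).
    by rewrite er comp_lfunE.
  exists r; split=> // h a; apply/lfunP => x.
  by rewrite codual_actE !rE codual_actE lf.
have [j [lj ej]] := tr _ _ p lp; have [q [lq eq]] := tr _ _ i li.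
exists j, q; split=> //; split=> //.
- apply/lker0P => l l' el; apply/lfunP => w; have [y <-] := surjP sp w.
  by rewrite -!ej el.
- apply/vspaceP => l; apply/memv_imgP/idP => [[l0 _ ->]|].
    by rewrite memv_ker; apply/eqP/lfunP => v; rewrite eq ej (ses_comp0 _ s) linear0 lfunE.
  rewrite memv_ker => /eqP ql; exists ((l : 'Hom(F, K^o)) \o p^-1)%VF; first exact: memvf.
  apply/lfunP => y; rewrite ej comp_lfunE.
  have [|v ev] := ses_ker (y := (p^-1)%VF (p y) - y) s.
    by rewrite linearB /= limg_lfunVK ?subrr // sp memvf.
  have -> : (p^-1)%VF (p y) = y + i v by rewrite -ev addrC subrK.
  by have /lfunP/(_ v) := ql; rewrite eq lfunE linearD /= => ->; rewrite addr0.
- apply: surjW => l; exists ((l : 'Hom(V, K^o)) \o i^-1)%VF; apply/lfunP => v.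
  by rewrite eq comp_lfunE lker0_lfunK.
Qed.

Lemma ext1_lift M N I S (j : 'Hom(N, I)) (q : 'Hom(I, S)) (f : 'Hom(M, S)) :
  ext1 M N -> ses j q -> rlinear f -> exists h : 'Hom(M, I), rlinear h /\ (q \o h)%VF = f.
Proof.
move=> eMN t lf; have [lj lq kj _ sq] := t.
have sc := ses_kernel (@cover_rlinear _ _ M) (@cover_surj _ _ M).
set c := sub_incl _ in sc; have [lc lcov kc ec sp] := sc.
have pc : projective (cover_rmod M) by exact: free_projective.
have [u [lu eu]] := pc _ _ q (f \o Defs.cover M)%VF lq sq (rlinear_comp lcov lf).
have [v [lv ev]] : exists v : 'Hom(syzygy M, N), rlinear v /\ (j \o v)%VF = (u \o c)%VF.
  apply: (ses_lift t); first exact: rlinear_comp.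
  move=> x; rewrite comp_lfunE -[q _]comp_lfunE eu comp_lfunE.
  by rewrite (ses_comp0 _ sc) linear0.
have [w [lw ew]] := eMN _ _ c (Defs.cover M) pc sc v lv.
have ljw : rlinear (j \o w)%VF by exact: rlinear_comp.
have [h [lh eh]] : exists h : 'Hom(M, I),
    rlinear h /\ (h \o Defs.cover M)%VF = (u - (j \o w))%VF.
  apply: (ses_factor sc); first exact: rlinearB.
  move=> x; rewrite add_lfunE opp_lfunE -comp_lfunE -ev !comp_lfunE.
  by rewrite -[w (c x)]comp_lfunE ew subrr.
exists h; split=> //; apply/lfunP => y; have [x <-] := surjP sp y.
rewrite comp_lfunE -[h _]comp_lfunE eh add_lfunE opp_lfunE comp_lfunE.
by rewrite linearB /= (ses_comp0 _ t) subr0 -[q _]comp_lfunE eu comp_lfunE.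
Qed.

(** [Hom_A(D A, D W) = Hom_op(W, A)]: a presentation of [W] dualizes to an
    injective copresentation of [D W], along which maps out of [D A] lift. *)
Lemma ext1_codual W : ext1 (dual_reg A) (codual_rmod W) -> ext1 W (reg_rmod (opalg A)).
Proof.
move=> eW V F i p pF s g lg; have [j [q [t eq]]] := codual_ses s.
have [f ef] : exists f : 'Hom(dual_reg A, codual_rmod V),
    forall l, f l = ((l : 'Hom(A, K^o)) \o g)%VF.
  by apply: lfun_of_linear => k h h'; rewrite comp_lfunDl comp_lfunZl.
have fE l v : (f l : 'Hom(V, K^o)) v = (l : 'Hom(A, K^o)) (g v) by rewrite ef comp_lfunE.
have dregE (l : dual_reg A) (a x : A) :
  (ract l a : 'Hom(A, K^o)) x = (l : 'Hom(A, K^o)) (a * x) by rewrite comp_lfunE lfunE.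
have lf : rlinear f.
  by move=> l a; apply/lfunP => v; rewrite codual_actE !fE dregE lg.
have [h [lh eh]] := ext1_lift eW t lf.
have [u eu] := @transpose_ex K F A h.
exists (u : 'Hom(F, reg_rmod (opalg A))); split=> [y a|].
  apply: (@dual_sep K A) => l.
  have E : (h (l : dual_reg A) : 'Hom(F, K^o)) (ract y a) = (h (ract (l : dual_reg A) (a : A)) : 'Hom(F, K^o)) y.
    by rewrite lh codual_actE.
  by rewrite -eu E eu dregE.
apply/lfunP => v; rewrite comp_lfunE; apply: (@dual_sep K A) => l.
by rewrite -eu -eq -[q _]comp_lfunE eh fE.
Qed.

(** Syzygies of [W] dualize to cosyzygies of [D W]. *)
Lemma ext_zero_codual n W :
  ext_zero n (dual_reg A) (codual_rmod W) -> ext_zero n W (reg_rmod (opalg A)).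
Proof.
elim: n W => [|n IH] W H; first exact: ext1_codual.
have pF : projective (cover_rmod W) by exact: free_projective.
have s := ses_kernel (@cover_rlinear _ _ W) (@cover_surj _ _ W).
have [j [q [t _]]] := codual_ses s.
apply/(ext_zero_syzygy _ _ pF s); apply: IH; exact: H (codual_injective pF) t.
Qed.

Lemma ext1_iso M N N' (f : 'Hom(N, N')) (g : 'Hom(N', N)) :
  rlinear f -> rlinear g -> (f \o g)%VF = \1%VF -> ext1 M N -> ext1 M N'.
Proof.
move=> lf lg fg e L P i p pP s u lu.
have [h [lh eh]] := e _ _ i p pP s _ (rlinear_comp lu lg).
exists (f \o h)%VF; split; first exact: rlinear_comp.
by rewrite -comp_lfunA eh comp_lfunA fg comp_lfun1l.
Qed.

Lemma ext_zero_iso n M N N' (f : 'Hom(N, N')) :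
  rlinear f -> lker f == 0%VS -> surj f -> ext_zero n M N -> ext_zero n M N'.
Proof.
move=> lf kf sf; case: n => [|n] /= H.
  have fg : (f \o f^-1)%VF = \1%VF.
    by apply/lfunP => x; rewrite comp_lfunE limg_lfunVK ?id_lfunE // sf memvf.
  apply: (ext1_iso lf _ fg H) => y a; have [x <-] := surjP sf y.
  by rewrite -lf !lker0_lfunK.
move=> I S j q inI t; apply: (H _ _ (j \o f)%VF q inI).
have [lj lq kj e sq] := t; split=> //; first exact: rlinear_comp.
  by apply/lker0P => x y; rewrite !comp_lfunE => /(lker0P kj) /(lker0P kf).
by rewrite -e limg_comp sf.
Qed.

Lemma ext_zero_dual n M :
  ext_zero n (dual_reg A) M -> ext_zero n (dual_rmod M) (reg_rmod (opalg A)).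
Proof.
move=> H; apply: ext_zero_codual.
have [f [lf ef]] := dual_adj (@rlinear_id _ _ (dual_rmod M)).
apply: (ext_zero_iso (f := f)) H => //.
  apply/lker0P => x y e; apply: dual_sep => l.
  by have := ef l x; rewrite e ef id_lfunE.
apply: surjW => F.
have [v ev] : exists v : M, forall l : 'Hom(M, K^o), (F : 'Hom('Hom(M, K^o), K^o)) l = l v.
  have [h eh] : exists h : 'Hom('Hom(M, K^o), 'Hom(K^o, K^o)),
      forall l, h l = (F : 'Hom('Hom(M, K^o), K^o)) l *: \1%VF.
    by apply: lfun_of_linear => k l l'; rewrite linearP scalerDl scalerA.
  have [u eu] := transpose_ex h; exists (u 1) => l.
  by rewrite -eu eh scale_lfunE id_lfunE -[RHS]/(_ * _) mulr1.
by exists v; apply/lfunP => l; rewrite ef ev id_lfunE.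
Qed.

Lemma right_weakly_Gorenstein_op :
  left_weakly_Gorenstein (opalg A) -> right_weakly_Gorenstein A.
Proof.
move=> lw M /Ext_vanishes_all H; apply: lw; apply/Ext_vanishes_all => n.
exact: ext_zero_dual.
Qed.
End OppositeDual.

(** * Direct sum decompositions *)

Section Decomposition.
Variables (K : fieldType) (B : falgType K).
Implicit Types Y Z : rmod B.

Lemma biproduct_submodules (J : Type) (X : J -> rmod B) Y (U V : {vspace Y})
    (sU : submodule U) (sV : submodule V) :
  (U + V)%VS = fullv -> (U :&: V)%VS = 0%VS ->
  is_biproduct X (sub_rmod sU) -> is_biproduct X (sub_rmod sV) -> is_biproduct X Y.
Proof.
move=> UV UV0.
pose pU := daddv_pi U V; pose pV := daddv_pi V U.
have VU0 : (V :&: U)%VS = 0%VS by rewrite capvC.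
have sum x : pU x + pV x = x by rewrite daddv_pi_add // UV memvf.
have pUU x : pU x \in U by exact: memv_pi.
have pVV x : pV x \in V by exact: memv_pi.
clearbody pU pV.
have uniq u v : u \in U -> v \in V -> pU (u + v) = u /\ pV (u + v) = v.
  move=> uU vV; have e : pU (u + v) - u = v - pV (u + v).
    by apply/eqP; rewrite subr_eq addrAC eq_sym subr_eq sum addrC.
  have : pU (u + v) - u \in (U :&: V)%VS.
    by rewrite memv_cap rpredB //= e rpredB.
  rewrite UV0 memv0 => /eqP d0; split; apply/eqP.
    by rewrite -subr_eq0 d0.
  by rewrite eq_sym -subr_eq0 -e d0.
have lin x a : pU (ract x a) = ract (pU x) a /\ pV (ract x a) = ract (pV x) a.
  by rewrite -{1 3}[x]sum ractDl; apply: uniq; [apply: sU | apply: sV].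
have [p [lp ep]] : exists p : 'Hom(Y, sub_rmod sU), rlinear p /\ (sub_incl sU \o p)%VF = pU.
  apply: sub_corestrict; first by move=> x a; case: (lin x a).
  by apply/subvP => _ /memv_imgP [x _ ->].
have [q [lq eq]] : exists q : 'Hom(Y, sub_rmod sV), rlinear q /\ (sub_incl sV \o q)%VF = pV.
  apply: sub_corestrict; first by move=> x a; case: (lin x a).
  by apply/subvP => _ /memv_imgP [x _ ->].
have pE x : sub_incl sU (p x) = pU x by rewrite -comp_lfunE ep.
have qE x : sub_incl sV (q x) = pV x by rewrite -comp_lfunE eq.
have iU (x : sub_rmod sU) : sub_incl sU x \in U by rewrite sub_inclE subvsP.
have iV (x : sub_rmod sV) : sub_incl sV x \in V by rewrite sub_inclE subvsP.
have uU (x : sub_rmod sU) : pU (sub_incl sU x) = sub_incl sU x /\ pV (sub_incl sU x) = 0.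
  by rewrite -{1 3}[sub_incl sU x]addr0; apply: uniq; rewrite ?mem0v.
have uV (x : sub_rmod sV) : pU (sub_incl sV x) = 0 /\ pV (sub_incl sV x) = sub_incl sV x.
  by rewrite -{1 2}[sub_incl sV x]add0r; apply: uniq; rewrite ?mem0v.
apply: (biproduct_direct (i := sub_incl sU) (p := p) (j := sub_incl sV) (q := q)).
- by split=> //; exact: sub_incl_rlinear.
- split; apply/lfunP => x; rewrite comp_lfunE ?id_lfunE ?zero_lfunE.
  + by apply: (lker0P (sub_incl_ker sU)); rewrite pE (proj1 (uU x)).
  + by apply: (lker0P (sub_incl_ker sV)); rewrite qE (proj2 (uV x)).
  + by apply: (lker0P (sub_incl_ker sU)); rewrite pE (proj1 (uV x)) linear0.
  + by apply: (lker0P (sub_incl_ker sV)); rewrite qE (proj2 (uU x)) linear0.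
by apply/lfunP => x; rewrite add_lfunE !comp_lfunE pE qE sum id_lfunE.
Qed.

Lemma dim_sub_rmod Y (U : {vspace Y}) (sU : submodule U) :
  \dim {:sub_rmod sU} = \dim U.
Proof. by rewrite dimvf /dim /=. Qed.

Lemma representation_finite_biproduct (t : nat) (X : 'I_t -> rmod B) Y :
  (forall Z, indecomposable Z -> exists i, rmod_iso Z (X i)) -> is_biproduct X Y.
Proof.
move=> H; have [n] := ubnP (\dim {:Y}); elim: n Y => // n IH Y dY.
have [Y0|nY0] := eqVneq (fullv : {vspace Y}) 0%VS; first exact: biproduct0.
have [iY|niY] := classic (indecomposable Y).
  have [i [f [lf bf]]] := H Y iY.
  have kf : lker f == 0%VS by apply/lker0P; exact: bij_inj.
  have sf : surj f by apply: surjW => y; case: bf => g _ gK; exists (g y).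
  have fK x : f (f^-1%VF x) = x by rewrite limg_lfunVK // sf memvf.
  apply: (@biproduct_iso _ _ _ _ i Y (f^-1)%VF).
  - by move=> x a; have [y <-] := surjP sf x; rewrite -lf !lker0_lfunK.
  - by apply/lker0P => x y e; rewrite -[x]fK e fK.
  by apply: surjW => y; exists (f y); rewrite lker0_lfunK.
have : ~ forall U V : {vspace Y}, submodule U -> submodule V ->
    (U + V)%VS = fullv -> (U :&: V)%VS = 0%VS -> U = 0%VS \/ V = 0%VS by move=> h; apply: niY.
move=> nH; have [U nU] := not_all_ex_not _ _ nH; have [V nV] := not_all_ex_not _ _ nU.
have [sU h1] := imply_to_and _ _ nV; have [sV h2] := imply_to_and _ _ h1.
have [UV h3] := imply_to_and _ _ h2; have [UV0 n0] := imply_to_and _ _ h3.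
have {h1 h2 h3 nH nU nV} nU : U != 0%VS by apply/eqP => U0; apply: n0; left.
have nV : V != 0%VS by apply/eqP => V0; apply: n0; right.
have dUV : (\dim U + \dim V = \dim {:Y})%N by rewrite -UV dimv_disjoint_sum.
apply: (biproduct_submodules (sU := sU) (sV := sV)) => //; apply: IH; rewrite dim_sub_rmod.
  by rewrite -ltnS (leq_trans _ dY) // ltnS -dUV -addn1 leq_add2l lt0n dimv_eq0.
by rewrite -ltnS (leq_trans _ dY) // ltnS -dUV -add1n leq_add2r lt0n dimv_eq0.
Qed.
End Decomposition.

Section PowerModule.
Variables (K : fieldType) (B : falgType K) (M : rmod B) (n : nat).
Let car := {ffun 'I_n -> M}.
Let act (x : car) (a : B) : car := [ffun i => ract (x i) a].
Lemma pow_linearl a : linear (act^~ a).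
Proof. by move=> k x y; apply/ffunP => i; rewrite !ffunE ractDl ractZl. Qed.
Lemma pow_linearr x : linear (act x).
Proof. by move=> k a b; apply/ffunP => i; rewrite !ffunE linearP. Qed.
Lemma pow_actA x a b : act (act x a) b = act x (a * b).
Proof. by apply/ffunP => i; rewrite !ffunE ractA. Qed.
Lemma pow_act1 x : act x 1 = x.
Proof. by apply/ffunP => i; rewrite !ffunE ract1. Qed.

Definition pow_rmod : rmod B := RMod pow_linearl pow_linearr pow_actA pow_act1.

Lemma pow_tuple_ex (X : rmod B) (h : 'I_n -> 'Hom(X, M)) : (forall i, rlinear (h i)) ->
  exists f : 'Hom(X, pow_rmod), rlinear f /\ forall x i, (f x : car) i = h i x.
Proof.
move=> lh; pose f0 (x : X) : car := [ffun i => h i x].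
have [f ef] : exists f : 'Hom(X, pow_rmod), forall x, f x = f0 x.
  by apply: lfun_of_linear => k x y; apply/ffunP => i; rewrite !ffunE linearP.
exists f; split=> [x a|x i]; last by rewrite ef ffunE.
by apply/ffunP => i; rewrite !ef !ffunE lh.
Qed.

Lemma pow_cotuple_ex (X : rmod B) (h : 'I_n -> 'Hom(M, X)) : (forall i, rlinear (h i)) ->
  exists f : 'Hom(pow_rmod, X), rlinear f /\ forall x, f x = \sum_i h i ((x : car) i).
Proof.
move=> lh; have [f ef] : exists f : 'Hom(pow_rmod, X), forall x, f x = \sum_i h i ((x : car) i).
  apply: lfun_of_linear => k x y; rewrite scaler_sumr -big_split.
  by apply: eq_bigr => i _; rewrite !ffunE linearP.
exists f; split=> // x a; rewrite !ef ract_suml; apply: eq_bigr => i _.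
by rewrite ffunE lh.
Qed.

Lemma pow_coord_ex (i : 'I_n) : exists f : 'Hom(pow_rmod, M),
  rlinear f /\ forall x, f x = (x : car) i.
Proof.
have [f ef] : exists f : 'Hom(pow_rmod, M), forall x, f x = (x : car) i.
  by apply: lfun_of_linear => k x y; rewrite !ffunE.
by exists f; split=> // x a; rewrite !ef ffunE.
Qed.

Lemma pow_incl_ex (i : 'I_n) : exists f : 'Hom(M, pow_rmod),
  rlinear f /\ forall m j, (f m : car) j = if i == j then m else 0.
Proof.
have lh j : rlinear (if i == j then \1 else 0 : 'Hom(M, M))%VF.
  by case: eqP => _; [exact: rlinear_id | exact: rlinear0].
have [f [lf ef]] := pow_tuple_ex lh; exists f; split=> // m j.
by rewrite ef; case: eqP => _; rewrite ?id_lfunE ?lfunE.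
Qed.

Lemma pow_incl_sum (X : rmod B) (f : 'Hom(pow_rmod, X)) (u : forall i, 'Hom(M, pow_rmod)) x :
  (forall i m j, (u i m : car) j = if i == j then m else 0) ->
  f x = \sum_i f (u i ((x : car) i)).
Proof.
move=> eu; rewrite -linear_sum; congr (f _); apply/ffunP => j.
rewrite sum_ffunE (bigD1 j) //= big1 ?addr0 => [|i nij]; rewrite eu ?eqxx //.
by rewrite (negPf nij).
Qed.
End PowerModule.

(** * Second syzygies over endomorphism algebras *)

Section HomModules.
Variables (K : fieldType) (A B : falgType K) (M : rmod B) (phi : {linear A -> 'End(M)}).
Hypotheses (phi_rlinear : forall a, rlinear (phi a : 'Hom(M, M)))
  (phi_inj : injective phi) (phi_onto : forall f : 'Hom(M, M), rlinear f -> exists a, f = phi a)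
  (phi1 : phi 1 = \1%VF) (phiM : forall a b, phi (a * b) = (phi a \o phi b)%VF).
Implicit Types X Y Z : rmod B.

Section Covariant.
Variable X : rmod B.
Let car := subvs_of (rhom M X).
Let act (f : car) (a : A) : car := vsproj _ ((vsval f : 'Hom(M, X)) \o phi a)%VF.
Let actE f a : (vsval (act f a) : 'Hom(M, X)) = ((vsval f : 'Hom(M, X)) \o phi a)%VF.
Proof.
rewrite vsprojK //; apply/rhomP; apply: rlinear_comp; first exact: phi_rlinear.
by apply/rhomP; exact: subvsP.
Qed.
Let carP (k : K) (f g : car) :
  (vsval (k *: f + g) : 'Hom(M, X)) = k *: (vsval f : 'Hom(M, X)) + vsval g.
Proof. by rewrite linearP. Qed.
Lemma homl_linearl a : linear (act^~ a).
Proof. by move=> k f g; apply: subvs_inj; rewrite carP !actE carP comp_lfunDl -comp_lfunZl. Qed.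
Lemma homl_linearr f : linear (act f).
Proof. by move=> k a b; apply: subvs_inj; rewrite carP !actE linearP comp_lfunDr -comp_lfunZr. Qed.
Lemma homl_actA f a b : act (act f a) b = act f (a * b).
Proof. by apply: subvs_inj; rewrite !actE phiM comp_lfunA. Qed.
Lemma homl_act1 f : act f 1 = f.
Proof. by apply: subvs_inj; rewrite actE phi1 comp_lfun1r. Qed.
(** The functor [Hom_B(M, -)] to right modules over [A = End_B(M)]. *)
Definition homl_rmod : rmod A := RMod homl_linearl homl_linearr homl_actA homl_act1.
Lemma homl_actE (f : homl_rmod) a : (vsval (ract f a) : 'Hom(M, X)) = ((vsval f : 'Hom(M, X)) \o phi a)%VF.
Proof. exact: actE. Qed.
End Covariant.

Section Contravariant.
Variable X : rmod B.
Let car := subvs_of (rhom X M).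
Let act (f : car) (a : opalg A) : car := vsproj _ (phi (a : A) \o (vsval f : 'Hom(X, M)))%VF.
Let actE f a : (vsval (act f a) : 'Hom(X, M)) = (phi (a : A) \o (vsval f : 'Hom(X, M)))%VF.
Proof.
rewrite vsprojK //; apply/rhomP; apply: rlinear_comp; last exact: phi_rlinear.
by apply/rhomP; exact: subvsP.
Qed.
Let carP (k : K) (f g : car) :
  (vsval (k *: f + g) : 'Hom(X, M)) = k *: (vsval f : 'Hom(X, M)) + vsval g.
Proof. by rewrite linearP. Qed.
Lemma homr_linearl a : linear (act^~ a).
Proof. by move=> k f g; apply: subvs_inj; rewrite carP !actE carP comp_lfunDr -comp_lfunZr. Qed.
Lemma homr_linearr f : linear (act f).
Proof.
move=> k a b; apply: subvs_inj; rewrite carP !actE -[k *: a + b]/(k *: (a : A) + (b : A)).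
by rewrite linearP comp_lfunDl -comp_lfunZl.
Qed.
Lemma homr_actA f a b : act (act f a) b = act f (a * b).
Proof. by apply: subvs_inj; rewrite !actE opalgM phiM comp_lfunA. Qed.
Lemma homr_act1 f : act f 1 = f.
Proof. by apply: subvs_inj; rewrite actE phi1 comp_lfun1l. Qed.
(** The functor [Hom_B(-, M)] to left modules over [A = End_B(M)]. *)
Definition homr_rmod : rmod (opalg A) := RMod homr_linearl homr_linearr homr_actA homr_act1.
Lemma homr_actE (f : homr_rmod) a : (vsval (ract f a) : 'Hom(X, M)) = (phi (a : A) \o (vsval f : 'Hom(X, M)))%VF.
Proof. exact: actE. Qed.
End Contravariant.

Lemma homl_map_ex X Y (g : 'Hom(X, Y)) : rlinear g ->
  exists G : 'Hom(homl_rmod X, homl_rmod Y), rlinear G /\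
    forall f, (vsval (G f) : 'Hom(M, Y)) = (g \o (vsval f : 'Hom(M, X)))%VF.
Proof.
move=> lg.
pose G0 (f : homl_rmod X) : homl_rmod Y := vsproj (rhom M Y) (g \o (vsval f : 'Hom(M, X)))%VF.
have G0E f : (vsval (G0 f) : 'Hom(M, Y)) = (g \o (vsval f : 'Hom(M, X)))%VF.
  by rewrite vsprojK //; apply/rhomP; apply: rlinear_comp => //; apply/rhomP; exact: subvsP.
clearbody G0.
have [G eG] : exists G : 'Hom(homl_rmod X, homl_rmod Y), forall f, G f = G0 f.
  apply: lfun_of_linear => k f f'; apply: subvs_inj; rewrite G0E !linearP /= !G0E.
  by rewrite comp_lfunDr comp_lfunZr.
exists G; split=> [f a|f]; last by rewrite eG G0E.
by apply: subvs_inj; rewrite homl_actE !eG !G0E homl_actE comp_lfunA.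
Qed.

Lemma homr_map_ex X Y (g : 'Hom(X, Y)) : rlinear g ->
  exists G : 'Hom(homr_rmod Y, homr_rmod X), rlinear G /\
    forall f, (vsval (G f) : 'Hom(X, M)) = ((vsval f : 'Hom(Y, M)) \o g)%VF.
Proof.
move=> lg.
pose G0 (f : homr_rmod Y) : homr_rmod X := vsproj (rhom X M) ((vsval f : 'Hom(Y, M)) \o g)%VF.
have G0E f : (vsval (G0 f) : 'Hom(X, M)) = ((vsval f : 'Hom(Y, M)) \o g)%VF.
  by rewrite vsprojK //; apply/rhomP; apply: rlinear_comp => //; apply/rhomP; exact: subvsP.
clearbody G0.
have [G eG] : exists G : 'Hom(homr_rmod Y, homr_rmod X), forall f, G f = G0 f.
  apply: lfun_of_linear => k f f'; apply: subvs_inj; rewrite G0E !linearP /= !G0E.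
  by rewrite comp_lfunDl comp_lfunZl.
exists G; split=> [f a|f]; last by rewrite eG G0E.
by apply: subvs_inj; rewrite homr_actE !eG !G0E homr_actE comp_lfunA.
Qed.

Lemma homl_biproduct (J : Type) (X : J -> rmod B) Z :
  is_biproduct X Z -> is_biproduct (fun j => homl_rmod (X j)) (homl_rmod Z).
Proof.
move=> [T [c [io [pr [lio lpr o id1 e1]]]]].
have [I eI] := fin_all_exists (fun j => homl_map_ex (lio j)).
have [P eP] := fin_all_exists (fun j => homl_map_ex (lpr j)).
exists T, c, I, P; split=> [j|j|i j nij|j|]; try by case: (eI j); case: (eP j).
- apply/lfunP => f; apply: subvs_inj; rewrite comp_lfunE (proj2 (eP i)) (proj2 (eI j)).
  by rewrite comp_lfunA o // comp_lfun0l zero_lfunE linear0.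
- apply/lfunP => f; apply: subvs_inj; rewrite comp_lfunE (proj2 (eP j)) (proj2 (eI j)).
  by rewrite comp_lfunA id1 comp_lfun1l id_lfunE.
apply/lfunP => f; apply: subvs_inj; rewrite sum_lfunE linear_sum id_lfunE.
rewrite -[RHS]comp_lfun1l -e1; apply/lfunP => m; rewrite comp_lfunE !sum_lfunE.
by apply: eq_bigr => j _; rewrite comp_lfunE /= (proj2 (eI j)) (proj2 (eP j)) !comp_lfunE.
Qed.

Lemma homr_biproduct (J : Type) (X : J -> rmod B) Z :
  is_biproduct X Z -> is_biproduct (fun j => homr_rmod (X j)) (homr_rmod Z).
Proof.
move=> [T [c [io [pr [lio lpr o id1 e1]]]]].
have [I eI] := fin_all_exists (fun j => homr_map_ex (lpr j)).
have [P eP] := fin_all_exists (fun j => homr_map_ex (lio j)).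
exists T, c, I, P; split=> [j|j|i j nij|j|]; try by case: (eI j); case: (eP j).
- apply/lfunP => f; apply: subvs_inj; rewrite comp_lfunE (proj2 (eP i)) (proj2 (eI j)).
  by rewrite -comp_lfunA o 1?eq_sym // comp_lfun0r zero_lfunE linear0.
- apply/lfunP => f; apply: subvs_inj; rewrite comp_lfunE (proj2 (eP j)) (proj2 (eI j)).
  by rewrite -comp_lfunA id1 comp_lfun1r id_lfunE.
apply/lfunP => f; apply: subvs_inj; rewrite sum_lfunE linear_sum id_lfunE.
rewrite -[RHS]comp_lfun1r -e1; apply/lfunP => m; rewrite comp_lfunE !sum_lfunE linear_sum.
by apply: eq_bigr => j _; rewrite comp_lfunE /= (proj2 (eI j)) (proj2 (eP j)) !comp_lfunE.
Qed.

Lemma phi_inv_ex : exists P : 'Hom('Hom(M, M), A), forall f, rlinear f -> phi (P f) = f.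
Proof.
exists ((linfun phi)^-1)%VF => f /phi_onto [a ->].
by rewrite -(lfunE phi) limg_lfunVK ?lfunE // -(lfunE phi) memv_img ?memvf.
Qed.

(** The matrix of [d] over [A = End_B(M)] is a [B]-linear map [Phi] from [M^n] to
    [M^m], and the elements of [A^n] killed by [d] are the maps from [M] to [M^n]
    killed by [Phi], so that the kernel of [d] is [Hom_B(M, Ker Phi)]. *)
Lemma homl_kernel n m (d : 'Hom(free_rmod A n, free_rmod A m)) : rlinear d ->
  exists (Y : rmod B) (th : 'Hom(homl_rmod Y, free_rmod A n)),
    [/\ rlinear th, lker th == 0%VS & limg th = lker d].
Proof.
move=> ld; pose a j i : A := (d (free_gen A j) : {ffun 'I_m -> A}) i.
have dE x i : (d x : {ffun 'I_m -> A}) i = \sum_j a j i * (x : {ffun 'I_n -> A}) j.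
  rewrite {1}(free_genE x) linear_sum sum_ffunE; apply: eq_bigr => j _.
  by rewrite -[LHS]/((d (ract (free_gen A j) ((x : {ffun 'I_n -> A}) j)) : {ffun 'I_m -> A}) i) ld ffunE.
have [pr epr] := fin_all_exists (@pow_coord_ex K B M n).
have [|Phi [lPhi ePhi]] := @pow_tuple_ex K B M m (pow_rmod M n) (fun i => \sum_j (phi (a j i) \o pr j)%VF).
  by move=> i; apply: rlinear_sum => j; apply: rlinear_comp; [case: (epr j) | exact: phi_rlinear].
have PhiE x i : (Phi x : {ffun _ -> M}) i = \sum_j phi (a j i) ((x : {ffun _ -> M}) j).
  by rewrite ePhi sum_lfunE; apply: eq_bigr => j _; rewrite comp_lfunE (proj2 (epr j)).
have sY := lker_submodule lPhi.
pose Y := sub_rmod sY; have lY := @sub_incl_rlinear _ _ _ _ sY.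
have [Pi ePi] := phi_inv_ex.
pose th0 (f : homl_rmod Y) : {ffun 'I_n -> A} :=
  [ffun j => Pi (pr j \o (sub_incl sY \o (vsval f : 'Hom(M, Y))))%VF].
have th0E f j y : phi (th0 f j) y = (sub_incl sY ((vsval f : 'Hom(M, Y)) y) : {ffun _ -> M}) j.
  rewrite ffunE ePi ?comp_lfunE ?(proj2 (epr j)) //.
  apply: rlinear_comp; last by case: (epr j).
  by apply: rlinear_comp => //; apply/rhomP; exact: subvsP.
clearbody th0.
have [th eth] : exists th : 'Hom(homl_rmod Y, free_rmod A n), forall f, th f = th0 f.
  apply: lfun_of_linear => k f f'; apply/ffunP => j; apply: phi_inj; apply/lfunP => y.
  rewrite !ffunE linearP add_lfunE scale_lfunE !th0E.
  have -> : (vsval (k *: f + f') : 'Hom(M, Y)) y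
     = k *: (vsval f : 'Hom(M, Y)) y + (vsval f' : 'Hom(M, Y)) y.
    by rewrite linearP /= add_lfunE scale_lfunE.
  by rewrite linearP !ffunE.
exists Y, th; split.
- move=> f b; apply/ffunP => j; apply: phi_inj; apply/lfunP => y.
  by rewrite !eth ffunE phiM comp_lfunE !th0E homl_actE comp_lfunE.
- apply/lker0P => f f'; rewrite !eth => e; apply: subvs_inj; apply/lfunP => y.
  apply: (lker0P (sub_incl_ker sY)); apply/ffunP => j.
  by rewrite -!th0E e.
apply/vspaceP => x; rewrite memv_ker; apply/memv_imgP/eqP => [[f _ ->]|dx0].
  apply/ffunP => i; apply: phi_inj; apply/lfunP => y.
  have -> : ((0 : free_rmod A m) : {ffun 'I_m -> A}) i = 0 by rewrite ffunE.
  rewrite dE linear0 zero_lfunE linear_sum sum_lfunE.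
  have : sub_incl sY ((vsval f : 'Hom(M, Y)) y) \in lker Phi by rewrite sub_inclE subvsP.
  rewrite memv_ker => /eqP/ffunP/(_ i); rewrite PhiE [RHS]ffunE => e0; rewrite -[RHS]e0.
  by apply: eq_bigr => j _; rewrite phiM comp_lfunE eth th0E.
have [f0 [lf0 ef0]] := pow_tuple_ex (fun j => phi_rlinear ((x : {ffun 'I_n -> A}) j)).
have [||f [lf ef]] := @sub_corestrict _ _ _ _ _ sY f0; first exact: lf0.
  apply/subvP => _ /memv_imgP [y _ ->]; rewrite memv_ker; apply/eqP/ffunP => i.
  rewrite PhiE ffunE.
  have := congr1 (fun z : {ffun 'I_m -> A} => phi (z i) y) dx0.
  rewrite dE ffunE linear0 zero_lfunE linear_sum sum_lfunE => e0; rewrite -[RHS]e0.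
  by apply: eq_bigr => j _; rewrite phiM comp_lfunE ef0.
exists (vsproj (rhom M Y) f : homl_rmod Y); first exact: memvf.
apply/ffunP => j; apply: phi_inj; apply/lfunP => y.
rewrite eth th0E vsprojK; last by apply/rhomP.
by rewrite -comp_lfunE ef ef0.
Qed.

(** On the opposite side the matrix of [d] acts by precomposition: it is a map
    [Psi] from [M^m] to [M^n], and the kernel of [d] is [Hom_B(Coker Psi, M)]. *)
Lemma homr_kernel n m (d : 'Hom(free_rmod (opalg A) n, free_rmod (opalg A) m)) : rlinear d ->
  exists (Y : rmod B) (th : 'Hom(homr_rmod Y, free_rmod (opalg A) n)),
    [/\ rlinear th, lker th == 0%VS & limg th = lker d].
Proof.
move=> ld; pose a j i : A := (d (free_gen (opalg A) j) : {ffun 'I_m -> A}) i.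
have dE x i : (d x : {ffun 'I_m -> A}) i = \sum_j ((x : {ffun 'I_n -> A}) j * a j i).
  rewrite {1}(free_genE x) linear_sum sum_ffunE; apply: eq_bigr => j _.
  by rewrite -[LHS]/((d (ract (free_gen (opalg A) j) ((x : {ffun 'I_n -> opalg A}) j)) : {ffun 'I_m -> opalg A}) i) ld ffunE.
have [inc einc] := fin_all_exists (@pow_incl_ex K B M n).
have [inm einm] := fin_all_exists (@pow_incl_ex K B M m).
have [prm eprm] := fin_all_exists (@pow_coord_ex K B M m).
have [|Psi [lPsi ePsi]] := @pow_tuple_ex K B M n (pow_rmod M m) (fun j => \sum_i (phi (a j i) \o prm i)%VF).
  by move=> j; apply: rlinear_sum => i; apply: rlinear_comp; [case: (eprm i) | exact: phi_rlinear].
have PsiE x j : (Psi x : {ffun _ -> M}) j = \sum_i phi (a j i) ((x : {ffun _ -> M}) i).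
  by rewrite ePsi sum_lfunE; apply: eq_bigr => i _; rewrite comp_lfunE (proj2 (eprm i)).
have sI : submodule (limg Psi).
  move=> _ b /memv_imgP [x _ ->]; rewrite -lPsi; exact: memv_img (memvf _).
have [Y [p [lp sp kp]]] := exists_coker sI.
have [Pi ePi] := phi_inv_ex.
have E (g : 'Hom(Y, M)) x : g (p x) = \sum_j g (p (inc j ((x : {ffun _ -> M}) j))).
  have := @pow_incl_sum K B M n M (g \o p)%VF inc x (fun i => proj2 (einc i)).
  by rewrite -comp_lfunE => ->; apply: eq_bigr => j _; rewrite comp_lfunE.
pose th0 (f : homr_rmod Y) : {ffun 'I_n -> A} :=
  [ffun j => Pi ((vsval f : 'Hom(Y, M)) \o (p \o inc j))%VF].
have th0E f j y : phi (th0 f j) y = (vsval f : 'Hom(Y, M)) (p (inc j y)).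
  rewrite ffunE ePi ?comp_lfunE //.
  apply: rlinear_comp; last by apply/rhomP; exact: subvsP.
  by apply: rlinear_comp => //; case: (einc j).
clearbody th0.
have [th eth] : exists th : 'Hom(homr_rmod Y, free_rmod (opalg A) n), forall f, th f = th0 f.
  apply: lfun_of_linear => k f f'; apply/ffunP => j; apply: phi_inj; apply/lfunP => y.
  rewrite !ffunE -[k *: th0 f j + th0 f' j]/(k *: (th0 f j : A) + (th0 f' j : A)).
  rewrite linearP add_lfunE scale_lfunE !th0E.
  by rewrite linearP /= add_lfunE scale_lfunE.
exists Y, th; split.
- move=> f b; apply/ffunP => j; apply: phi_inj; apply/lfunP => y.
  by rewrite !eth ffunE opalgM phiM comp_lfunE !th0E homr_actE comp_lfunE.
- apply/lker0P => f f'; rewrite !eth => e; apply: subvs_inj; apply/lfunP => y.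
  have [x <-] := surjP sp y.
  by rewrite !E; apply: eq_bigr => j _; rewrite -!th0E e.
apply/vspaceP => x; rewrite memv_ker; apply/memv_imgP/eqP => [[f _ ->]|dx0].
  apply/ffunP => i; apply: phi_inj; apply/lfunP => y.
  have -> : ((0 : free_rmod (opalg A) m) : {ffun 'I_m -> A}) i = 0 by rewrite ffunE.
  rewrite dE linear0 zero_lfunE linear_sum sum_lfunE.
  have : Psi (inm i y) \in lker p by rewrite kp; exact: memv_img (memvf _).
  rewrite memv_ker => /eqP p0.
  have e0 : (vsval f : 'Hom(Y, M)) (p (Psi (inm i y))) = 0 by rewrite p0 linear0.
  rewrite E in e0; rewrite -[RHS]e0.
  apply: eq_bigr => j _; rewrite phiM comp_lfunE eth th0E PsiE (bigD1 i) //= big1 => [|l nl].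
    by rewrite addr0 (proj2 (einm i)) eqxx.
  by rewrite (proj2 (einm i)) eq_sym (negPf nl) linear0.
have [f0 [lf0 ef0]] := pow_cotuple_ex (fun j => phi_rlinear ((x : {ffun 'I_n -> A}) j)).
have [|f [lf ef]] := factor_surj lp sp lf0.
  rewrite kp; apply/subvP => _ /memv_imgP [y _ ->]; rewrite memv_ker; apply/eqP.
  rewrite ef0; under eq_bigr do rewrite PsiE linear_sum.
  rewrite exchange_big /= big1 // => i _.
  have := congr1 (fun z : {ffun 'I_m -> A} => phi (z i) ((y : {ffun _ -> M}) i)) dx0.
  rewrite dE ffunE linear0 zero_lfunE linear_sum sum_lfunE => e0; rewrite -[RHS]e0.
  by apply: eq_bigr => j _; rewrite phiM comp_lfunE.
exists (vsproj (rhom Y M) f : homr_rmod Y); first exact: memvf.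
apply/ffunP => j; apply: phi_inj; apply/lfunP => y.
rewrite eth th0E vsprojK; last by apply/rhomP.
rewrite -comp_lfunE ef ef0 (bigD1 j) //= big1 => [|l nl].
  by rewrite addr0 (proj2 (einc j)) eqxx.
by rewrite (proj2 (einc j)) eq_sym (negPf nl) linear0.
Qed.
End HomModules.

Section SecondSyzygy.
Variables (K : fieldType) (A : falgType K).

Lemma nth_syzygy2_kernel (N : rmod A) (H : rmod A -> Prop) :
  (forall n m (d : 'Hom(free_rmod A n, free_rmod A m)), rlinear d ->
     exists (Z : rmod A) (th : 'Hom(Z, free_rmod A n)),
       [/\ rlinear th, lker th == 0%VS, limg th = lker d & H Z]) ->
  exists Z, nth_syzygy 2 N Z /\ H Z.
Proof.
move=> ker; have sN := ses_kernel (@cover_rlinear _ _ N) (@cover_surj _ _ N).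
set L := sub_rmod _ in sN; set i := sub_incl _ in sN.
have [li _ ki _ _] := sN.
have lL := @cover_rlinear _ _ L.
have [Z [th [lth kth eth HZ]]] := ker _ _ _ (rlinear_comp lL li).
exists Z; split=> //; exists L, (cover_rmod N), i, (Defs.cover N); split=> //.
  exact: free_projective.
exists Z, (cover_rmod L), th, (Defs.cover L); split=> //; first exact: free_projective.
split=> //; last exact: cover_surj.
rewrite eth; apply/vspaceP => x; rewrite !memv_ker comp_lfunE.
by apply/eqP/eqP => [e|->]; [apply: (lker0P ki); rewrite e | ]; rewrite linear0.
Qed.
End SecondSyzygy.

(** * Last letters of words *)

Section LastLetters.
Variable T : eqType.
Implicit Types s q w l : seq T.

Definition lastn k s := drop (size s - k) s.

Lemma lastn_cat k s q : (0 < size q)%N -> lastn k.+1 (lastn k s ++ q) = lastn k.+1 (s ++ q).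
Proof.
move=> q0; have [le|lt] := leqP (size s) k.
  by rewrite {2}/lastn (eqnP le) drop0.
have sz : size (lastn k s) = k by rewrite size_drop subKn // ltnW.
rewrite -{2}(cat_take_drop (size s - k) s) -/(lastn k s) -catA.
rewrite [RHS]/lastn drop_cat !size_cat sz size_takel ?leq_subr //.
rewrite ifN; last by lia.
by congr drop; rewrite size_cat sz; lia.
Qed.

Lemma lastn_suffix k l l' w w' : (size w <= k)%N -> (size w <= size w')%N ->
  lastn k (l ++ w) = lastn k (l' ++ w') -> drop (size w' - size w) w' = w.
Proof.
have E a b s : (a <= b)%N -> lastn a (lastn b s) = lastn a s.
  move=> ab; rewrite /lastn drop_drop size_drop; congr drop.
  by have [sb|bs] := leqP (size s) b; lia.
move=> wk ww' /(congr1 (lastn (size w))); rewrite !E // /lastn !size_cat addnK.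
by rewrite drop_size_cat // -addnBA // drop_cat ltnNge leq_addr addKn.
Qed.
End LastLetters.

(** * Algebras with a basis of words *)

(** A multiplicative basis of paths: [mvert] and [marrow] are the vertices and
    arrows of a quiver, and [mwords] lists the nonempty words in the arrows whose
    product is nonzero. Unlike a presentation by a quiver with relations, this
    structure passes to the opposite algebra by reversing the words. *)
Record monomial_basis (K : fieldType) (A : falgType K) := MonomialBasis {
  mvert : finType;
  marrow : finType;
  mtgt : marrow -> mvert;
  msrc : marrow -> mvert;
  midem : mvert -> A;
  marr : marrow -> A;
  mwords : seq (seq marrow);
  midem_sum : \sum_v midem v = 1;
  midemM : forall u v, midem u * midem v = if u == v then midem v else 0;
  midem_marr : forall a, midem (msrc a) * marr a = marr a;
  marr_midem : forall a, marr a * midem (mtgt a) = marr a;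
  mwords_uniq : uniq mwords;
  mwords_nil : [::] \notin mwords;
  mem_mwords : forall w, w != [::] -> \prod_(a <- w) marr a != 0 -> w \in mwords;
  mwords_free : free [seq \prod_(a <- w) marr a | w <- mwords];
  midem_span : forall x, exists (c : mvert -> K) (y : A),
    y \in <<[seq \prod_(a <- w) marr a | w <- mwords]>>%VS /\
    x = \sum_v c v *: midem v + y }.

Section Words.
Variables (K : fieldType) (A : falgType K) (mb : monomial_basis A).
Local Notation V := (mvert mb).
Local Notation E := (marrow mb).
Local Notation idem := (@midem _ _ mb).
Implicit Types (w : seq E) (b : pred (seq E)).

Definition wprod w : A := \prod_(a <- w) marr a.

Lemma wprod_cat w w' : wprod (w ++ w') = wprod w * wprod w'.
Proof. exact: big_cat. Qed.

Definition nwords := size (mwords mb).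
Definition word (i : 'I_nwords) : seq E := nth [::] (mwords mb) i.
Definition jbasis : nwords.-tuple A := [tuple wprod (word i) | i < nwords].
Definition jac : {vspace A} := <<jbasis>>%VS.

Lemma jbasisE (i : 'I_nwords) : jbasis`_i = wprod (word i).
Proof. by rewrite -tnth_nth tnth_mktuple. Qed.

Lemma jbasis_map : jbasis = [seq wprod w | w <- mwords mb] :> seq A.
Proof.
apply: (@eq_from_nth _ 0) => [|i]; rewrite size_tuple ?size_map // => lt.
by rewrite (jbasisE (Ordinal lt)) (nth_map [::]).
Qed.

Lemma jbasis_free : free jbasis.
Proof. by rewrite jbasis_map; exact: mwords_free. Qed.

Lemma word_neq0 i : word i != [::].
Proof. by apply: contraNneq (mwords_nil mb) => <-; rewrite mem_nth. Qed.

Lemma word_inj : injective word.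
Proof. by move=> i j /eqP; rewrite nth_uniq ?mwords_uniq // => /eqP/val_inj. Qed.

Lemma wordP w : w != [::] -> wprod w != 0 -> exists i, w = word i.
Proof.
move=> nw /(mem_mwords nw) /(nthP [::]) [i lt <-].
by exists (Ordinal lt).
Qed.

Lemma wprod_jac w : w != [::] -> wprod w \in jac.
Proof.
move=> nw; have [->|nz] := eqVneq (wprod w) 0; first exact: mem0v.
have [i ->] := wordP nw nz; rewrite -jbasisE; apply: memv_span.
by rewrite mem_nth // size_tuple.
Qed.

Lemma jacE x : x \in jac -> x = \sum_i coord jbasis i x *: wprod (word i).
Proof.
by move/coord_span => {1}->; apply: eq_bigr => i _; rewrite jbasisE.
Qed.

Lemma jac_ext (U : lmodType K) (f g : A -> U) : linear f -> linear g ->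
  (forall w, w != [::] -> f (wprod w) = g (wprod w)) -> forall x, x \in jac -> f x = g x.
Proof.
move=> lf lg e x /jacE ->.
pose f' : {linear A -> U} := HB.pack f (GRing.isLinear.Build _ _ _ _ f lf).
pose g' : {linear A -> U} := HB.pack g (GRing.isLinear.Build _ _ _ _ g lg).
rewrite -[LHS]/(f' _) -[RHS]/(g' _) !linear_sum; apply: eq_bigr => i _.
by rewrite !linearZ /= e // word_neq0.
Qed.

(** The projection onto the span of the words that satisfy [b]. *)
Definition wfilter b (x : A) : A :=
  \sum_(i | b (word i)) coord jbasis i x *: wprod (word i).

Lemma wfilter_linear b : linear (wfilter b).
Proof.
move=> k x y; rewrite /wfilter scaler_sumr -big_split; apply: eq_bigr => i _.
by rewrite linearP scalerDl scalerA.
Qed.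
HB.instance Definition _ b := GRing.isLinear.Build K A A _ (wfilter b) (wfilter_linear b).

Lemma wfilter_wprod b w : w != [::] -> wfilter b (wprod w) = if b w then wprod w else 0.
Proof.
move=> nw; have [->|nz] := eqVneq (wprod w) 0; first by rewrite linear0 if_same.
have [i ->] := wordP nw nz; rewrite /wfilter big_mkcond (bigD1 i) //= big1 => [|j nji].
  rewrite addr0 -jbasisE coord_free ?jbasis_free // eqxx jbasisE.
  by case: ifP; rewrite ?scale1r.
rewrite -jbasisE coord_free ?jbasis_free //.
have -> : (i == j) = false by rewrite eq_sym; exact: negbTE nji.
by rewrite scale0r if_same.
Qed.

Lemma wfilter_jac b x : wfilter b x \in jac.
Proof. by apply: memv_suml => i _; apply/memvZ/wprod_jac/word_neq0. Qed.

Lemma wfilter_id b x : (forall w, b w) -> x \in jac -> wfilter b x = x.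
Proof.
by move=> bT /jacE {2}->; apply: eq_bigl => i; rewrite bT.
Qed.

Lemma wfilter_comp b b' x : x \in jac -> wfilter b (wfilter b' x) = wfilter (predI b b') x.
Proof.
move: x; apply: jac_ext => [k u v|k u v|w nw]; rewrite ?linearP // !wfilter_wprod //=.
by case: (b' w); rewrite ?andbT ?andbF ?linear0 // wfilter_wprod.
Qed.

Lemma eq_wfilter b b' : b =1 b' -> wfilter b =1 wfilter b'.
Proof. by move=> e x; apply: eq_bigl => i; rewrite e. Qed.

Lemma wfilter_comm b b' x : x \in jac -> wfilter b (wfilter b' x) = wfilter b' (wfilter b x).
Proof.
by move=> jx; rewrite !wfilter_comp //; apply: eq_wfilter => w /=; rewrite andbC.
Qed.

Lemma wprod_idem w v : w != [::] ->
  wprod w * idem v = wprod w \/ wprod w * idem v = 0.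
Proof.
case/lastP: w => // w a _; rewrite /wprod -cats1 big_cat big_seq1 /=.
have [<-|n] := eqVneq (mtgt a) v; first by left; rewrite -mulrA marr_midem.
by right; rewrite -(marr_midem a) -!mulrA midemM (negPf n) !mulr0.
Qed.

Lemma idem_wprod w v : w != [::] ->
  idem v * wprod w = wprod w \/ idem v * wprod w = 0.
Proof.
case: w => // a w _; rewrite /wprod big_cons.
have [<-|n] := eqVneq (msrc a) v; first by left; rewrite mulrA midem_marr.
by right; rewrite -(midem_marr a) !mulrA midemM eq_sym (negPf n) !mul0r.
Qed.

Lemma span_idem_jac (x : A) : exists (c : V -> K) (y : A),
  y \in jac /\ x = \sum_v c v *: idem v + y.
Proof.
by have [c [y [jy ->]]] := midem_span mb x; exists c, y; rewrite /jac jbasis_map.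
Qed.

Lemma jac_stable (f : A -> A) x : linear f ->
  (forall w, w != [::] -> f (wprod w) \in jac) -> x \in jac -> f x \in jac.
Proof.
move=> lf H /jacE ->; pose f' : {linear A -> A} := HB.pack f (GRing.isLinear.Build _ _ _ _ f lf).
rewrite -[f _]/(f' _) linear_sum; apply: memv_suml => i _; rewrite linearZ.
by apply: memvZ; apply: H; exact: word_neq0.
Qed.

Lemma mulr_linear (a : A) : linear (fun x : A => x * a).
Proof. by move=> k x y; rewrite mulrDl scalerAl. Qed.
Lemma mull_linear (a : A) : linear (fun x : A => a * x).
Proof. by move=> k x y; rewrite mulrDr scalerAr. Qed.

Lemma cat_neq0l w w' : w != [::] -> w ++ w' != [::]. Proof. by case: w. Qed.
Lemma cat_neq0r w w' : w' != [::] -> w ++ w' != [::]. Proof. by case: w w' => // ? ? []. Qed.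

Lemma jac_mulr x a : x \in jac -> x * a \in jac.
Proof.
have [c [y [jy ->]]] := span_idem_jac a.
apply: (jac_stable (mulr_linear _)) => w nw; rewrite mulrDr mulr_sumr; apply: memvD.
  apply: memv_suml => v _; rewrite -scalerAr; apply: memvZ.
  by have [->|->] := wprod_idem v nw; [exact: wprod_jac | exact: mem0v].
apply: (jac_stable (mull_linear _)) jy => w' nw'; rewrite -wprod_cat.
by apply: wprod_jac; exact: cat_neq0l.
Qed.

Lemma jac_mull x a : x \in jac -> a * x \in jac.
Proof.
have [c [y [jy ->]]] := span_idem_jac a.
apply: (jac_stable (mull_linear _)) => w nw; rewrite mulrDl mulr_suml; apply: memvD.
  apply: memv_suml => v _; rewrite -scalerAl; apply: memvZ.
  by have [->|->] := idem_wprod v nw; [exact: wprod_jac | exact: mem0v].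
apply: (jac_stable (mulr_linear _)) jy => w' nw'; rewrite -wprod_cat.
by apply: wprod_jac; exact: cat_neq0l.
Qed.

Lemma idem_mul_jac (x : A) v : exists (k : K) y, y \in jac /\ idem v * x = k *: idem v + y.
Proof.
have [c [y [jy ->]]] := span_idem_jac x.
exists (c v), (idem v * y); split; first exact: jac_mull.
rewrite mulrDr mulr_sumr (bigD1 v) //= big1 => [|u nu]; rewrite -scalerAr midemM.
  by rewrite eqxx addr0.
by rewrite eq_sym (negPf nu) scaler0.
Qed.

Lemma wfilter_mull b v x : x \in jac -> wfilter b (idem v * x) = idem v * wfilter b x.
Proof.
move: x; apply: jac_ext => [k u u'|k u u'|w nw].
- by rewrite mulrDr linearD /= -scalerAr linearZ.
- by rewrite linearP mulrDr scalerAr.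
rewrite wfilter_wprod //; case: (idem_wprod v nw) => e; case: ifP => bw;
  rewrite ?mulr0 e ?linear0 // wfilter_wprod ?bw //.
Qed.

Lemma wfilter_mulr_idem b v x : x \in jac -> wfilter b (x * idem v) = wfilter b x * idem v.
Proof.
move: x; apply: jac_ext => [k u u'|k u u'|w nw].
- by rewrite mulrDl linearD /= -scalerAl linearZ.
- by rewrite linearP mulrDl scalerAl.
rewrite wfilter_wprod //; case: (wprod_idem v nw) => e; case: ifP => bw;
  rewrite ?mul0r e ?linear0 // wfilter_wprod ?bw //.
Qed.

(** Here [b] is a property of the beginning of a word, and [b'] keeps only words
    that are long enough to decide it. *)
Lemma wfilter_mulr b b' x a : x \in jac ->
  (forall w w', b' w -> b (w ++ w') = b w) ->
  wfilter b (wfilter b' x * a) = wfilter b (wfilter b' x) * a.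
Proof.
move=> jx H; move: x jx.
have [c [y [jy ->]]] := span_idem_jac a.
apply: jac_ext => [k u u'|k u u'|w nw].
- by rewrite linearP mulrDl linearD /= -scalerAl linearZ.
- by rewrite !linearP /= mulrDl scalerAl.
rewrite (wfilter_wprod b') //; case: ifP => b'w; last by rewrite linear0 !mul0r linear0.
rewrite !mulrDr linearD /= !mulr_sumr linear_sum; congr (_ + _).
  apply: eq_bigr => v _; rewrite -!scalerAr linearZ /=.
  by rewrite wfilter_mulr_idem // wprod_jac.
move: y jy; apply: jac_ext => [k u u'|k u u'|w' nw'].
- by rewrite mulrDr linearD /= -scalerAr linearZ.
- by rewrite mulrDr scalerAr.
rewrite -wprod_cat !wfilter_wprod ?cat_neq0l // H //.
by case: ifP; rewrite ?mul0r // wprod_cat.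
Qed.

Lemma wfilter_mul_word b b' (c : bool) w x : x \in jac ->
  (forall w', b' w' -> b (w' ++ w) = c) ->
  wfilter b (wfilter b' x * wprod w) = if c then wfilter b' x * wprod w else 0.
Proof.
move=> jx H; move: x jx; apply: jac_ext => [k u u'|k u u'|w' nw'].
- by rewrite linearP mulrDl linearD /= -scalerAl linearZ.
- by case: c {H}; rewrite ?scaler0 ?addr0 // linearP mulrDl scalerAl.
rewrite wfilter_wprod //; case: ifP => b'w; last by rewrite mul0r linear0 if_same.
by rewrite -wprod_cat wfilter_wprod ?cat_neq0l // H.
Qed.

Lemma wfilter_size_mul q x y : x \in jac -> y \in jac ->
  wfilter (fun w => (q < size w)%N) (x * wfilter (fun w => (q <= size w)%N) y)
  = x * wfilter (fun w => (q <= size w)%N) y.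
Proof.
move=> jx jy; move: x jx; apply: jac_ext => [k u u'|k u u'|w nw].
- by rewrite mulrDl linearD /= -scalerAl linearZ.
- by rewrite mulrDl scalerAl.
move: y jy; apply: jac_ext => [k u u'|k u u'|w' nw'].
- by rewrite linearP mulrDr linearD /= -scalerAr linearZ.
- by rewrite linearP mulrDr scalerAr.
rewrite wfilter_wprod //; case: ifP => qw; last by rewrite mulr0 linear0.
rewrite -wprod_cat wfilter_wprod ?cat_neq0l //= ifT //.
by rewrite size_cat -addn1 addnC leq_add // lt0n size_eq0.
Qed.

Definition wheight : nat := \max_(i < nwords) size (word i).

Lemma wprod_height w : (wheight < size w)%N -> wprod w = 0.
Proof.
move=> lt; apply/eqP/negP => /negP nz.
have nw : w != [::] by case: w lt {nz}.
have [i ew] := wordP nw nz; move: lt.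
by rewrite ltnNge /wheight ew (leq_bigmax_cond (F := fun i => size (word i))).
Qed.

Lemma wfilter_height x : wfilter (fun w => (wheight < size w)%N) x = 0.
Proof.
by rewrite /wfilter big1 // => i lt; rewrite wprod_height // scaler0.
Qed.

(** The factor [k + n] is invertible as [n] is nilpotent; concretely, [x] equals
    [- k^-1 n x], hence is made of arbitrarily long words. *)
Lemma jac_unit k n x : k != 0 -> n \in jac -> x \in jac -> (k *: 1 + n) * x = 0 -> x = 0.
Proof.
move=> nk jn jx; rewrite mulrDl -scalerAl mul1r => e.
have ex : x = (- k^-1 *: n) * x.
  have /eqP := e; rewrite addr_eq0 => /eqP kx.
  by rewrite -[LHS](scalerK nk) kx scalerN -scalerAl scaleNr.
have jn' : - k^-1 *: n \in jac by exact: memvZ.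
have fil q : wfilter (fun w => (q <= size w)%N) x = x.
  elim: q => [|q IH]; first exact: wfilter_id.
  by rewrite {1}ex -{1}IH wfilter_size_mul // IH -ex.
by rewrite -(fil wheight.+1); exact: wfilter_height.
Qed.
End Words.

(** * Projective covers *)

Lemma independent_mod_ex (K : fieldType) (U : vectType K) (W : {vspace U}) (s : seq U) :
  exists t : seq U, [/\ {subset t <= s}, (<<s>> <= <<t>> + W)%VS
    & forall c : 'I_(size t) -> K, \sum_i c i *: t`_i \in W -> forall i, c i = 0].
Proof.
elim: s => [|a s [t [ts st ind]]].
  by exists [::]; split=> //; [rewrite span_nil sub0v | move=> c _ []].
have [aW|naW] := boolP (a \in <<t>> + W)%VS.
  exists t; split=> // [x /ts xs|]; first by rewrite in_cons xs orbT.
  by rewrite span_cons subv_add -memvE aW st.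
exists (a :: t); split=> [x|| c].
- by rewrite !in_cons => /orP [->//|/ts ->]; rewrite orbT.
- rewrite !span_cons -addvA; apply: addvS => //; exact: subvv.
rewrite big_ord_recl /= => H.
have c0 : c ord0 = 0.
  apply/eqP/negP => /negP nz; case/negP: naW.
  have -> : a = (c ord0)^-1 *: (c ord0 *: a + \sum_(i < size t) c (lift ord0 i) *: t`_i)
              - (c ord0)^-1 *: (\sum_(i < size t) c (lift ord0 i) *: t`_i).
    by rewrite scalerDr addrK scalerA mulVf // scale1r.
  rewrite addrC; apply: memv_add; last exact: memvZ.
  rewrite memvN; apply: memvZ; apply: memv_suml => i _; apply: memvZ; apply: memv_span.
  by rewrite mem_nth.
move: H; rewrite c0 scale0r add0r => /ind H i.
by case: (unliftP ord0 i) => [j ->|->].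
Qed.

Section Cover.
Variables (K : fieldType) (A : falgType K) (mb : monomial_basis A).
Local Notation V := (mvert mb).
Local Notation E := (marrow mb).
Local Notation idem := (@midem _ _ mb).
Local Notation jac := (jac mb).
Implicit Types N L P W : rmod A.

Definition mul_jac N : {vspace N} :=
  (\sum_(i < nwords mb) (linfun (@ractr K A N (wprod (word i))) @: fullv))%VS.

Lemma mem_mul_jac N (y : N) a : a \in jac -> ract y a \in mul_jac N.
Proof.
move=> /jacE ->; rewrite linear_sum; apply: memv_suml => i _; rewrite linearZ /=.
apply: memvZ; apply: (subvP (sumv_sup i (erefl _) (subvv _))).
by apply/memv_imgP; exists y; rewrite ?memvf // lfunE.
Qed.

Lemma mul_jacP N (y : N) : y \in mul_jac N ->
  exists g : 'I_(nwords mb) -> N, y = \sum_i ract (g i) (wprod (word i)).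
Proof.
case/memv_sumP => h hP ->.
have ex i : exists g : N, h i = ract g (wprod (word i)).
  by have /memv_imgP [g _ ->] := hP i (erefl _); exists g; rewrite lfunE.
by have [g eg] := fin_all_exists ex; exists g; apply: eq_bigr => i _.
Qed.

(** Nakayama's lemma, by descending induction on the length of words. *)
Lemma mul_jac_generates N (X : {vspace N}) :
  submodule X -> (X + mul_jac N)%VS = fullv -> X = fullv.
Proof.
move=> sX XJ.
have dec (y : N) : exists2 x, x \in X & exists g : 'I_(nwords mb) -> N,
    y = x + \sum_i ract (g i) (wprod (word i)).
  have : y \in (X + mul_jac N)%VS by rewrite XJ memvf.
  by case/memv_addP => x xX [z /mul_jacP [g ->] ->]; exists x => //; exists g.
have H d (y : N) (w : seq E) : w != [::] -> (wheight mb < size w + d)%N ->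
    ract y (wprod w) \in X.
  elim: d y w => [|d IH] y w nw lt.
    by rewrite addn0 in lt; rewrite wprod_height // linear0 mem0v.
  have [x xX [g ->]] := dec y; rewrite ractDl ract_suml; apply: memvD; first exact: sX.
  apply: memv_suml => i _; rewrite ractA -wprod_cat; apply: IH.
    exact: cat_neq0r.
  have : (0 < size (word i))%N by rewrite lt0n size_eq0 word_neq0.
  by move: lt; rewrite size_cat; lia.
apply/vspaceP => y; rewrite memvf; have [x xX [g ->]] := dec y.
apply: memvD => //; apply: memv_suml => i _.
by apply: (H (wheight mb).+1); [exact: word_neq0 | rewrite addnS ltnS leq_addl].
Qed.

Section VertexProjective.
Variables (n : nat) (v : 'I_n -> V).

Lemma vertex_proj_ex : exists q : 'Hom(free_rmod A n, free_rmod A n),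
  rlinear q /\ forall z, q z = [ffun j => idem (v j) * (z : {ffun 'I_n -> A}) j].
Proof.
have [q eq] : exists q : 'Hom(free_rmod A n, free_rmod A n),
    forall z, q z = [ffun j => idem (v j) * (z : {ffun 'I_n -> A}) j].
  by apply: lfun_of_linear => k x y; apply/ffunP => j; rewrite !ffunE mulrDr scalerAr.
by exists q; split=> // z a; apply/ffunP => j; rewrite !eq !ffunE mulrA.
Qed.

(** The direct sum of the [e_{v_j} A], inside [A^n] so that elements have entries. *)
Lemma vertex_projective_ex : exists (P : rmod A) (s : 'Hom(P, free_rmod A n)),
  [/\ projective P, rlinear s, lker s == 0%VS &
     forall z, z \in limg s <-> forall j, idem (v j) * (z : {ffun 'I_n -> A}) j = (z : {ffun 'I_n -> A}) j].
Proof.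
have [q [lq eq]] := vertex_proj_ex.
have sq : submodule (limg q).
  by move=> _ a /memv_imgP [z _ ->]; rewrite -lq; exact: memv_img (memvf _).
have qq z : q (q z) = q z.
  by apply/ffunP => j; rewrite !eq !ffunE mulrA midemM eqxx.
have limP z : z \in limg q <-> forall j, idem (v j) * (z : {ffun 'I_n -> A}) j = (z : {ffun 'I_n -> A}) j.
  split=> [/memv_imgP [y _ ->] j|H]; first by rewrite eq ffunE mulrA midemM eqxx.
  have -> : z = q z by apply/ffunP => j; rewrite eq ffunE H.
  exact: memv_img (memvf _).
exists (sub_rmod sq), (sub_incl sq); split.
- have [r [lr er]] := sub_corestrict sq lq (subvv _).
  apply: (projective_retract (@free_projective K A n) (@sub_incl_rlinear _ _ _ _ sq) lr).
  apply/lfunP => x; rewrite id_lfunE comp_lfunE; apply: (lker0P (sub_incl_ker sq)).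
  have : sub_incl sq x \in limg q by rewrite sub_inclE subvsP.
  by case/memv_imgP => y _ e; rewrite -comp_lfunE er e qq.
- exact: sub_incl_rlinear.
- exact: sub_incl_ker.
by move=> z; rewrite limg_sub_incl.
Qed.
End VertexProjective.

(** Generators that are independent modulo the radical have all their relations
    in the radical. *)
Lemma minimal_cover N (S : seq N) :
  <<S>>%VS = fullv -> (forall s, s \in S -> exists v, ract s (idem v) = s) ->
  exists (n : nat) (x : 'I_n -> N) (v : 'I_n -> V) (L P : rmod A)
    (i : 'Hom(L, P)) (p : 'Hom(P, N)) (e : 'Hom(L, free_rmod A n)),
  [/\ forall j, x j \in S, projective P, ses i p
    & [/\ rlinear e, lker e == 0%VS, forall z j, (e z : {ffun 'I_n -> A}) j \in jac
        & forall z, z \in limg e <-> free_map x z = 0 /\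
            forall j, idem (v j) * (z : {ffun 'I_n -> A}) j = (z : {ffun 'I_n -> A}) j]].
Proof.
move=> spanS vS; have [t [tS st ind]] := independent_mod_ex (mul_jac N) S.
pose n := size t; pose x (j : 'I_n) := t`_j.
have xS j : x j \in S by apply: tS; rewrite mem_nth.
have [v ev] := fin_all_exists (fun j => vS _ (xS j)).
have [P [s [pP ls ks limP]]] := vertex_projective_ex v.
have [q [lq eq]] := vertex_proj_ex v.
have lf := free_map_rlinear x; set f := free_map x in lf *.
have fq z : f (q z) = f z.
  by rewrite /f !free_mapE; apply: eq_bigr => j _; rewrite eq ffunE -ractA ev.
have sf : surj f.
  apply: mul_jac_generates.
    by move=> _ a /memv_imgP [z _ ->]; rewrite -lf; exact: memv_img (memvf _).
  apply/eqP; rewrite eqEsubv subvf -spanS (subv_trans st) // addvS ?subvv //.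
  apply/span_subvP => y /(nthP 0) [j lj <-].
  rewrite -[t`_j]/(x (Ordinal lj)) -(free_map_gen x); exact: memv_img (memvf _).
have sp : surj (f \o s)%VF.
  apply: surjW => y; have [z <-] := surjP sf y.
  have : q z \in limg s by apply/limP => j; rewrite eq ffunE mulrA midemM eqxx.
  by case/memv_imgP => u _ eu; exists u; rewrite comp_lfunE -eu fq.
have lp : rlinear (f \o s)%VF by exact: rlinear_comp.
have ses_p := ses_kernel lp sp.
set L := sub_rmod _ in ses_p; set i := sub_incl _ in ses_p.
have [li _ ki ei _] := ses_p.
have limE z : z \in limg (s \o i)%VF <-> f z = 0 /\
    forall j, idem (v j) * (z : {ffun 'I_n -> A}) j = (z : {ffun 'I_n -> A}) j.
  split=> [/memv_imgP [u _ ->]|[fz /limP /memv_imgP [u _ zu]]].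
    split; first by rewrite comp_lfunE -[f _]comp_lfunE (ses_comp0 _ ses_p).
    by apply/limP; rewrite comp_lfunE; exact: memv_img (memvf _).
  have [|l ul] := ses_ker (y := u) ses_p; first by rewrite comp_lfunE -zu.
  by rewrite zu ul -comp_lfunE; exact: memv_img (memvf _).
exists n, x, v, L, P, i, (f \o s)%VF, (s \o i)%VF; split=> //; split=> //.
- exact: rlinear_comp.
- by apply/lker0P => a b; rewrite !comp_lfunE => /(lker0P ks)/(lker0P ki).
move=> u; have /limE [] : (s \o i)%VF u \in limg (s \o i)%VF by exact: memv_img (memvf _).
set z : {ffun 'I_n -> A} := (s \o i)%VF u => fz zv.
have ex j : exists (c : K) , z j - c *: idem (v j) \in jac.
  have [c [y [jy e]]] := idem_mul_jac (z j) (v j).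
  by exists c; rewrite -zv e addrAC subrr add0r.
have [c ec] := fin_all_exists ex.
suff c0 j : c j = 0 by move=> j; have := ec j; rewrite c0 scale0r subr0.
apply: ind; rewrite -/n.
have -> : \sum_j c j *: t`_j = - \sum_j ract (x j) (z j - c j *: idem (v j)).
  rewrite -sumrN; apply/eqP; rewrite -subr_eq0 -sumrB.
  rewrite -[X in _ == X]fz free_mapE; apply/eqP; apply: eq_bigr => j' _.
  by rewrite linearB linearZ /= ev opprB /x opprB addrCA subrr addr0.
by rewrite memvN; apply: memv_suml => j' _; exact: mem_mul_jac.
Qed.
End Cover.

(** * Labelled syzygies *)

Section Graded.
Variables (K : fieldType) (A : falgType K) (mb : monomial_basis A).
Local Notation V := (mvert mb).
Local Notation E := (marrow mb).
Local Notation idem := (@midem _ _ mb).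
Local Notation jac := (jac mb).
Implicit Types N L P W : rmod A.

Lemma wfilter_partition (T : eqType) (r : seq T) (g : seq E -> T) (x : A) : uniq r ->
  (forall i : 'I_(nwords mb), g (word i) \in r) -> x \in jac ->
  \sum_(u <- r) wfilter (fun w : seq E => g w == u) x = x.
Proof.
move=> ur gr /jacE ex; rewrite [RHS]ex /wfilter.
under eq_bigr do rewrite big_mkcond.
rewrite exchange_big /=; apply: eq_bigr => i _.
rewrite (bigD1_seq (g (word i))) //= eqxx big1 ?addr0 // => u nu.
by rewrite eq_sym (negPf nu).
Qed.

Section Labels.
Variables (k n : nat) (lam : 'I_n -> seq E).

Definition label_pred (u : seq E) j : pred (seq E) := fun w => lastn k (lam j ++ w) == u.

(** Homogeneous components. The generator of index [j] of [A^n] covers an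
    element of label [lam j], so that its multiple by [w] is labelled by the last
    letters of [lam j ++ w]. *)
Definition label_part u (x : free_rmod A n) : free_rmod A n :=
  [ffun j => wfilter (label_pred u j) ((x : {ffun 'I_n -> A}) j)].

(** The shape of iterated syzygies: contained in the radical of a projective, and
    homogeneous for the labels of length [k]. *)
Definition label_graded W (e : 'Hom(W, free_rmod A n)) : Prop :=
  [/\ rlinear e, lker e == 0%VS, forall x j, (e x : {ffun 'I_n -> A}) j \in jac
    & forall u x, label_part u (e x) \in limg e].

End Labels.

Lemma homogeneous_span k n (lam : 'I_n -> seq E) W (e : 'Hom(W, free_rmod A n)) :
  label_graded k lam e -> exists S : seq W, <<S>>%VS = fullv /\ forall s, s \in S ->
    (exists v, ract s (idem v) = s) /\ (exists u, label_part k lam u (e s) = e s).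
Proof.
move=> [le ke je ge].
pose Us := undup [seq lastn k (lam j ++ word i) | j <- enum 'I_n, i <- enum 'I_(nwords mb)].
pose h u (x : W) : W := (e^-1)%VF (label_part k lam u (e x)).
have hE u x : e (h u x) = label_part k lam u (e x) by rewrite limg_lfunVK.
clearbody h.
pose S := [seq ract (h ub.1 ub.2) (idem v) |
   ub <- [seq (u, b) | u <- Us, b <- vbasis {:W}], v <- enum V].
exists S; split.
  apply/eqP; rewrite eqEsubv subvf -(span_basis (vbasisP {:W})); apply/span_subvP => b bW.
  have -> : b = \sum_(u <- Us) \sum_v ract (h u b) (idem v).
    transitivity (\sum_(u <- Us) h u b); last first.
      by apply: eq_bigr => u _; rewrite -{1}(ract1 (h u b)) -(midem_sum mb) linear_sum.
    apply: (lker0P ke); rewrite linear_sum; apply/ffunP => j; rewrite sum_ffunE.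
    rewrite -[LHS](@wfilter_partition _ Us (fun w => lastn k (lam j ++ w))).
    - by apply: eq_bigr => u _; rewrite /= hE ffunE.
    - exact: undup_uniq.
    - by move=> i; rewrite mem_undup; apply/allpairsP; exists (j, i); rewrite !mem_enum.
    - exact: je.
  rewrite big_seq; apply: memv_suml => u uU; apply: memv_suml => v _; apply: memv_span.
  apply/allpairsP; exists ((u, b), v); split=> //; last by rewrite mem_enum.
  by apply/allpairsP; exists (u, b).
move=> s /allpairsP [[[u b] v] /= [_ _ ->]]; split.
  by exists v; rewrite ractA midemM eqxx.
exists u; rewrite le hE; apply/ffunP => j; rewrite !ffunE.
rewrite wfilter_mulr_idem ?wfilter_jac // wfilter_comp ?je //.
by congr (_ * _); apply: eq_wfilter => w /=; rewrite andbb.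
Qed.

(** If the entries of [X] are homogeneous of label [u], multiplication by [X]
    sends words [w] to combinations of words that all have the same last [k + 1]
    letters, those of [u w]. *)
Lemma wfilter_homogeneous_mul k l u (q : seq E) (X y : A) : X \in jac -> y \in jac ->
  wfilter (fun w : seq E => lastn k (l ++ w) == u) X = X ->
  wfilter (fun w : seq E => lastn k.+1 (l ++ w) == q) (X * y) =
  X * wfilter (fun w : seq E => lastn k.+1 (u ++ w) == q) y.
Proof.
move=> jX jy hX; move: y jy; apply: jac_ext => [c y y'|c y y'|w nw].
- by rewrite mulrDr linearD /= -scalerAr linearZ.
- by rewrite linearP mulrDr scalerAr.
rewrite -[in LHS]hX (wfilter_mul_word (c := lastn k.+1 (u ++ w) == q)) //.
  by rewrite hX wfilter_wprod //; case: ifP => _; rewrite ?mulr0.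
move=> w' /eqP <-; rewrite lastn_cat ?catA //.
by rewrite lt0n size_eq0.
Qed.

(** Each syzygy gains one letter. A relation [sum_i x_i a_i = 0] between
    homogeneous generators [x_i] of labels [u_i], with all [a_i] in the radical,
    takes place in [A^n], where the terms of [x_i w] all end in the last [k + 1]
    letters of [u_i w]; so it splits according to these letters. *)
Lemma graded_syzygy k n (lam : 'I_n -> seq E) W (e : 'Hom(W, free_rmod A n)) :
  label_graded k lam e ->
  exists n' (lam' : 'I_n' -> seq E) W' (e' : 'Hom(W', free_rmod A n')),
    label_graded k.+1 lam' e' /\
    exists P (i : 'Hom(W', P)) (p : 'Hom(P, W)), projective P /\ ses i p.
Proof.
move=> g; have [S [spanS hS]] := homogeneous_span g; have [le ke je _] := g.
have [n' [x [v [L [P [i [p [e' [xS pP s [le' ke' je' lime']]]]]]]]]] :=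
  minimal_cover spanS (fun s sS => proj1 (hS s sS)).
have [u eu] := fin_all_exists (fun j => proj2 (hS _ (xS j))).
exists n', u, L, e'; split; last by exists P, i, p.
split=> // q z; apply/lime'.
have /lime' [fz0 zv] : e' z \in limg e' by exact: memv_img (memvf _).
split; last first.
  by move=> j; rewrite ffunE -wfilter_mull ?je' // zv.
apply: (lker0P ke); rewrite linear0; apply/ffunP => j; rewrite [RHS]ffunE.
have fE y : (e (free_map x y) : {ffun 'I_n -> A}) j =
    \sum_l (e (x l) : {ffun 'I_n -> A}) j * (y : {ffun 'I_n' -> A}) l.
  rewrite free_mapE linear_sum sum_ffunE; apply: eq_bigr => l _.
  by rewrite -[LHS]/((e (ract (x l) ((y : {ffun 'I_n' -> A}) l)) : {ffun 'I_n -> A}) j) le ffunE.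
have := congr1 (fun y => wfilter (fun w : seq E => lastn k.+1 (lam j ++ w) == q)
                  ((e y : {ffun 'I_n -> A}) j)) fz0.
rewrite fE linear0 ffunE !linear0 => <-; rewrite fE linear_sum; apply: eq_bigr => l _.
rewrite ffunE /= (@wfilter_homogeneous_mul k (lam j) (u l)) //.
by have /ffunP/(_ j) := eu l; rewrite ffunE.
Qed.

Lemma graded_start M : exists n (lam : 'I_n -> seq E) W (e : 'Hom(W, free_rmod A n)),
  label_graded 0 lam e /\ nth_syzygy 1 M W.
Proof.
pose S := [seq ract b (idem v) | b <- vbasis {:M}, v <- enum V].
have spanS : <<S>>%VS = fullv.
  apply/eqP; rewrite eqEsubv subvf -(span_basis (vbasisP {:M})); apply/span_subvP => b bM.
  rewrite -(ract1 b) -(midem_sum mb) linear_sum; apply: memv_suml => v _; apply: memv_span.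
  by apply/allpairsP; exists (b, v); rewrite mem_enum.
have [|n [x [v [L [P [i [p [e [xS pP s [le ke je lime]]]]]]]]]] := minimal_cover (mb := mb) spanS.
  by move=> _ /allpairsP [[b v] /= [_ _ ->]]; exists v; rewrite ractA midemM eqxx.
exists n, (fun=> [::]), L, e; split; last by exists L, P, i, p.
split=> // u y.
have [<-|nu] := eqVneq [::] u.
  rewrite (_ : label_part _ _ _ _ = e y); first exact: memv_img (memvf _).
  apply/ffunP => j; rewrite ffunE wfilter_id ?je // => w.
  by rewrite /label_pred /lastn subn0 drop_size.
rewrite (_ : label_part _ _ _ _ = 0) ?mem0v //.
apply/ffunP => j; rewrite !ffunE /wfilter big1 // => w.
by rewrite /label_pred /lastn subn0 drop_size (negPf nu).
Qed.

Lemma graded_nth_syzygy k M : exists n (lam : 'I_n -> seq E) W (e : 'Hom(W, free_rmod A n)),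
  label_graded k lam e /\ nth_syzygy k.+1 M W.
Proof.
elim: k => [|k [n [lam [W [e [g sW]]]]]]; first exact: graded_start.
have [n' [lam' [W' [e' [g' [P [i [p [pP s]]]]]]]]] := graded_syzygy g.
exists n', lam', W', e'; split=> //; rewrite -addn1; apply: nth_syzygyD sW _.
by exists W', P, i, p.
Qed.
End Graded.

(** * Path ideals as direct summands *)

Section PathIdeals.
Variables (K : fieldType) (A : falgType K).

Lemma amullE (a x : A) : amull a x = a * x. Proof. by rewrite lfunE. Qed.

Lemma principal_submodule (a : A) : @submodule K A (reg_rmod A) (limg (amull a)).
Proof.
move=> _ b /memv_imgP [x _ ->]; apply/memv_imgP; exists (x * b); first exact: memvf.
by rewrite !amullE mulrA.
Qed.

(** The right ideal [a A]. *)
Definition principal_rmod (a : A) : rmod A := sub_rmod (@principal_submodule a).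

Lemma principalP (a : A) (b : principal_rmod a) : exists x, sub_incl (@principal_submodule a) b = a * x.
Proof.
have : sub_incl (@principal_submodule a) b \in limg (amull a) by rewrite sub_inclE subvsP.
by case/memv_imgP => x _ ->; exists x; rewrite amullE.
Qed.

Variable mb : monomial_basis A.
Local Notation V := (mvert mb).
Local Notation E := (marrow mb).
Local Notation idem := (@midem _ _ mb).
Local Notation jac := (jac mb).
Local Notation coef := (coord (jbasis mb)).
Local Notation lg := (fun i : 'I_(nwords mb) => size (word i)).
Implicit Types W : rmod A.

Lemma wfilter_left_factor (b : pred (seq E)) (w : seq E) (x : A) :
  (forall w', b w' -> exists s, w' = s ++ w) -> exists y, wfilter b x = y * wprod w.
Proof.
move=> H; exists (\sum_(i : 'I_(nwords mb) | b (word i))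
  coef i x *: wprod (take (size (word i) - size w) (word i))).
rewrite /wfilter mulr_suml; apply: eq_bigr => i bi; rewrite -scalerAl -wprod_cat.
have [s es] := H _ bi; congr (_ *: wprod _); rewrite {1}es.
by rewrite es size_cat addnK take_size_cat.
Qed.

Lemma wfilter_right_factor (b : pred (seq E)) (w : seq E) (x : A) :
  (forall w', b w' -> exists s, w' = w ++ s) -> exists y, wfilter b x = wprod w * y.
Proof.
move=> H; exists (\sum_(i : 'I_(nwords mb) | b (word i))
  coef i x *: wprod (drop (size w) (word i))).
rewrite /wfilter mulr_sumr; apply: eq_bigr => i bi; rewrite -scalerAr -wprod_cat.
by have [s es] := H _ bi; congr (_ *: wprod _); rewrite {1}es es drop_size_cat.
Qed.

(** The scalar part comes from [word i0] itself; the other words contribute proper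
    left factors, which lie in the radical. *)
Lemma wfilter_unit_factor (b : pred (seq E)) (i0 : 'I_(nwords mb)) (x : A) : b (word i0) ->
  (forall w', b w' -> exists s, w' = s ++ word i0) ->
  exists2 y, y \in jac & wfilter b x = (coef i0 x *: 1 + y) * wprod (word i0).
Proof.
move=> b0 H; exists (\sum_(i : 'I_(nwords mb) | b (word i) && (i != i0))
  coef i x *: wprod (take (size (word i) - size (word i0)) (word i))).
  apply: memv_suml => i /andP [bi ni]; apply/memvZ/wprod_jac.
  have [s es] := H _ bi; rewrite es size_cat addnK take_size_cat //.
  by apply: contraNneq ni => s0; apply/eqP/word_inj; rewrite es s0.
rewrite /wfilter (bigD1 i0) //= mulrDl -scalerAl mul1r; congr (_ + _).
rewrite mulr_suml; apply: eq_bigr => i /andP [bi _]; rewrite -scalerAl -wprod_cat.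
have [s es] := H _ bi; congr (_ *: wprod _); rewrite {1}es.
by rewrite es size_cat addnK take_size_cat.
Qed.

Section Split.
Variables (k n : nat) (lam : 'I_n -> seq E) (W : rmod A) (e : 'Hom(W, free_rmod A n)).
Hypotheses (ge : label_graded k lam e) (hk : (wheight mb <= k)%N).

Let entry (z : W) j : A := (e z : {ffun 'I_n -> A}) j.

Lemma word_le i : (size (word (mb := mb) i) <= wheight mb)%N.
Proof. exact: (leq_bigmax_cond (F := lg)). Qed.

Lemma shortest_entry : (fullv : {vspace W}) != 0%VS ->
  exists (z : W) (j : 'I_n) (i0 : 'I_(nwords mb)), coef i0 (entry z j) != 0 /\
    forall z' j' i, coef i (entry z' j') != 0 -> (size (word i0) <= size (word i))%N.
Proof.
move=> nW; have [le ke je _] := ge.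
pose P (i : 'I_(nwords mb)) := exists z j, coef i (entry z j) != 0.
have ex i : exists b : bool, b <-> P i.
  by have [p|np] := classic (P i); [exists true | exists false].
have [b eb] := fin_all_exists ex.
have [i1 b1] : exists i1, b i1.
  have nz : vpick {:W} != 0 by rewrite vpick0.
  have nez : e (vpick {:W}) != 0.
    by apply: contraNneq nz => e0; apply/eqP/(lker0P ke); rewrite e0 linear0.
  have [j nj] : exists j, entry (vpick {:W}) j != 0.
    apply/existsP; apply: contraNT nez => /existsPn H; apply/eqP/ffunP => j.
    by rewrite ffunE; apply/eqP; have := H j; rewrite negbK.
  have [i ni] : exists i, coef i (entry (vpick {:W}) j) != 0.
    apply/existsP; apply: contraNT nj => /existsPn H.
    rewrite [entry _ _](jacE (je (vpick {:W}) j)) big1 // => i _.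
    by have := H i; rewrite negbK => /eqP ->; rewrite scale0r.
  by exists i; apply/eb; exists (vpick {:W}), j.
case: (arg_minnP lg b1) => i0 /eb [z [j nz]] min.
by exists z, j, i0; split=> // z' j' i nz'; apply: min; apply/eb; exists z', j'.
Qed.

(** Take an entry of [W] on a shortest word [w]. All words in the homogeneous
    component [x] of its label then end in [w], so [w a |-> x a] is defined;
    reading off the part of an entry that starts with [w] is linear because no
    word of an entry is shorter than [w]; the composite is multiplication by a
    unit. *)
Lemma path_ideal_summand : (fullv : {vspace W}) != 0%VS ->
  exists (i0 : 'I_(nwords mb)) (io : 'Hom(principal_rmod (wprod (word i0)), W))
    (ro : 'Hom(W, principal_rmod (wprod (word i0)))),
    [/\ rlinear io, rlinear ro, lker (ro \o io)%VF == 0%VS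
      & forall u z z', ro z = 0 -> e z' = label_part k lam u (e z) -> ro z' = 0].
Proof.
move=> /shortest_entry [z [j0 [i0 [nz min]]]]; have [le ke je se] := ge.
set w := word i0; pose p := wprod w; pose u := lastn k (lam j0 ++ w).
have [x _ ex] := memv_imgP (se u z).
have long z' j : wfilter (fun w' : seq E => (size w <= size w')%N) (entry z' j) = entry z' j.
  rewrite [RHS](jacE (je z' j)) /wfilter big_mkcond; apply: eq_bigr => i _.
  case: ifP => // /negbT lt; apply/esym/eqP; rewrite scaler_eq0.
  by apply/orP; left; apply: contraNT lt; exact: min.
have xE j : entry x j = wfilter (predI (label_pred k lam u j) (fun w' => (size w <= size w')%N)) (entry z j).
  by rewrite /entry -ex ffunE -/(entry z j) -{1}[entry z j]long wfilter_comp // je.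
have ends j w' : predI (label_pred k lam u j) (fun w' => (size w <= size w')%N) w' ->
    exists s, w' = s ++ w.
  case/andP => /eqP eu lw; exists (take (size w' - size w) w').
  rewrite -{2}(@lastn_suffix _ k (lam j0) (lam j) w w') ?cat_take_drop //.
  exact: leq_trans (word_le i0) hk.
(* the entries of x are left multiples of w, hence so are those of x a *)
have ey j : exists y, entry x j = y * p by rewrite xE; apply: wfilter_left_factor; exact: ends.
have [y yp] := fin_all_exists ey.
pose incl := sub_incl (@principal_submodule p).
have lincl : rlinear incl by exact: sub_incl_rlinear.
have [g eg] : exists g : 'Hom(principal_rmod p, free_rmod A n),
    forall b, g b = [ffun j => y j * (incl b : A)].
  apply: lfun_of_linear => c b b'; apply/ffunP => j.
  by rewrite !ffunE linearP mulrDr scalerAr.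
have gx b a : incl b = p * a -> g b = e (ract x a).
  by move=> eb; apply/ffunP => j; rewrite eg ffunE eb mulrA -yp le ffunE.
have [||io [lio eio]] := factor_inj (f := g) le ke.
- by move=> b a; apply/ffunP => j; rewrite !eg !ffunE lincl mulrA.
- apply/subvP => _ /memv_imgP [b _ ->]; have [a ea] := principalP b.
  by rewrite (gx b a ea); exact: memv_img (memvf _).
(* the part of the entry of index j0 that starts with w *)
have [ro0 ero0] : exists ro0 : 'Hom(W, reg_rmod A),
    forall z', ro0 z' = wfilter (prefix w) (entry z' j0).
  apply: lfun_of_linear => c a a'.
  have -> : entry (c *: a + a') j0 = c *: entry a j0 + entry a' j0.
    by rewrite /entry linearP !ffunE.
  by rewrite linearP.
have lro0 : rlinear ro0.
  move=> z' a; rewrite !ero0 -[entry z' j0]long.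
  have -> : entry (ract z' a) j0 = entry z' j0 * a by rewrite /entry le ffunE.
  rewrite -{1}[entry z' j0]long wfilter_mulr ?je // => w1 w2 lw.
  rewrite !prefixE take_cat ltn_neqAle lw andbT.
  by have [->|//] := eqVneq (size w) (size w1); rewrite /= subnn take0 cats0 take_size.
have [|ro [lro ero]] := sub_corestrict (@principal_submodule p) lro0.
  apply/subvP => _ /memv_imgP [z' _ ->]; rewrite ero0.
  have [|b ->] := @wfilter_right_factor (prefix w) w (entry z' j0).
    by move=> w' /prefixP [s ->]; exists s.
  by rewrite -amullE; exact: memv_img (memvf _).
have roE z' : incl (ro z') = wfilter (prefix w) (entry z' j0).
  by rewrite -ero0 -ero comp_lfunE.
exists i0, io, ro; split=> //; last first.
  move=> q z1 z2 r0 e2; apply: (lker0P (sub_incl_ker (@principal_submodule p))).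
  rewrite -/incl linear0 roE /entry e2 ffunE wfilter_comm ?je //.
  by rewrite -/(entry z1 j0) -roE r0 !linear0.
apply/lker0P.
suff ker b : (ro \o io)%VF b = 0 -> b = 0.
  by move=> b b' eb; apply/eqP; rewrite -subr_eq0; apply/eqP/ker; rewrite linearB /= eb subrr.
rewrite comp_lfunE => rb0; have [a ea] := principalP b; rewrite -/incl in ea.
have iox : io b = ract x a.
  by apply: (lker0P ke); rewrite -comp_lfunE eio (gx b a ea).
have := congr1 incl rb0; rewrite iox linear0 -comp_lfunE ero lro0 ero0 xE.
rewrite wfilter_comp ?je //; set B := predI _ _.
have B0 : B w by rewrite /B /= prefix_refl leqnn /label_pred eqxx.
have [|m jm ->] := @wfilter_unit_factor B i0 (entry z j0) B0.
  by move=> w' /andP [_ H]; exact: ends H.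
rewrite -[ract _ a]/(_ * a) -mulrA -/w -/p -ea => eq0.
apply: (lker0P (sub_incl_ker (@principal_submodule p))); rewrite linear0.
apply: (jac_unit nz jm _ eq0); rewrite ea; apply: jac_mulr; apply: wprod_jac.
exact: word_neq0.
Qed.
End Split.

(** When labels are as long as the longest nonzero word, homogeneous elements have
    all their words among the ends of one label, and path ideals can be split off
    one after the other. *)
Lemma graded_biproduct k n (lam : 'I_n -> seq E) W (e : 'Hom(W, free_rmod A n)) :
  (wheight mb <= k)%N -> label_graded k lam e ->
  is_biproduct (fun i : 'I_(nwords mb) => principal_rmod (wprod (word i))) W.
Proof.
move=> hk; have [d] := ubnP (\dim {:W}); elim: d W e => // d IH W e dW ge.
have [W0|nW] := eqVneq (fullv : {vspace W}) 0%VS; first exact: biproduct0.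
have [i0 [io [ro [lio lro kro stab]]]] := path_ideal_summand ge hk nW.
have [le ke je se] := ge.
have sV := lker_submodule lro.
have sU : submodule (limg io).
  by move=> _ a /memv_imgP [x _ ->]; rewrite -lio; exact: memv_img (memvf _).
have kio : lker io == 0%VS.
  by apply/lker0P => x y exy; apply: (lker0P kro); rewrite !comp_lfunE exy.
have inj b : ro (io b) = 0 -> b = 0.
  by move=> e0; apply: (lker0P kro); rewrite comp_lfunE e0 linear0.
have UV0 : (limg io :&: lker ro)%VS = 0%VS.
  apply/eqP; rewrite -subv0; apply/subvP => y; rewrite memv_cap => /andP [/memv_imgP [b _ ->]].
  by rewrite memv_ker => /eqP/inj ->; rewrite linear0 mem0v.
have dU : \dim (limg io) = \dim {:principal_rmod (wprod (word i0))}.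
  by apply: limg_dim_eq; apply/eqP; rewrite (eqP kio) capv0.
have dW' : (\dim (lker ro) + \dim (limg ro) = \dim {:W})%N.
  by rewrite -(limg_ker_dim ro fullv) capfv.
have UV : (limg io + lker ro)%VS = fullv.
  apply/eqP; rewrite -(geq_leqif (dimv_leqif_eq (subvf _))) dimv_disjoint_sum //.
  by rewrite dU addnC -dW' leq_add2l dimvS ?subvf.
apply: (biproduct_submodules (sU := sU) (sV := sV)) => //.
  have [io' [lio' eio']] := sub_corestrict sU lio (subvv _).
  apply: (@biproduct_iso _ _ _ _ i0 _ io') => //.
    by apply/lker0P => x y exy; apply: (lker0P kio); rewrite -eio' !comp_lfunE exy.
  apply: surjW => y; have : vsval y \in limg io by exact: subvsP.
  case/memv_imgP => b _ eb; exists b; apply: (lker0P (sub_incl_ker sU)).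
  by rewrite -comp_lfunE eio' -eb sub_inclE.
apply: (IH _ (e \o sub_incl sV)%VF).
  rewrite dim_sub_rmod -ltnS (leq_trans _ dW) // ltnS -UV dimv_disjoint_sum //.
  rewrite -[X in (X < _)%N]add0n ltn_add2r dU lt0n dimv_eq0; apply/negP => /eqP P0.
  have p_in : wprod (word i0) \in limg (amull (wprod (word i0))).
    by apply/memv_imgP; exists 1; rewrite ?memvf // amullE mulr1.
  have : (vsproj (limg (amull (wprod (word i0)))) (wprod (word i0)) : principal_rmod _) \in fullv.
    exact: memvf.
  rewrite P0 memv0 => /eqP /(congr1 vsval); rewrite vsprojK // linear0.
  by apply/eqP; rewrite -jbasisE (free_not0 (jbasis_free mb)) // mem_nth // size_tuple.
split.
- exact: rlinear_comp (@sub_incl_rlinear _ _ _ _ sV) le.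
- by apply/lker0P => x y; rewrite !comp_lfunE => /(lker0P ke)/(lker0P (sub_incl_ker sV)).
- by move=> x j; rewrite comp_lfunE.
move=> u x; rewrite comp_lfunE.
have [y _ ey] := memv_imgP (se u (sub_incl sV x)); rewrite ey.
have yV : y \in lker ro.
  rewrite memv_ker; apply/eqP; apply: (stab u (sub_incl sV x)); last by [].
  by apply/eqP; rewrite -memv_ker sub_inclE; exact: subvsP.
apply/memv_imgP; exists (vsproj (lker ro) y : sub_rmod sV); first exact: memvf.
by rewrite comp_lfunE sub_inclE vsprojK.
Qed.
End PathIdeals.

(** * Monomial quiver algebras *)

Section OppositeBasis.
Variables (K : fieldType) (A : falgType K) (mb : monomial_basis A).

Let oarr (a : marrow mb) : opalg A := @marr K A mb a.

Let op_prod (w : seq (marrow mb)) :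
  \prod_(a <- w) oarr a = wprod (rev w) :> A.
Proof.
elim: w => [|a w IH]; first by rewrite /wprod !big_nil.
by rewrite big_cons opalgM IH rev_cons -cats1 wprod_cat /wprod big_seq1.
Qed.

Let op_words : [seq \prod_(a <- w) oarr a | w <- [seq rev w | w <- mwords mb]]
  = [seq wprod w | w <- mwords mb] :> seq A.
Proof. by rewrite -map_comp; apply: eq_map => w /=; rewrite op_prod revK. Qed.

Lemma opposite_monomial_basis : inhabited (monomial_basis (opalg A)).
Proof.
apply: inhabits.
apply: (@MonomialBasis K (opalg A) (mvert mb) (marrow mb) (@msrc _ _ mb) (@mtgt _ _ mb)
  (fun v => @midem K A mb v) oarr [seq rev w | w <- mwords mb]).
- exact: (midem_sum mb).
- by move=> u v; rewrite opalgM midemM eq_sym; case: eqP => // ->.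
- by move=> a; rewrite opalgM marr_midem.
- by move=> a; rewrite opalgM midem_marr.
- by rewrite map_inj_uniq ?mwords_uniq //; exact: (can_inj revK).
- by apply/mapP => -[[|a w] wm]; [rewrite (negPf (mwords_nil mb)) in wm |];
    move/(congr1 size); rewrite size_rev.
- move=> w nw; rewrite -[X in X != _ -> _]/(_ : A) op_prod => nz.
  apply/mapP; exists (rev w); last by rewrite revK.
  apply: mem_mwords nz; by apply: contraNneq nw => /(congr1 size)/eqP; rewrite size_rev size_eq0.
- rewrite op_words; exact: mwords_free.
- by move=> x; rewrite op_words; exact: midem_span.
Qed.
End OppositeBasis.

Lemma span_sandwich (K : fieldType) (R : algType K) (I : eqType) (T : R -> Prop) (f : I -> R)
    (r1 r2 r3 : seq I) (c1 c2 c3 : I -> K) :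
  T 0 -> (forall x y, T x -> T y -> T (x + y)) -> (forall k x, T x -> T (k *: x)) ->
  (forall i j l, j \in r2 -> T (f i * f j * f l)) ->
  T ((\sum_(i <- r1) c1 i *: f i) * (\sum_(j <- r2) c2 j *: f j) * (\sum_(l <- r3) c3 l *: f l)).
Proof.
move=> T0 TD TZ Tf; rewrite !mulr_suml; apply: big_ind => // i _.
rewrite mulr_sumr; apply: big_ind => // l _.
rewrite mulr_sumr mulr_suml big_seq; apply: big_ind => // j jr2.
by rewrite -!(scalerAl, scalerAr) !scalerA; apply: TZ; exact: Tf.
Qed.

Section PathProducts.
Variables (R : nzRingType) (Q : quiver) (g : qpath Q -> R).
Hypothesis gM : forall p q, g p * g q = oapp g 0 (pcat p q).
Local Notation aprod w := (\prod_(a <- w) g (arrow_path a)).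

Lemma triv_arrow v a : g (triv_path v) * g (arrow_path a) =
  if v == source a then g (arrow_path a) else 0.
Proof. by rewrite gM pcat1p; case: eqP. Qed.

Lemma arrow_triv a : g (arrow_path a) * g (triv_path (target a)) = g (arrow_path a).
Proof. by rewrite gM pcatp1 eqxx. Qed.

Lemma path_consP (p : qpath Q) a w : parrows p = a :: w -> pstart p = source a /\
  exists p', [/\ pstart p' = target a, parrows p' = w & pcat (arrow_path a) p' = Some p].
Proof.
move=> ap; have := valP p; rewrite -/(pstart p) -/(parrows p) ap => /andP [/eqP sa wk].
split=> //; pose p' : qpath Q := QPath (wk : walk (target a, w).1 (target a, w).2).
exists p'; split=> //.
apply: (inj_omap val_inj); rewrite pcat_val eqxx /=; congr Some.
by rewrite [RHS]surjective_pairing -/(pstart p) -/(parrows p) ap -sa.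
Qed.

Lemma arrows_prod w v (p : qpath Q) : pstart p = v -> parrows p = w ->
  g p = g (triv_path v) * aprod w.
Proof.
elim: w v p => [|a w IH] v p sp ap.
  rewrite big_nil mulr1; congr g; apply: val_inj.
  by case: p sp ap => -[v' w'] /= wk; rewrite /pstart /parrows /= => -> ->.
have [sa [p' [sp' ap' e]]] := path_consP ap.
have := gM (arrow_path a) p'; rewrite e /= => <-.
rewrite (IH _ _ sp' ap') mulrA arrow_triv big_cons mulrA triv_arrow.
by rewrite -sp sa eqxx.
Qed.

Lemma aprod_nonwalk w v : ~~ walk v w -> g (triv_path v) * aprod w = 0.
Proof.
elim: w v => [|a w IH] v // nw; rewrite big_cons mulrA triv_arrow.
case: eqP => [va|_]; last by rewrite mul0r.
rewrite -arrow_triv -mulrA IH ?mulr0 //.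
by apply: contraNN nw => wk; rewrite /= va eqxx.
Qed.

Lemma aprod_source a w : g (triv_path (source a)) * aprod (a :: w) = aprod (a :: w).
Proof. by rewrite big_cons mulrA triv_arrow eqxx. Qed.

Lemma aprodP w : w != [::] -> aprod w != 0 -> exists p, parrows p = w /\ aprod w = g p.
Proof.
case: w => // a w _; rewrite -aprod_source.
have [wk|/aprod_nonwalk ->] := boolP (walk (source a) (a :: w)); last by rewrite eqxx.
pose p : qpath Q := QPath (wk : walk (source a, a :: w).1 (source a, a :: w).2).
by exists p; rewrite -(@arrows_prod (a :: w) (source a) p).
Qed.

Lemma arrows_prod_nonempty p : parrows p != [::] -> g p = aprod (parrows p).
Proof.
case ep: (parrows p) => [|a w] // _; have [sa _] := path_consP ep.
by rewrite (arrows_prod sa ep) aprod_source.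
Qed.
End PathProducts.

Section QuiverBasis.
Variables (K : fieldType) (A : falgType K) (Q : quiver) (S : qpath Q -> Prop).
Local Notation KQ := (path_algebra K Q).
Local Notation pv := (@path_vec K Q).

Definition subpath_in (p : qpath Q) : Prop :=
  exists a s b, S s /\ obind (pcat a) (pcat s b) = Some p.

Lemma path_vecM p q : pv p * pv q = oapp pv 0 (pcat p q).
Proof. exact: path_mul_vec. Qed.

Lemma subpath_in_vec p : subpath_in p -> exists a s b, S s /\ pv p = pv a * pv s * pv b.
Proof.
move=> [a [s [b [Ss e]]]]; exists a, s, b; split=> //.
rewrite -mulrA path_vecM; case: (pcat s b) e => [t|] //= e.
by rewrite path_vecM e.
Qed.

Lemma subpath_in_ext p q r t : subpath_in p -> obind (pcat q) (pcat p r) = Some t -> subpath_in t.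
Proof.
move=> [a [s [b [Ss e]]]] et.
case sb: (pcat s b) e => [c|] //= ac.
have := pcatA a c r; rewrite ac /=.
case pr: (pcat p r) et => [d|] //= qd.
case cr: (pcat c r) => [f|] //= af.
have := pcatA q a f; rewrite af /= qd.
case qa: (pcat q a) => [g|] //= gf.
have := pcatA s b r; rewrite sb /= cr.
case br: (pcat b r) => [h|] //= sh.
by exists g, s, h; split=> //; rewrite sh /= -gf.
Qed.

(** The elements supported on paths that contain a path from [S] form a two-sided
    ideal. *)
Lemma path_ideal_support (x : KQ) p : path_ideal S x -> x@_p != 0 -> subpath_in p.
Proof.
move=> Ix; move: p; apply: (Ix (fun x => forall p, x@_p != 0 -> subpath_in p)); last first.
  move=> _ [q [Sq ->]] p; rewrite mcoeffU; case: (q =P p) => [<- _|_]; last by rewrite eqxx.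
  exists (triv_path (pstart q)), q, (triv_path (pend q)); split=> //.
  by rewrite pcatp1 eqxx /= pcat1p eqxx.
pose T (x : KQ) := forall p, x@_p != 0 -> subpath_in p.
have T0 : T 0 by move=> p; rewrite mcoeff0 eqxx.
have TD u v : T u -> T v -> T (u + v).
  move=> h1 h2 p; rewrite mcoeffD => nz.
  have [e1|] := eqVneq (u@_p) 0; last exact: h1.
  by apply: h2; move: nz; rewrite e1 add0r.
have TZ k u : T u -> T (k *: u).
  move=> h p; rewrite mcoeffZ => nz; apply: h.
  by apply: contraNneq nz => ->; rewrite mulr0.
split=> // x1 y z hy; rewrite -/(T _) in hy *.
rewrite (path_vecE x1) (path_vecE y) (path_vecE z).
apply: (@span_sandwich K KQ _ T) => // q r t ry p.
rewrite -mulrA path_vecM.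
case rt: (pcat r t) => [d|] /=; last by rewrite mulr0 mcoeff0 eqxx.
rewrite path_vecM; case qd: (pcat q d) => [f|] /=; last by rewrite mcoeff0 eqxx.
rewrite mcoeffU; case: (f =P p) => [<- _|_]; last by rewrite eqxx.
by apply: (@subpath_in_ext r q t); [apply: hy; rewrite mcoeff_neq0 | rewrite rt /= qd].
Qed.

Lemma path_ideal_vec p : subpath_in p -> path_ideal S (pv p).
Proof.
case/subpath_in_vec => a [s [b [Ss ->]]] I [_ _ Im] Is; apply: Im; apply: Is.
by exists s.
Qed.

Lemma path_pow w (p : qpath Q) : parrows p = w ->
  ideal_pow (@arrow_ideal K Q) (size w) (pv p).
Proof.
elim: w p => [|a w IH] p //= ap I HI H; apply: H.
have [sa [p' [sp' ap' e]]] := path_consP ap.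
exists (pv (arrow_path a)), (pv p'); split; last by rewrite path_vecM e.
  by move=> I' _ HI'; apply: HI'; exists a.
exact: IH.
Qed.

Variable pi : {lrmorphism KQ -> A}.
Hypotheses (pi_onto : forall a, exists x, pi x = a)
  (pi_ker : forall x, pi x = 0 <-> path_ideal S x) (adm : admissible (@path_ideal K Q S)).

Let g p : A := pi (pv p).
Let aprod w : A := \prod_(a <- w) g (arrow_path a).

Lemma pi_pathM p q : g p * g q = oapp g 0 (pcat p q).
Proof. by rewrite /g -rmorphM path_vecM; case: (pcat p q) => [t|] //=; rewrite rmorph0. Qed.

Lemma quiver_words : exists ws : seq (seq (arrow Q)), [/\ uniq ws, [::] \notin ws,
  forall w, w != [::] -> aprod w != 0 -> w \in ws & forall w, w \in ws -> aprod w != 0].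
Proof.
have [_ [m [m1 powI _]]] := adm.
have long w : (m <= size w)%N -> aprod w = 0.
  move=> mw; rewrite -(cat_take_drop m w) /aprod big_cat /=.
  have [->|nz] := eqVneq (\prod_(a <- take m w) g (arrow_path a)) 0; first by rewrite mul0r.
  have [|p [ap ep]] := aprodP pi_pathM _ nz.
    by rewrite -size_eq0 size_takel // -lt0n ltnW.
  rewrite ep (_ : g p = 0) ?mul0r //; apply/pi_ker; apply: powI.
  by have := path_pow ap; rewrite size_takel //; apply.
pose all := flatten [seq [seq val t | t : k.-tuple (arrow Q)] | k <- iota 1 m].
exists (undup [seq w <- all | aprod w != 0]); split.
- exact: undup_uniq.
- rewrite mem_undup mem_filter negb_and; apply/orP; right.
  apply/negP => /flattenP [_ /mapP [k kin ->] /mapP [t _ e]].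
  have k0 := size_tuple t; rewrite -[tval t]/(val t) -e in k0.
  by move: kin; rewrite -k0 mem_iota.
- move=> w nw nz; rewrite mem_undup mem_filter nz; apply/flattenP.
  exists [seq val t | t : (size w).-tuple (arrow Q)].
    apply/mapP; exists (size w) => //; rewrite mem_iota lt0n size_eq0 nw add1n ltnS.
    by apply: contraNT nz; rewrite -ltnNge => /ltnW/long ->.
  by apply/mapP; exists (in_tuple w); rewrite ?mem_enum.
by move=> w; rewrite mem_undup mem_filter => /andP [].
Qed.

Lemma quiver_words_free ws : uniq ws -> [::] \notin ws ->
  (forall w, w \in ws -> aprod w != 0) -> free [seq aprod w | w <- ws].
Proof.
move=> uws nws nzws; pose X := in_tuple [seq aprod w | w <- ws].
rewrite -[[seq _ | _ <- _]]/(X : seq A); apply/freeP => c sum0.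
have szX : size [seq aprod w | w <- ws] = size ws by rewrite size_map.
pose wd (i : 'I_(size [seq aprod w | w <- ws])) := nth [::] ws i.
have wdin i : wd i \in ws by rewrite mem_nth // -szX.
have wd0 i : wd i != [::] by apply: contraNneq nws => <-.
have [p ep] := fin_all_exists (fun i => aprodP pi_pathM (wd0 i) (nzws _ (wdin i))).
have Xi (i : 'I_(size [seq aprod w | w <- ws])) : X`_i = g (p i).
  by rewrite /X /= (nth_map [::]) -?szX // -(proj2 (ep i)).
have inI : path_ideal S (\sum_i c i *: pv (p i)).
  apply/pi_ker; rewrite linear_sum -[RHS]sum0; apply: eq_bigr => i _.
  by rewrite linearZ Xi.
move=> i; apply/eqP/negP => /negP nz.
have := nzws _ (wdin i); rewrite /aprod (proj2 (ep i)) => /eqP; apply.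
apply/pi_ker; apply: path_ideal_vec; apply: (path_ideal_support inI).
rewrite raddf_sum /= (bigD1 i) //= big1 => [|j nji].
  by rewrite mcoeffZ mcoeffUU mulr1 addr0.
rewrite mcoeffZ mcoeffU; case: (p j =P p i) => [e|_]; last by rewrite mulr0.
case/eqP: nji; apply: val_inj; apply/eqP.
have lt (l : 'I_(size [seq aprod w | w <- ws])) : (l < size ws)%N by rewrite -szX.
rewrite -(nth_uniq [::] (lt j) (lt i) uws); apply/eqP.
by rewrite -/(wd j) -/(wd i) -(proj1 (ep i)) -(proj1 (ep j)) e.
Qed.

Lemma quiver_monomial_basis : inhabited (monomial_basis A).
Proof.
have [ws [uws nws inws nzws]] := quiver_words.
apply: inhabits.
apply: (@MonomialBasis K A (vertex Q) (arrow Q) (@target Q) (@source Q)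
  (fun v => g (triv_path v)) (fun a => g (arrow_path a)) ws) => //.
- by rewrite /g -rmorph_sum; exact: rmorph1.
- by move=> u v; rewrite pi_pathM pcat1p; case: eqP.
- by move=> a; rewrite pi_pathM pcat1p eqxx.
- by move=> a; rewrite pi_pathM pcatp1 eqxx.
- exact: quiver_words_free.
move=> x; have [y <-] := pi_onto x; set J := <<_>>%VS.
pose T (x : A) := exists (c : vertex Q -> K) (y : A),
  y \in J /\ x = \sum_v c v *: g (triv_path v) + y.
rewrite -/(T _) (path_vecE y) linear_sum; apply: big_ind => [|a b|p _].
- exists (fun=> 0), 0; rewrite mem0v addr0; split=> //.
  by rewrite big1 // => v _; rewrite scale0r.
- move=> [c [z [jz ->]]] [c' [z' [jz' ->]]]; exists (fun v => c v + c' v), (z + z').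
  split; first exact: memvD.
  rewrite addrACA -big_split; congr (_ + _); apply: eq_bigr => v _.
  by rewrite scalerDl.
rewrite linearZ /= -/(g p); have [p0|np] := eqVneq (parrows p) [::].
  exists (fun v => if v == pstart p then y@_p else 0), 0; rewrite mem0v addr0; split=> //.
  rewrite (bigD1 (pstart p)) //= eqxx big1 => [|v nv].
    by rewrite addr0 (arrows_prod pi_pathM (erefl (pstart p)) p0) big_nil mulr1.
  by rewrite (negPf nv) scale0r.
exists (fun=> 0), (y@_p *: g p); split; last first.
  by rewrite big1 ?add0r // => v _; rewrite scale0r.
apply: memvZ; rewrite (arrows_prod_nonempty pi_pathM np).
have [->|nz] := eqVneq (\prod_(a <- parrows p) g (arrow_path a)) 0; first exact: mem0v.
by apply: memv_span; apply/mapP; exists (parrows p) => //; exact: inws.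
Qed.
End QuiverBasis.

(** * Weakly Gorenstein algebras *)

Section Conclusion.
Variables (K : fieldType) (A : falgType K).

Lemma left_weakly_Gorenstein_finite (t : nat) (X : 'I_t -> rmod A) n0 : (0 < n0)%N ->
  (forall N, exists Z, nth_syzygy n0 N Z /\ is_biproduct X Z) -> left_weakly_Gorenstein A.
Proof.
move=> n0_gt0 fin; apply: left_weakly_Gorenstein_torsionless => M.
exact: semi_Gproj_torsionless n0_gt0 fin.
Qed.
End Conclusion.

Lemma monomial_left_weakly_Gorenstein (K : fieldType) (A : falgType K) :
  inhabited (monomial_basis A) -> left_weakly_Gorenstein A.
Proof.
move=> [mb]; apply: (@left_weakly_Gorenstein_finite _ _ _
  (fun i : 'I_(nwords mb) => principal_rmod (wprod (word i))) (wheight mb).+1) => // N.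
have [n [lam [W [e [g sW]]]]] := graded_nth_syzygy mb (wheight mb) N.
by exists W; split=> //; exact: graded_biproduct (leqnn _) g.
Qed.

Lemma endo_left_weakly_Gorenstein (K : fieldType) (A B : falgType K) (M : rmod B) :
  representation_finite B -> iso_endo_alg A M ->
  left_weakly_Gorenstein A /\ left_weakly_Gorenstein (opalg A).
Proof.
move=> [t [X repB]] [phi [phi_inj phiP phi1 phiM]].
have phi_rl a : rlinear (phi a : 'Hom(M, M)) by apply/phiP; exists a.
have phi_onto (f : 'Hom(M, M)) : rlinear f -> exists a, f = phi a by move/phiP.
split.
  apply: (@left_weakly_Gorenstein_finite _ _ _ (fun i => homl_rmod phi_rl phi1 phiM (X i)) 2) => // N.
  apply: nth_syzygy2_kernel => n m d ld.
  have [Y [th [lth kth eth]]] := homl_kernel phi_rl phi_inj phi_onto phi1 phiM ld.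
  exists (homl_rmod phi_rl phi1 phiM Y), th; split=> //.
  by apply: homl_biproduct; exact: representation_finite_biproduct.
apply: (@left_weakly_Gorenstein_finite _ _ _ (fun i => homr_rmod phi_rl phi1 phiM (X i)) 2) => // N.
apply: nth_syzygy2_kernel => n m d ld.
have [Y [th [lth kth eth]]] := homr_kernel phi_rl phi_inj phi_onto phi1 phiM ld.
exists (homr_rmod phi_rl phi1 phiM Y), th; split=> //.
by apply: homr_biproduct; exact: representation_finite_biproduct.
Qed.

Theorem corollary3p6 (K : fieldType) (A : falgType K)
    (A_connected : connected_alg A) (A_nonsemisimple : ~ semisimple_alg A) :
  (monomial_quiver_algebra A -> weakly_Gorenstein A) /\
  ((exists (B : falgType K) (M : rmod B),
      [/\ connected_alg B, ~ semisimple_alg B, representation_finite B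
        & iso_endo_alg A M]) ->
   weakly_Gorenstein A).
Proof.
split.
  move=> [Q [S [adm [pi [onto ker]]]]].
  have [mb] := quiver_monomial_basis onto ker adm.
  split; first by apply: monomial_left_weakly_Gorenstein.
  apply: right_weakly_Gorenstein_op; apply: monomial_left_weakly_Gorenstein.
  exact: opposite_monomial_basis mb.
move=> [B [M [_ _ repB isoA]]].
have [lA lop] := endo_left_weakly_Gorenstein repB isoA.
by split=> //; exact: right_weakly_Gorenstein_op.
Qed.
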